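(* Let $\eta>0$, $\eta\neq1$. Let $\ell\in C([0,+\infty))$ be positive with $|\ell'(t)|<1$ for all $t\ge 0$, and put $L=\ell(0)$. Let $\varphi\in C^1([-L,+\infty))$ be real-valued with $\varphi'>0$ on $[-L,+\infty)$ and $\varphi(t+\ell(t))-\varphi(t-\ell(t))=2$ for all $t\ge 0$. Let $u^0\in H^1(0,L)$ with $u^0(0)=0$ and $u^1\in L^2(0,L)$, and let $u$ be the solution of $$\begin{cases} u_{tt}-u_{xx}=0, & 0<x<\ell(t),\ t>0,\\ (1+\eta\ell'(t))\,u_x(\ell(t),t)+(\eta+\ell'(t))\,u_t(\ell(t),t)=0, & t>0,\\ u(0,t)=0, & t>0,\\ u(x,0)=u^0(x),\quad u_t(x,0)=u^1(x), & 0<x<L.\end{cases}$$ Then, for $0\le t_0<t$, $$\frac{m(t)e^{-\ln|\gamma_\eta|\varphi(t+\ell(t))}}{M(t_0)e^{-\ln|\gamma_\eta|\varphi(t_0-\ell(t_0))}}E_\ell(t_0)\le E_\ell(t)\le\frac{M(t)e^{-\ln|\gamma_\eta|\varphi(t-\ell(t))}}{m(t_0)e^{-\ln|\gamma_\eta|\varphi(t_0+\ell(t_0))}}E_\ell(t_0).$$ Moreover, if $\varphi'$ is monotone for $t\in[t_0,t_1]$, where $0\le t_0<t_1$, then: (i) If $-1<\ell'(t)\le0$ on $[t_0,t_1]$, then $\varphi'$ is nondecreasing and $E_\ell(t)$ satisfies, for $t\in[t_0,t_1]$, $$\frac{\varphi'(t-\ell(t))e^{-\ln|\gamma_\eta|\varphi(t+\ell(t))}}{\varphi'(t_0+\ell(t_0))e^{-\ln|\gamma_\eta|\varphi(t_0-\ell(t_0))}}E_\ell(t_0)\le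 E_\ell(t)\le\frac{\varphi'(t+\ell(t))e^{-\ln|\gamma_\eta|\varphi(t-\ell(t))}}{\varphi'(t_0-\ell(t_0))e^{-\ln|\gamma_\eta|\varphi(t_0+\ell(t_0))}}E_\ell(t_0).$$ (ii) If $0<\ell'(t)<1$ on $[t_0,t_1]$, then $\varphi'$ and $E_\ell(t)$ are nonincreasing and, for $t\in[t_0,t_1]$, $$\frac{\varphi'(t+\ell(t))e^{-\ln|\gamma_\eta|\varphi(t+\ell(t))}}{\varphi'(t_0-\ell(t_0))e^{-\ln|\gamma_\eta|\varphi(t_0-\ell(t_0))}}E_\ell(t_0)\le E_\ell(t)\le\frac{\varphi'(t-\ell(t))e^{-\ln|\gamma_\eta|\varphi(t-\ell(t))}}{\varphi'(t_0+\ell(t_0))e^{-\ln|\gamma_\eta|\varphi(t_0+\ell(t_0))}}E_\ell(t_0).$$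
   Context: Energy: $E_\ell(t):=\frac12\int_0^{\ell(t)}u_t^2(x,t)+u_x^2(x,t)\,dx$ for $t\ge 0$. $\gamma_\eta:=\frac{1+\eta}{1-\eta}$. $m(t):=\min_{x\in[0,\ell(t)]}\{\varphi'(t-x),\varphi'(t+x)\}$ and $M(t):=\max_{x\in[0,\ell(t)]}\{\varphi'(t-x),\varphi'(t+x)\}$ (minimum and maximum over all $x\in[0,\ell(t)]$ and both listed quantities). The solution $u$ is the unique one with $u\in C([0,T];V_0(0,\ell(t)))\cap C^1([0,T];L^2(0,\ell(t)))$ for every $T>0$, where $V_0(0,\ell(t)):=\{w\in H^1(0,\ell(t)):w(0)=0\}$.
   Formalization: ''φ′ is monotone for t∈[t0,t1]'' is taken as: φ′ is monotone on [t0−ℓ(t0), t1+ℓ(t1)], the range of all arguments t±x with 0≤x≤ℓ(t); with monotonicity on [t0,t1] alone, (i) is false. The conclusions on φ′ are on that same interval. *)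

(* Defs.v *)
From HB Require Import structures.
From mathcomp Require Import all_boot all_order all_algebra.
From mathcomp Require Import all_classical all_reals all_analysis.

Set Implicit Arguments.
Unset Strict Implicit.
Unset Printing Implicit Defensive.
Import Order.TTheory GRing.Theory Num.Theory.
Import numFieldNormedType.Exports.

Local Open Scope classical_set_scope.
Local Open Scope ring_scope.

(* The derivative is one-sided at an end point of D that belongs to D. *)
Definition deriv_within {R : realType} (D : set R) (f df : R -> R) :=
  forall x, D x -> (fun y => (f y - f x) / (y - x)) @ within D x^' --> df x.

Definition inL2 {R : realType} (l : R) (w : R -> R) :=
  w \_ `]0, l[ \in Lfun (@lebesgue_measure R) 2%:E.

(* Test functions of class C^1 with compact support in the open interval. *)
Definition test1 {R : realType} (l : R) (psi dpsi : R -> R) :=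
  [/\ forall x : R, is_derive x 1 psi (dpsi x), continuous dpsi &
      exists a b, [/\ 0 < a, b < l & forall x, x \notin `[a, b] -> psi x = 0]].

(* w belongs to H^1(0, l) with weak derivative dw, and w is the continuous
   representative on [0, l], so that w 0 and w l are the traces. *)
Definition inH1 {R : realType} (l : R) (w dw : R -> R) :=
  [/\ inL2 l w, inL2 l dw, {within `[0, l], continuous w} &
      forall psi dpsi, test1 l psi dpsi ->
        \int[lebesgue_measure]_(x in `]0, l[) (w x * dpsi x) =
        - \int[lebesgue_measure]_(x in `]0, l[) (dw x * psi x)].

Definition inV0 {R : realType} (l : R) (w dw : R -> R) :=
  inH1 l w dw /\ w 0 = 0.

Definition L2norm {R : realType} (D : set R) (w : R -> R) : \bar R :=
  'N[@lebesgue_measure R]_(2%:E)[EFin \o (w \_ D)]%E.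

(* w in C([0, +oo[; L^2(0, ell t)): slices living on different intervals are
   compared after extension by zero. *)
Definition L2continuous {R : realType} (ell : R -> R) (w : R -> R -> R) :=
  forall t, 0 <= t ->
    (fun s => L2norm setT
       ((w^~ s) \_ `]0, ell s[ \- (w^~ t) \_ `]0, ell t[))
      @ within [set s | 0 <= s] (nbhs t) --> 0%E.

(* wt is the time derivative of w in L^2(0, ell t). The extension of w by zero
   jumps at x = ell t, hence is not differentiable in time with values in L^2;
   difference quotients are therefore taken on the common interval. *)
Definition L2deriv {R : realType} (ell : R -> R) (w wt : R -> R -> R) :=
  forall t, 0 <= t ->
    (fun s => L2norm `]0, Num.min (ell s) (ell t)[
       (fun x => (w x s - w x t) / (s - t) - wt x t))
      @ within [set s | 0 <= s] t^' --> 0%E.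

(* Space-time test functions: v of class C^1 on the plane, v(0, t) = 0, with
   support in time compact in ]0, +oo[; v is unconstrained at x = ell t. *)
Definition test2 {R : realType} (v vx vt : R -> R -> R) :=
  [/\ forall x t : R, is_derive x 1 (v^~ t) (vx x t) /\
                      is_derive t 1 (v x) (vt x t),
      continuous (fun z : R * R => vx z.1 z.2),
      continuous (fun z : R * R => vt z.1 z.2),
      forall t, v 0 t = 0 &
      exists a b, 0 < a /\ forall x t, t \notin `[a, b] -> v x t = 0].

(* Weak form of u_tt - u_xx = 0 with the boundary condition at x = ell t.
   Multiplying by v and applying the divergence theorem on 0 < x < ell t,
     \iint (u_x v_x - u_t v_t) - \int (u_x + ell' u_t)(ell t, t) v(ell t, t) dt
       = 0,
   while the boundary condition
     (1 + eta ell') u_x + (eta + ell') u_t = 0   at x = ell t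
   reads
     u_x + ell' u_t = - eta (u_t + ell' u_x) = - eta d/dt [u(ell t, t)].
   The last time derivative is moved onto v, which leaves only the trace of u
   itself on the moving end point. *)
Definition weak_wave {R : realType} (eta : R) (ell dell : R -> R)
    (u ux ut : R -> R -> R) :=
  forall v vx vt, test2 v vx vt ->
    \int[lebesgue_measure]_(t in `]0, +oo[)
      (\int[lebesgue_measure]_(x in `]0, ell t[)
         (ux x t * vx x t - ut x t * vt x t))
    = eta * \int[lebesgue_measure]_(t in `]0, +oo[)
        (u (ell t) t * (vt (ell t) t + dell t * vx (ell t) t)).

(* u is the solution with data u0, u1, in the class
   C([0, T]; V_0(0, ell t)) /\ C^1([0, T]; L^2(0, ell t)) for every T > 0;
   ux and ut are its space and time derivatives. *)
Record wave_solution {R : realType} (eta : R) (ell dell u0 u1 : R -> R)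
    (u ux ut : R -> R -> R) : Prop := WaveSolution {
  wave_V0 : forall t, 0 <= t -> inV0 (ell t) (u^~ t) (ux^~ t);
  wave_cont : L2continuous ell u;
  wave_contx : L2continuous ell ux;
  wave_L2t : forall t, 0 <= t -> inL2 (ell t) (ut^~ t);
  wave_deriv : L2deriv ell u ut;
  wave_contt : L2continuous ell ut;
  wave_weak : weak_wave eta ell dell u ux ut;
  wave_init0 : forall x, 0 < x < ell 0 -> u x 0 = u0 x;
  wave_init1 : {ae lebesgue_measure,
                  forall x, 0 < x < ell 0 -> ut x 0 = u1 x}
}.

Definition energy {R : realType} (ell : R -> R) (ux ut : R -> R -> R) (t : R) :=
  2^-1 * \int[lebesgue_measure]_(x in `]0, ell t[)
           ((ut x t) ^+ 2 + (ux x t) ^+ 2).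

Definition gamma {R : realType} (eta : R) : R := (1 + eta) / (1 - eta).

Definition dphi_values {R : realType} (ell dphi : R -> R) (t : R) : set R :=
  [set y | exists2 x, 0 <= x <= ell t & y = dphi (t - x) \/ y = dphi (t + x)].

(* The infimum and the supremum are attained, dphi being continuous. *)
Definition mmin {R : realType} (ell dphi : R -> R) (t : R) : R :=
  inf (dphi_values ell dphi t).

Definition mmax {R : realType} (ell dphi : R -> R) (t : R) : R :=
  sup (dphi_values ell dphi t).

(* exp(- ln|gamma_eta| y) *)
Definition decay {R : realType} (eta y : R) : R :=
  expR (- ln `|gamma eta| * y).

(* Main.v *)
Require Import Defs.
From HB Require Import structures.
From mathcomp Require Import all_boot all_order all_algebra.
From mathcomp Require Import all_classical all_reals all_analysis.
From mathcomp Require Import measurable_realfun ring lra.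
Import Order.TTheory GRing.Theory Num.Theory.
Import numFieldNormedType.Exports.
Local Open Scope classical_set_scope.
Local Open Scope ring_scope.
Set Implicit Arguments.
Unset Strict Implicit.
Unset Printing Implicit Defensive.

(* Let p = ut + ux, q = ut - ux and kap = (eta - 1) / (eta + 1). If a is of class
   C^1 and a (t - ell t) = kap * a (t + ell t), testing the weak formulation with
   chi t * (a (t + x) - a (t - x)) and integrating by parts in x shows that
     J_a t = \int (p a (t + x) - q a (t - x)) dx
   is constant: this is d'Alembert's formula in a dual form that makes sense for
   solutions of finite energy. By Legendre duality, for a weight om > 0,
     S t = \int (p^2 om (t + x) + q^2 om (t - x)) dx
         = sup_a (2 J_a t - \int_(t - ell t)^(t + ell t) a^2 / om),
   so the variation of S is controlled by that of the last integral, whose derivative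
   consists of boundary terms. For om = exp (ln |gamma| phi) / phi' they cancel, since
   |kap| = 1 / |gamma|, phi (t + ell t) = phi (t - ell t) + 2 and
   phi' (t + ell t) (1 + ell' t) = phi' (t - ell t) (1 - ell' t). Hence S is constant,
   and bounding om on [t - ell t, t + ell t] gives the estimates. For om = 1, S is four
   times the energy, and the boundary terms have a sign when ell' > 0. *)

(** * Convergence in L2 *)

(** At finite energy no trace of ut or ux at the moving end point is available, and smoothing the
    data would call for a theory of existence and stability. Duality moves all derivatives onto a,
    so that only the trace of u occurs. Two times s and t' are compared as follows: for a nearly
    optimal at t', S t' is almost 2 J_a t' minus the dual integral; J_a is the same at s; and S s is
    at least 2 J_a s minus the dual integral there. Nothing orders s and t', so one argument serves
    both directions of monotonicity. The optimal a is merely in L2, whence the density of test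
    functions. It is prescribed between t' - ell t' and t' + ell t' and continued by reflection,
    with factor kap on one side and 1 / kap on the other, which uses eta <> 1. The reflection is y
    -> Psi (Phi y + 2), where Phi extends phi and Psi inverts Phi. One reflection on each side
    covers |t - t'| <= ell t' only, so the comparison is local, and it is iterated in steps no
    longer than the minimum of ell on a compact interval. *)

Section integrable_real.
Context d (T : measurableType d) {R : realType}.
Variables (mu : {measure set T -> \bar R}) (D : set T).
Hypothesis mD : measurable D.
Implicit Types f g : T -> R.

Lemma itgD f g : mu.-integrable D (EFin \o f) ->
  mu.-integrable D (EFin \o g) -> mu.-integrable D (EFin \o (fun x => f x + g x)).
Proof. by move=> fi gi; have := integrableD mD fi gi; apply: eq_integrable. Qed.

Lemma itgB f g : mu.-integrable D (EFin \o f) ->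
  mu.-integrable D (EFin \o g) -> mu.-integrable D (EFin \o (fun x => f x - g x)).
Proof. by move=> fi gi; have := integrableB mD fi gi; apply: eq_integrable. Qed.

Lemma itgZ a f : mu.-integrable D (EFin \o f) ->
  mu.-integrable D (EFin \o (fun x => a * f x)).
Proof. by move=> fi; have := integrableZl mD a fi; apply: eq_integrable. Qed.

Lemma itg_sub f : mu.-integrable setT (EFin \o f) -> mu.-integrable D (EFin \o f).
Proof. by apply: integrableS. Qed.

End integrable_real.

Lemma cvg_pair_nbhs {R : realType} (T : Type) (F : set_system T) {FF : Filter F}
    (f g : T -> R) (a b : R) :
  f @ F --> a -> g @ F --> b -> (fun x => (f x, g x)) @ F --> ((a, b) : R * R).
Proof. by move=> fa gb; exact: (cvg_pair fa gb). Qed.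

Section L2.
Context {R : realType}.
Notation mu := (@lebesgue_measure R).
Notation L2 := (Lfun mu 2%:E).
Implicit Types (f g h : R -> R) (D : set R).

Lemma L2P f : f \in L2 <->
  measurable_fun setT f /\ mu.-integrable setT (EFin \o (fun x => f x ^+ 2)).
Proof.
split=> [fL|[mf /integrableP[_ fi]]].
  split; last exact: Lfun2_integrable_sqr.
  by move: fL; rewrite inE => /andP[]; rewrite inE.
rewrite inE; apply/andP; split; rewrite inE//= /finite_norm unlock/=.
apply: poweR_lty; apply: le_lt_trans fi; rewrite le_eqVlt; apply/orP; left.
apply/eqP/eq_integral => x _ /=.
by rewrite powR_mulrn// normrX.
Qed.

Lemma L2_measurable f : f \in L2 -> measurable_fun setT f.
Proof. by move=> /L2P[]. Qed.

Lemma L2B f g : f \in L2 -> g \in L2 -> (fun x => f x - g x) \in L2.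
Proof. by have h : (1 <= 2%:E :> \bar R)%E := lee1n 2; move=> fL gL; apply: (@rpredB _ (@Lfun _ _ _ mu 2%:E)). Qed.

Lemma L2D f g : f \in L2 -> g \in L2 -> (fun x => f x + g x) \in L2.
Proof. by have h : (1 <= 2%:E :> \bar R)%E := lee1n 2; move=> fL gL; apply: (@rpredD _ (@Lfun _ _ _ mu 2%:E)). Qed.

Lemma L2Z a f : f \in L2 -> (fun x => a * f x) \in L2.
Proof.
move=> fL; rewrite (_ : (fun x => _) = a \o* f); last by apply/funext => x /=; rewrite mulrC.
by apply: Lfun_scale => //; rewrite ler1n.
Qed.

Lemma L2_intM f g : f \in L2 -> g \in L2 ->
  mu.-integrable setT (EFin \o (fun x => f x * g x)).
Proof. by move=> fL gL; apply/Lfun1_integrable/Lfun2_mul_Lfun1. Qed.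

Lemma L2_intX f : f \in L2 -> mu.-integrable setT (EFin \o (fun x => f x ^+ 2)).
Proof. exact: Lfun2_integrable_sqr. Qed.

Lemma L2_le f g : measurable_fun setT f -> g \in L2 ->
  (forall x, `|f x| <= `|g x|) -> f \in L2.
Proof.
move=> mf gL fg; apply/L2P; split=> //.
apply: (le_integrable measurableT _ _ (L2_intX gL)) => /=.
  by apply/measurable_EFinP; apply: measurable_funX.
by move=> x _; rewrite lee_fin !normrX lerXn2r// nnegrE.
Qed.

Lemma L2_restrict f D : measurable D -> f \in L2 -> f \_ D \in L2.
Proof.
move=> mD fL; apply: (L2_le _ fL).
  have := L2_measurable fL; move/(measurable_funS measurableT (@subsetT _ D)).
  by move/(measurable_restrictT f mD).1.
by move=> x; rewrite patchE; case: ifP => _; rewrite ?normr0.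
Qed.

Lemma L2_bounded f (a b K : R) (i j : bool) :
  measurable_fun [set` Interval (BSide i a) (BSide j b)] f ->
  (forall x, [set` Interval (BSide i a) (BSide j b)] x -> `|f x| <= K) ->
  f \_ [set` Interval (BSide i a) (BSide j b)] \in L2.
Proof.
set D := [set` _] => mf fK.
have mD : measurable D by exact: measurable_itv.
apply/L2P; split; first by move/(measurable_restrictT f mD).1 : mf.
have : mu.-integrable D (EFin \o (fun x => f x ^+ 2)).
  apply: measurable_bounded_integrable => //.
  - have : (mu D < +oo)%E.
      by rewrite /D lebesgue_measure_itv; case: ifP => // _; rewrite -EFinD ltry.
    exact.
  - exact: measurable_funX.
  - exists (K ^+ 2); split; first exact: num_real.
    move=> y Ky x Dx /=; apply: le_trans (ltW Ky).
    by rewrite normrX lerXn2r ?nnegrE// ?(le_trans _ (fK _ Dx))//; exact: fK.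
move=> H; have := (@integrable_mkcond _ _ _ mu _ (EFin \o (fun x => f x ^+ 2)) mD).1 H; apply: eq_integrable => // x _ /=.
by rewrite !patchE; case: ifP => // _; rewrite expr0n.
Qed.

Lemma int_sqr_ge0 f : 0 <= \int[mu]_x (f x ^+ 2).
Proof. by apply: Rintegral_ge0 => x _; rewrite sqr_ge0. Qed.

Lemma int_quad f g (a b : R) : f \in L2 -> g \in L2 ->
  \int[mu]_x ((a * f x + b * g x) ^+ 2) = a ^+ 2 * \int[mu]_x (f x ^+ 2) +
  2 * a * b * \int[mu]_x (f x * g x) + b ^+ 2 * \int[mu]_x (g x ^+ 2).
Proof.
move=> fL gL.
have i1 := L2_intX fL; have i2 := L2_intX gL; have i3 := L2_intM fL gL.
have -> : \int[mu]_x ((a * f x + b * g x) ^+ 2) = \int[mu]_x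
    (a ^+ 2 * f x ^+ 2 + 2 * a * b * (f x * g x) + b ^+ 2 * g x ^+ 2).
  by apply: eq_Rintegral => x _; ring.
have j1 := itgZ measurableT (a ^+ 2) i1.
have j2 := itgZ measurableT (b ^+ 2) i2.
have j3 := itgZ measurableT (2 * a * b) i3.
rewrite RintegralD//; last exact: itgD.
by rewrite RintegralD// !RintegralZl.
Qed.

Lemma CauchySchwarz f g : f \in L2 -> g \in L2 ->
  (\int[mu]_x (f x * g x)) ^+ 2 <=
  \int[mu]_x (f x ^+ 2) * \int[mu]_x (g x ^+ 2).
Proof.
move=> fL gL.
have A0 := int_sqr_ge0 f; have C0 := int_sqr_ge0 g.
have Q a b : 0 <= a ^+ 2 * \int[mu]_x (f x ^+ 2) +
  2 * a * b * \int[mu]_x (f x * g x) + b ^+ 2 * \int[mu]_x (g x ^+ 2).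
  by rewrite -int_quad//; exact: int_sqr_ge0.
move: A0 C0 Q; set A := \int[mu]_x (f x ^+ 2); set C := \int[mu]_x (g x ^+ 2).
set B := \int[mu]_x (f x * g x) => A0 C0 Q.
have [C_eq0|C_neq0] := eqVneq C 0.
  have := Q 1 (- (A + 1) * B); rewrite C_eq0 => Q1.
  have : 0 <= A - 2 * (A + 1) * B ^+ 2 by move: Q1; lra.
  move=> Q2; have [->|B0] := eqVneq B 0; first by rewrite expr0n/= mulr0.
  (* With C = 0 the form is affine in its second argument; this choice gives it the value -1, which
     excludes B <> 0. *)
  have := Q 1 (- (A + 1) / (2 * B) ); rewrite C_eq0 mulr0.
  by rewrite (_ : 2 * 1 * (- (A + 1) / (2 * B)) * B = - (A + 1)); [lra|field].
have Cp : 0 < C by rewrite lt_def C_neq0.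
(* The ratio - B / C minimises the form; scaling by C avoids the division. *)
have := Q C (- B).
rewrite (_ : C ^+ 2 * A + 2 * C * - B * B + (- B) ^+ 2 * C = C * (A * C - B ^+ 2)); last by ring.
by rewrite pmulr_rge0// subr_ge0.
Qed.

Section L2cvg.
Context {T : Type} (F : set_system T) {FF : Filter F}.

(** Membership in L2 is part of the notion because the real integral of a nonintegrable square takes
    the default value 0, which would look like convergence. *)
Definition L2cvg (f_ : T -> R -> R) f :=
  [/\ \forall s \near F, f_ s \in L2, f \in L2 &
      (fun s => \int[mu]_x ((f_ s x - f x) ^+ 2)) @ F --> (0 : R)].

(** Both factors vary, since in the applications the kernel and the interval of integration move
    with time as well. With df, dg the differences, the error is df dg + df g + f dg; Cauchy-Schwarz
    bounds each term, and [e s] is the sum of the three bounds. *)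
Lemma L2cvg_ip (f_ g_ : T -> R -> R) f g : L2cvg f_ f -> L2cvg g_ g ->
  (fun s => \int[mu]_x (f_ s x * g_ s x)) @ F --> (\int[mu]_x (f x * g x) : R).
Proof.
move=> [fL_ fL f0] [gL_ gL g0].
set A := \int[mu]_x (f x ^+ 2); set C := \int[mu]_x (g x ^+ 2).
pose a s := \int[mu]_x ((f_ s x - f x) ^+ 2).
pose c s := \int[mu]_x ((g_ s x - g x) ^+ 2).
have a0 : a @ F --> (0 : R) by [].
have c0 : c @ F --> (0 : R) by [].
pose e s := Num.sqrt (a s * c s) + Num.sqrt (a s * C) + Num.sqrt (A * c s).
have e0 : e @ F --> (0 : R).
  rewrite -(addr0 0) -{1}(addr0 0) -[X in _ --> X + _ + _]sqrtr0.
  rewrite -[X in _ --> _ + X + _]sqrtr0 -[X in _ --> _ + _ + X]sqrtr0.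
  apply: cvgD; first apply: cvgD.
  - apply: continuous_cvg; first exact: sqrt_continuous.
    by rewrite -(mulr0 0); apply: cvgM.
  - apply: continuous_cvg; first exact: sqrt_continuous.
    by rewrite -(mul0r C); apply: cvgMl.
  - apply: continuous_cvg; first exact: sqrt_continuous.
    by rewrite -(mulr0 A); apply: cvgMr.
have CS u v : u \in L2 -> v \in L2 -> `|\int[mu]_x (u x * v x)| <=
    Num.sqrt (\int[mu]_x (u x ^+ 2) * \int[mu]_x (v x ^+ 2)).
  by move=> uL vL; rewrite -sqrtr_sqr; apply: ler_wsqrtr; exact: CauchySchwarz.

have ipD u v w z : u \in L2 -> v \in L2 -> w \in L2 -> z \in L2 ->
    \int[mu]_x (u x * v x) - \int[mu]_x (w x * z x) =
    \int[mu]_x ((u x - w x) * (v x - z x)) + \int[mu]_x ((u x - w x) * z x)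
    + \int[mu]_x (w x * (v x - z x)).
  move=> uL vL wL zL; have uw := L2B uL wL; have vz := L2B vL zL.
  have i1 := L2_intM uw vz; have i2 := L2_intM uw zL; have i3 := L2_intM wL vz.
  have i4 := L2_intM wL zL.
  apply/eqP; rewrite subr_eq; apply/eqP.
  rewrite -RintegralD// -RintegralD//; last exact: itgD.
  rewrite -RintegralD//; last exact: itgD _ (itgD _ _ _) _.
  by apply: eq_Rintegral => x _; ring.
apply/cvgrPdist_le => eps eps0.
move/cvgrPdist_le : e0 => /(_ _ eps0).
apply: filter_app; near=> s.
have fs : f_ s \in L2 by near: s.
have gs : g_ s \in L2 by near: s.
rewrite sub0r normrN distrC => H; apply: le_trans H.
rewrite ipD// (le_trans _ (ler_norm _))//.
rewrite (le_trans (ler_normD _ _))// lerD//; last by apply: CS => //; exact: L2B.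
by rewrite (le_trans (ler_normD _ _))// lerD//; apply: CS => //; exact: L2B.
Unshelve. all: by end_near. Qed.

Lemma L2cvgB (f_ g_ : T -> R -> R) f g : L2cvg f_ f -> L2cvg g_ g ->
  L2cvg (fun s x => f_ s x - g_ s x) (fun x => f x - g x).
Proof.
move=> [fL_ fL f0] [gL_ gL g0]; split; [|exact: L2B|].
  by apply: filterS2 fL_ gL_ => s; exact: L2B.
have h0 : (fun s => 2 * \int[mu]_x ((f_ s x - f x) ^+ 2)
    + 2 * \int[mu]_x ((g_ s x - g x) ^+ 2)) @ F --> (0 : R).
  rewrite -(addr0 0) -{1}(mulr0 2) -[X in _ --> _ + X](mulr0 2).
  by apply: cvgD; apply: cvgMr.
apply: squeeze_cvgr (cvg_cst 0) h0.
near=> s; rewrite int_sqr_ge0/=.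
have fs : f_ s \in L2 by near: s.
have gs : g_ s \in L2 by near: s.
have fB := L2B fs fL; have gB := L2B gs gL.
rewrite -!RintegralZl//; try exact: L2_intX.
rewrite -RintegralD//; try (apply: itgZ => //; exact: L2_intX).
apply: le_Rintegral => //.
- by apply: L2_intX; apply: L2B; exact: L2B.
- by apply: itgD => //; apply: itgZ => //; exact: L2_intX.
move=> x _; have := sqr_ge0 ((f_ s x - f x) + (g_ s x - g x)); nra.
Unshelve. all: by end_near. Qed.

End L2cvg.

Lemma L2cvg_cst {T : Type} (F : set_system T) {FF : Filter F} f :
  f \in L2 -> L2cvg F (fun=> f) f.
Proof.
move=> fL; split=> //; first exact: nearW.
rewrite (_ : (fun _ => _) = cst 0); first exact: cvg_cst.
apply/funext => s /=; rewrite (@eq_Rintegral _ _ _ _ _ (cst 0)).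
  by rewrite Rintegral_cst// mul0r.
by move=> x _; rewrite subrr expr0n.
Qed.

(** The squares of the differences are dominated by 4 g^2, which is integrable. *)
Lemma L2cvg_dominated (f_ : nat -> R -> R) f g :
  (forall n, measurable_fun setT (f_ n)) -> measurable_fun setT f ->
  g \in L2 -> (forall n x, `|f_ n x| <= g x) -> (forall x, `|f x| <= g x) ->
  {ae mu, forall x, f_ ^~ x @ \oo --> f x} -> L2cvg \oo f_ f.
Proof.
move=> mf mlim gL fg flg fcv.
have fnL n : f_ n \in L2.
  by apply: (L2_le (mf n) gL) => x; rewrite (le_trans (fg n x))// ler_norm.
have fL : f \in L2.
  by apply: (L2_le mlim gL) => x; rewrite (le_trans (flg x))// ler_norm.
split=> //; first exact: nearW.
have gi := itgZ measurableT 4 (L2_intX gL).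
have := @dominated_convergence _ _ _ mu setT measurableT
  (fun n => EFin \o (fun x => (f_ n x - f x) ^+ 2)) (cst 0%E) _ _ _ _ gi _.
move=> /(_ _ _ _ _)[||||_ _].
- move=> n; apply/measurable_EFinP; apply: measurable_funX.
  exact: (L2_measurable (L2B (fnL n) fL)).
- exact: measurable_cst.
- move: fcv; apply: filterS; first exact: (ae_filter_ringOfSetsType mu).
  move=> x fcv _; apply: cvg_EFin; first exact: nearW.
  have h : (fun n => f_ n x - f x) @ \oo --> (0 : R).
    by rewrite -(subrr (f x)); apply: cvgB; [exact: fcv|exact: cvg_cst].
  by rewrite -(mulr0 0); apply: (cvgM h h).
- apply: aeW => x n _ /=; rewrite lee_fin ger0_norm ?sqr_ge0//.
  have := fg n x; have := flg x; rewrite !ler_norml; nra.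
rewrite integral0 => /fine_cvg.
by apply: cvg_trans; apply: near_eq_cvg; exact: nearW.
Qed.

Lemma L2norm_eq D (w : R -> R) : w \_ D \in L2 ->
  L2norm D w = (Num.sqrt (\int[mu]_x ((w \_ D) x ^+ 2)))%:E.
Proof.
move=> wL; rewrite /L2norm unlock.
have -> : (\int[mu]_x (`|(EFin \o w \_ D) x| `^ 2) =
    (\int[mu]_x ((w \_ D) x ^+ 2))%:E)%E.
  rewrite /Rintegral fineK; last first.
    by apply: integrable_fin_num => //; exact: L2_intX.
  apply: eq_integral => x _ /=.
  by rewrite powR_mulrn// real_normK// num_real.
by rewrite poweR_EFin powR12_sqrt// int_sqr_ge0.
Qed.

(** The set [E s] is allowed to move because [L2deriv] measures its quotients on the interval common
    to two times. *)
Lemma L2norm_cvg {T : Type} (F : set_system T) {FF : Filter F}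
    (E : T -> set R) (w_ : T -> R -> R) :
  (\forall s \near F, (w_ s) \_ (E s) \in L2) ->
  (fun s => L2norm (E s) (w_ s)) @ F --> 0%E ->
  (fun s => \int[mu]_x (((w_ s) \_ (E s)) x ^+ 2)) @ F --> (0 : R).
Proof.
move=> wL /fine_cvg w0; rewrite -(mulr0 0).
apply: cvg_trans (cvgM w0 w0); apply: near_eq_cvg.
near=> s; have ws : (w_ s) \_ (E s) \in L2 by near: s.
by rewrite /= L2norm_eq//= -expr2 sqr_sqrtr// int_sqr_ge0.
Unshelve. all: by end_near. Qed.

Lemma L2cvg_comp {T U : Type} (F : set_system T) (G : set_system U)
    {FF : Filter F} (k : T -> U) (f_ : U -> R -> R) f :
  k @ F --> G -> L2cvg G f_ f -> L2cvg F (f_ \o k) f.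
Proof.
move=> kFG [fL_ fL f0]; split=> //; first exact: kFG fL_.
exact: (@cvg_comp _ _ _ k (fun s => \int[mu]_x ((f_ s x - f x) ^+ 2)) _ _ _ kFG f0).
Qed.

Lemma L2cvg_near {T : Type} (F : set_system T) {FF : Filter F}
    (f_ g_ : T -> R -> R) f :
  (\forall s \near F, f_ s = g_ s) -> L2cvg F f_ f -> L2cvg F g_ f.
Proof.
move=> fg [fL_ fL f0]; split=> //; first by apply: filterS2 fg fL_ => s ->.
by apply: cvg_trans f0; apply: near_eq_cvg; apply: filterS fg => s ->.
Qed.

Lemma ae_neq (c : R) : {ae mu, forall x : R, x != c}.
Proof.
exists [set c]; split=> //; first exact: lebesgue_measure_set1.
by move=> x /= /negP; rewrite negbK => /eqP.
Qed.

(** Dominated convergence works along sequences, hence the detour through [cvgr_dnbhsP]. Pointwise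
    convergence can fail only at x = l, a null set. *)
Lemma L2cvg_itv f (l : R) : f \in L2 ->
  L2cvg (nbhs l) (fun r => f \_ `]0, r[) (f \_ `]0, l[).
Proof.
move=> fL.
have fr r : f \_ `]0, r[ \in L2 by exact: L2_restrict.
split=> //; first exact: nearW.
pose J r := \int[mu]_x (((f \_ `]0, r[) x - (f \_ `]0, l[) x) ^+ 2).
have Jl : J l = 0.
  rewrite /J (@eq_Rintegral _ _ _ _ _ (cst 0)).
    by rewrite Rintegral_cst// mul0r.
  by move=> x _; rewrite subrr expr0n.
suff : J @ l --> J l by rewrite Jl.
apply/continuous_withinNx/cvgr_dnbhsP => v [_ vl]; rewrite Jl.
have nL : (fun x => `|f x|) \in L2.
  by apply: (L2_le _ fL) => [|x]; rewrite ?normr_id//;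
    apply: measurableT_comp => //; exact: L2_measurable.
have [] // := @L2cvg_dominated (fun n => f \_ `]0, v n[) (f \_ `]0, l[) _ _ _ nL.
- by move=> n; exact: L2_measurable.
- exact: L2_measurable.
- by move=> n x; rewrite patchE; case: ifP => // _; rewrite normr0.
- by move=> x; rewrite patchE; case: ifP => // _; rewrite normr0.
have := ae_neq l; apply: filterS; first exact: (ae_filter_ringOfSetsType mu).
move=> x xl.
apply: cvg_near_cst.
have [xl'|lx] := ltP x l.
  have : \forall n \near \oo, x < v n by exact: (cvgr_gt l vl).
  by apply: filterS => n xv; rewrite !patchE !mem_setE !in_itv/= xl' xv.
have lx' : l < x by rewrite lt_neqAle eq_sym xl.
have : \forall n \near \oo, v n < x by exact: (cvgr_lt l vl).
by apply: filterS => n xv; rewrite !patchE !mem_setE !in_itv/=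
  (ltNge x (v n)) (ltW xv) (ltNge x l) lx/= !andbF.
Qed.

Lemma itv_mu_fin (a b : R) (i j : bool) :
  (mu [set` Interval (BSide i a) (BSide j b)] < +oo)%E.
Proof.
by rewrite lebesgue_measure_itv; case: ifP => // _; rewrite -EFinD ltry.
Qed.

Lemma L2cvg_unif {T : Type} (F : set_system T) {FF : Filter F}
    (a b : R) (g_ : T -> R -> R) g : a <= b ->
  (\forall s \near F, (g_ s) \_ `[a, b] \in L2) -> g \_ `[a, b] \in L2 ->
  (forall e, 0 < e -> \forall s \near F, forall x, x \in `[a, b] ->
     `|g_ s x - g x| <= e) ->
  L2cvg F (fun s => (g_ s) \_ `[a, b]) (g \_ `[a, b]).
Proof.
move=> ab gL_ gL gu; split=> //.
apply/cvgrPdist_le => e e0.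
(* Chosen so that d^2 (b - a) <= e; the added 1 keeps the denominator positive when a = b. *)
pose d := Num.sqrt (e / (b - a + 1)).
have ba1 : 0 < b - a + 1 by rewrite ltr_wpDl// subr_ge0.
have d0 : 0 < d by rewrite sqrtr_gt0 divr_gt0.
near=> s; have gs : (g_ s) \_ `[a, b] \in L2 by near: s.
have gsu : forall x, x \in `[a, b] -> `|g_ s x - g x| <= d by near: s; exact: gu.
rewrite sub0r normrN ger0_norm ?int_sqr_ge0//.
have cL : (cst d) \_ `[a, b] \in L2.
  by apply: (@L2_bounded _ _ _ `|d|) => //= x _; rewrite lexx.
apply: (@le_trans _ _ (\int[mu]_x (((cst d) \_ `[a, b]) x ^+ 2))).
  apply: le_Rintegral => //; [exact/L2_intX/L2B|exact: L2_intX|].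
  move=> x _; rewrite !patchE; case: ifPn => xab.
    have := gsu x; rewrite inE in xab => /(_ xab).
    by move=> h; rewrite -real_normK ?num_real// lerXn2r ?nnegrE// ltW.
  by rewrite subrr.
have -> : \int[mu]_x (((cst d) \_ `[a, b]) x ^+ 2) =
    \int[mu]_x ((cst (d ^+ 2)) \_ `[a, b]) x.
  by apply: eq_Rintegral; move=> x _; rewrite !patchE; case: ifP => // _; rewrite expr0n.
rewrite -Rintegral_mkcond Rintegral_cst//= lebesgue_measure_itv/= lte_fin.
have sd : d ^+ 2 = e / (b - a + 1) by rewrite sqr_sqrtr// divr_ge0// ltW.
case: ifPn => _ /=; last by rewrite mulr0 ltW.
rewrite sd mulrAC ler_pdivrMr// ler_pM2l//; lra.
Unshelve. all: by end_near. Qed.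

Lemma continuous_L2 g (a b : R) : continuous g -> g \_ `[a, b] \in L2.
Proof.
move=> cg; have [ba|ab] := ltP b a.
  apply: (@L2_bounded _ _ _ 0) => [|x /=].
    by apply: measurable_funTS; exact: continuous_measurable_fun.
  by rewrite in_itv/= => /andP[ax /(le_trans ax)]; rewrite leNgt ba.
have cn : {within `[a, b], continuous (fun x => `|g x|)}.
  apply: continuous_subspaceT => x.
  by apply: continuous_comp; [exact: cg|exact: norm_continuous].
have [c _ cM] := EVT_max ab cn.
apply: (@L2_bounded _ _ _ `|g c|) => [|x xab]; last exact: cM.
by apply: measurable_funTS; exact: continuous_measurable_fun.
Qed.

(** At points close to x, both [k s] and [k t] are within e / 2 of [k t x] by joint continuity;
    compactness of the segment makes the neighbourhood of t independent of x. *)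
Lemma unif_cvg_compact (k : R -> R -> R) (a b t : R) :
  continuous (fun z : R * R => k z.1 z.2) -> forall e, 0 < e ->
  \forall s \near t, forall x, x \in `[a, b] -> `|k s x - k t x| <= e.
Proof.
move=> kc e e0.
have /compact_near_coveringP cpt : compact `[a, b] by exact: segment_compact.
apply: (cpt R (nbhs t) (fun s x => `|k s x - k t x| <= e)) => x xab.
have e20 : 0 < e / 2 by rewrite divr_gt0.
have /cvgrPdist_le/(_ _ e20) h1 := kc (t, x).
have : \forall z \near (x, t), `|k t x - k z.2 z.1| <= e / 2.
  have sw : (fun z : R * R => (z.2, z.1)) @ nbhs (x, t) --> nbhs (t, x).
    by apply: cvg_pair_nbhs; [exact: cvg_snd|exact: cvg_fst].
  exact: (sw _ h1).
have : \forall z \near (x, t), `|k t x - k t z.1| <= e / 2.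
  have sw : (fun z : R * R => (t, z.1)) @ nbhs (x, t) --> nbhs (t, x).
    by apply: cvg_pair_nbhs; [exact: cvg_cst|exact: cvg_fst].
  exact: (sw _ h1).
apply: filterS2 => z h2 h3.
by rewrite -(subrK (k t x) (k z.2 z.1)) -addrA (le_trans (ler_normD _ _))//
  (splitr e) lerD// distrC.
Qed.

Lemma L2cvg_unif_continuous (k : R -> R -> R) (a b t : R) : a <= b ->
  continuous (fun z : R * R => k z.1 z.2) ->
  L2cvg (nbhs t) (fun s => (k s) \_ `[a, b]) ((k t) \_ `[a, b]).
Proof.
move=> ab kc.
have kL s : (k s) \_ `[a, b] \in L2.
  apply: continuous_L2 => x.
  apply: (@continuous_comp _ _ _ (fun x : R => (s, x)) (fun z => k z.1 z.2)).
    by apply: cvg_pair_nbhs; [exact: cvg_cst|exact: cvg_id].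
  exact: kc.
by apply: L2cvg_unif => //; [exact: nearW|exact: unif_cvg_compact].
Qed.

End L2.

(** * Calculus *)

Lemma Rintegral_dominated d (T : measurableType d) (R : realType)
    (mu : {measure set T -> \bar R}) (D : set T) (f_ : nat -> T -> R)
    (f g : T -> R) :
  measurable D -> (forall n, measurable_fun D (f_ n)) ->
  mu.-integrable D (EFin \o g) -> (forall n x, D x -> `|f_ n x| <= g x) ->
  (forall x, D x -> f_ ^~ x @ \oo --> f x) ->
  (fun n => \int[mu]_(x in D) f_ n x) @ \oo --> (\int[mu]_(x in D) f x : R).
Proof.
move=> mD mf gi fg fcv.
have mlim : measurable_fun D f by apply: (measurable_fun_cvg (h:=f_)).
have flg x : D x -> `|f x| <= g x.
  move=> Dx; have h : (fun n => `|f_ n x|) @ \oo --> `|f x|.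
    by apply: cvg_norm; exact: fcv.
  apply: (ler_cvg_to h (cvg_cst (g x))).
  by apply: nearW => n; exact: fg.
have := @dominated_convergence _ _ _ mu D mD
  (fun n => EFin \o f_ n) (EFin \o f) _ _ _ _ gi _.
move=> /(_ _ _ _ _)[||||fi _].
- by move=> n; exact/measurable_EFinP/mf.
- exact/measurable_EFinP.
- by apply: aeW => x Dx; apply: cvg_EFin; [exact: nearW|exact: fcv].
- by apply: aeW => x n Dx; rewrite lee_fin; exact: fg.
rewrite -[X in _ --> X]fineK; last exact: integrable_fin_num.
move/fine_cvg; exact.
Qed.

Section calculus.
Context {R : realType}.
Notation mu := (@lebesgue_measure R).
Implicit Types (f g : R -> R).

(** The definitions speak of difference quotients on punctured neighbourhoods, the calculus of
    [is_derive]. Caratheodory's slope function, continuous at x, passes between the two. *)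
Lemma is_derive_quotP f (x d : R) :
  is_derive x 1 f d <-> (fun y => (f y - f x) / (y - x)) @ x^' --> d.
Proof.
rewrite is_derive1_caratheodory; split=> [[g [fg gc <-]]|fd].
  have /continuous_withinNx : {for x, continuous g} by [].
  apply: cvg_trans; apply: near_eq_cvg; near=> y.
  rewrite fg mulfK// subr_eq0; near: y; exact: nbhs_dnbhs_neq.
exists (fun y => if y == x then d else (f y - f x) / (y - x)); split.
- move=> z; case: eqVneq => [->|zx]; first by rewrite !subrr mulr0.
  by rewrite mulfVK// subr_eq0.
- apply/continuous_withinNx; rewrite eqxx; apply: cvg_trans fd.
  apply: near_eq_cvg; near=> y.
  rewrite ifN//; near: y; exact: nbhs_dnbhs_neq.
- by rewrite eqxx.
Unshelve. all: by end_near. Qed.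

Lemma is_derive_glue f g (c d : R) : f c = g c ->
  (fun y => (f y - f c) / (y - c)) @ c^'- --> d ->
  (fun y => (g y - g c) / (y - c)) @ c^'+ --> d ->
  is_derive c 1 (fun y => if y < c then f y else g y) d.
Proof.
move=> fgc fd gd; apply/is_derive_quotP; rewrite ltxx.
apply: (@cvg_at_right_left_dnbhs _ R^o).
- apply: cvg_trans gd; apply: near_eq_cvg; near=> y.
  by rewrite ltNge ltW//; near: y; exact: nbhs_right_gt.
- apply: cvg_trans fd; apply: near_eq_cvg; near=> y.
  by rewrite ifT ?fgc//; near: y; exact: nbhs_left_lt.
Unshelve. all: by end_near. Qed.

Lemma is_derive1_compf f g (x a b : R) : is_derive (g x) 1 f a ->
  is_derive x 1 g b -> is_derive x 1 (fun y => f (g y)) (a * b).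
Proof. by move=> fa gb; exact: (@is_derive1_comp _ f g). Qed.

Lemma is_derive_continuous f (df : R -> R) :
  (forall x : R, is_derive x 1 f (df x)) -> continuous f.
Proof.
move=> fd x; apply: differentiable_continuous; apply/derivable1_diffP.
by have [] := fd x.
Qed.

Lemma continuous_pos : continuous (fun y : R => Num.max 0 y).
Proof.
by move=> x; apply: continuous_max; [exact: cst_continuous|exact: cvg_id].
Qed.

(** A C^1 function that vanishes on a half line; shifted copies of it are combined into C^1
    cutoffs. *)
Definition pos2 (x : R) := (Num.max 0 x) ^+ 2.

Lemma is_derive_pos2 (x : R) : is_derive x 1 pos2 (2 * Num.max 0 x).
Proof.
have near_pos2 g d : (\forall y \near x, g y = pos2 y) ->
    is_derive x 1 g d -> is_derive x 1 pos2 d.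
  by move=> gE; exact: near_eq_is_derive.
have [x0|x0|->] := ltgtP x 0.
- apply: (near_pos2 (cst 0)); last by rewrite mulr0; exact: is_derive_cst.
  near=> y; rewrite /pos2 max_l ?expr0n//=; apply: ltW.
  by near: y; exact: lt_nbhsl.
- apply: (near_pos2 (fun y => y * y)).
    near=> y; rewrite /pos2 max_r ?expr2//; apply: ltW.
    by near: y; exact: lt_nbhsr.
  by apply: is_derive_eq; rewrite /GRing.scale/=; ring.
- rewrite mulr0; apply/is_derive_quotP.
  have h : (fun y : R => Num.max 0 y) @ (0 : R)^' --> (0 : R).
    apply: cvg_within_filter.
    have h0 : (fun y : R => Num.max 0 y) @ (0 : R) --> (Num.max 0 0 : R).
      exact: continuous_pos.
    by rewrite maxxx in h0.
  apply: cvg_trans h; apply: near_eq_cvg; near=> y.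
  have y0 : y != 0 by near: y; exact: nbhs_dnbhs_neq.
  rewrite /pos2 maxxx expr0n/= !subr0.
  by have [y1|y1] := leP y 0; rewrite ?expr0n/= ?mul0r// expr2 mulfK.
Unshelve. all: by end_near. Qed.

(* The coefficients make the derivative the hat function of height 2 on [0, 1]. *)
Definition step (x : R) := 2 * pos2 x - 4 * pos2 (x - 2^-1) + 2 * pos2 (x - 1).

Definition dstep (x : R) :=
  4 * Num.max 0 x - 8 * Num.max 0 (x - 2^-1) + 4 * Num.max 0 (x - 1).

Lemma is_derive_step (x : R) : is_derive x 1 step (dstep x).
Proof.
have sh a : is_derive x 1 (fun y => pos2 (y - a)) (2 * Num.max 0 (x - a)).
  rewrite -[X in is_derive _ _ _ X]mulr1.
  apply: (is_derive1_compf (is_derive_pos2 _)).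
  by apply: is_derive_eq; rewrite subr0.
have h0 := is_derive_pos2 x; have h1 := sh 2^-1; have h2 := sh 1.
by rewrite /step /dstep; apply: is_derive_eq; rewrite /GRing.scale/=; ring.
Qed.

Lemma continuous_dstep : continuous dstep.
Proof.
have sh a : continuous (fun y : R => Num.max 0 (y - a)).
  move=> x; apply: (@continuous_comp _ _ _ (fun y => y - a)).
    by apply: cvgB; [exact: cvg_id|exact: cvg_cst].
  exact: continuous_pos.
move=> x; apply: cvgD; first apply: cvgB.
- by apply: cvgMr; exact: continuous_pos.
- by apply: cvgMr; exact: sh.
- by apply: cvgMr; exact: sh.
Qed.

Lemma step_le0 (x : R) : x <= 0 -> step x = 0.
Proof. by move=> x0; rewrite /step /pos2 !max_l; lra. Qed.

Lemma step_ge1 (x : R) : 1 <= x -> step x = 1.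
Proof. by move=> x0; rewrite /step /pos2 !max_r; try lra; field. Qed.

Lemma step_itv (x : R) : 0 <= step x <= 1.
Proof.
have [x0|x0] := leP x 0; first by rewrite step_le0// lexx ler01.
have [x1|x1] := leP 1 x; first by rewrite step_ge1// ler01 lexx.
rewrite /step /pos2 (max_r (ltW x0)) (max_l (_ : x - 1 <= 0)); last by lra.
have [h|h] := leP (x - 2^-1) 0; apply/andP; split; nra.
Qed.

Lemma dstep_ge0 (x : R) : 0 <= dstep x.
Proof.
rewrite /dstep; have [|] := leP x 0; have [|] := leP (x - 2^-1) 0;
  have [|] := leP (x - 1) 0; lra.
Qed.

Lemma dstep_le0 (x : R) : x <= 0 -> dstep x = 0.
Proof. by move=> x0; rewrite /dstep !max_l; lra. Qed.

Lemma dstep_ge1 (x : R) : 1 <= x -> dstep x = 0.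
Proof. by move=> x0; rewrite /dstep !max_r; lra. Qed.

Lemma integral_oo_cc f (a b : R) : mu.-integrable `[a, b] (EFin \o f) ->
  \int[mu]_(x in `]a, b[) f x = \int[mu]_(x in `[a, b]) f x.
Proof.
move=> fi; rewrite Rintegral_itv_bndo_bndc; last first.
  apply: integrableS fi => //; exact: subset_itv_oo_cc.
rewrite Rintegral_itv_obnd_cbnd//.
apply: integrableS fi => //; exact: subset_itv_oc_cc.
Qed.

Lemma within_continuous_integrable f (a b : R) :
  {within `[a, b], continuous f} -> mu.-integrable `[a, b] (EFin \o f).
Proof.
by move=> fc; apply: continuous_compact_integrable => //; exact: segment_compact.
Qed.

Lemma within_continuous_integrable_oo f (a b : R) :
  {within `[a, b], continuous f} -> mu.-integrable `]a, b[ (EFin \o f).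
Proof.
move=> /within_continuous_integrable; apply: integrableS => //.
exact: subset_itv_oo_cc.
Qed.

Lemma FTC2 f F (a b : R) : a <= b -> (forall x, x \in `[a, b] -> is_derive x 1 F (f x)) ->
  {within `[a, b], continuous f} -> \int[mu]_(x in `]a, b[) f x = F b - F a.
Proof.
rewrite le_eqVlt => /predU1P[<- _ _|ab FD fc].
  by rewrite set_itv_ge ?bnd_simp ?ltxx// Rintegral_set0 subrr.
rewrite integral_oo_cc; last exact: within_continuous_integrable.
rewrite /Rintegral (@continuous_FTC2 _ f F)// => [|x xab].
- have Fc x : x \in `[a, b] -> {for x, continuous F}.
    move=> xab; apply: differentiable_continuous; apply/derivable1_diffP.
    by have [] := FD x xab.
  split.
  + by move=> x xab; have [] := FD x (subset_itv_oo_cc xab).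
  + by apply: cvg_at_right_filter; apply: Fc; rewrite in_itv/= lexx ltW.
  + by apply: cvg_at_left_filter; apply: Fc; rewrite in_itv/= lexx ltW.
- by rewrite derive1E; have [_ ->] := FD x (subset_itv_oo_cc xab).
Qed.

Lemma within_continuousP f (a b c e : R) : {within `[a, b], continuous f} ->
  c \in `[a, b] -> 0 < e ->
  exists2 d, 0 < d & forall x, x \in `[a, b] -> `|x - c| < d -> `|f c - f x| <= e.
Proof.
move=> /subspace_continuousP fc cab e0.
have /cvgrPdist_le/(_ _ e0) := fc c cab.
rewrite near_withinE => /nbhs_ballP[d /= d0 hd]; exists d => // x xab xcd.
by apply: hd => //=; rewrite /ball/= distrC.
Qed.

(** An approximate identity whose limit point may be an end of the segment, because the mass is
    counted inside [[a, b]]. This one-sided form turns the derivative of a cutoff into a boundary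
    value. *)
Lemma delta_cvg (rho : nat -> R -> R) (h : R -> R) (a b c : R) :
  c \in `[a, b] -> {within `[a, b], continuous h} ->
  (forall n, continuous (rho n)) -> (forall n x, 0 <= rho n x) ->
  (\forall n \near \oo, \int[mu]_(x in `[a, b]) rho n x = 1) ->
  (forall e, 0 < e -> \forall n \near \oo, forall x, e <= `|x - c| -> rho n x = 0) ->
  (fun n => \int[mu]_(x in `[a, b]) (h x * rho n x)) @ \oo --> h c.
Proof.
move=> cab hc rc r0 r1 rs; apply/cvgrPdist_le => e e0.
have [d d0 hd] := within_continuousP hc cab e0.
near=> n.
have rn1 : \int[mu]_(x in `[a, b]) rho n x = 1 by near: n.
have rns : forall x, d <= `|x - c| -> rho n x = 0 by near: n; exact: rs.
have rci : {within `[a, b], continuous (rho n)}.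
  by apply: continuous_subspaceT; exact: rc.
have hri : mu.-integrable `[a, b] (EFin \o (fun x => h x * rho n x)).
  apply: within_continuous_integrable => x.
  by apply: continuousM; [exact: hc|exact: rci].
have ri := within_continuous_integrable rci.
rewrite -[X in X - _]mulr1 -rn1 -RintegralZl// -RintegralB//; last exact: itgZ.
rewrite (le_trans (le_normr_Rintegral _ _))//; first exact: itgB _ (itgZ _ _ _) _.
rewrite -[leRHS]mulr1 -rn1 -RintegralZl//.
apply: le_Rintegral => //; last first.
- move=> x xab; rewrite -mulrBl normrM (ger0_norm (r0 _ _)).
  have [dx|xd] := leP d `|x - c|; first by rewrite rns// !mulr0.
  by rewrite ler_wpM2r//; exact: hd.
- exact: itgZ.
- by apply: integrable_norm; exact: itgB _ (itgZ _ _ _) _.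
Unshelve. all: by end_near. Qed.

End calculus.

(** * Weak derivatives *)

Section cutoff.
Context {R : realType}.
Notation mu := (@lebesgue_measure R).
Variables (a b : R).
Hypothesis ab : a < b.

(** The offset 4 makes [a, b] at least four meshes wide, so that the layer from a + mesh to a + 2
    mesh, where [cut] rises, and the one from b - 2 mesh to b - mesh, where it falls, do not overlap
    even for n = 0. *)
Definition mesh (n : nat) : R := (b - a) / (n%:R + 4).

Lemma mesh_gt0 n : 0 < mesh n.
Proof. by rewrite divr_gt0 ?subr_gt0// ltr_wpDl. Qed.

Lemma mesh_near e : 0 < e -> \forall n \near \oo, 2 * mesh n <= e.
Proof.
move=> e0; near=> n.
have n4 : 0 < n%:R + 4 :> R by rewrite ltr_wpDl.
rewrite /mesh mulrA ler_pdivrMr//.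
have : 2 * (b - a) / e <= n%:R by near: n; exact: nbhs_infty_ger.
by rewrite ler_pdivrMr//; nra.
Unshelve. all: by end_near. Qed.

Lemma mesh_inv n : (b - a) / mesh n = n%:R + 4.
Proof.
have n4 : n%:R + 4 != 0 :> R by rewrite gt_eqF// ltr_wpDl.
by rewrite /mesh; field; rewrite n4 gt_eqF// subr_gt0.
Qed.

Definition cut n (x : R) := step ((x - a) / mesh n - 1) - step ((x - b) / mesh n + 2).

(** The slopes of the two flanks of [cut]: unit masses that concentrate at a and at b from inside
    the interval. *)
Definition rhol n (x : R) := dstep ((x - a) / mesh n - 1) / mesh n.
Definition rhor n (x : R) := dstep ((x - b) / mesh n + 2) / mesh n.

Lemma is_derive_rhol n (x : R) :
  is_derive x 1 (fun x => step ((x - a) / mesh n - 1)) (rhol n x).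
Proof.
apply: (is_derive1_compf (is_derive_step _)).
by apply: is_derive_eq; rewrite /GRing.scale/=; ring.
Qed.

Lemma is_derive_rhor n (x : R) :
  is_derive x 1 (fun x => step ((x - b) / mesh n + 2)) (rhor n x).
Proof.
apply: (is_derive1_compf (is_derive_step _)).
by apply: is_derive_eq; rewrite /GRing.scale/=; ring.
Qed.

Lemma is_derive_cut n (x : R) : is_derive x 1 (cut n) (rhol n x - rhor n x).
Proof. exact: is_deriveB (is_derive_rhol n x) (is_derive_rhor n x). Qed.

Lemma continuous_rhol n : continuous (rhol n).
Proof.
move=> x; apply: cvgMl.
apply: (@continuous_comp _ _ _ (fun y => (y - a) / mesh n - 1)); last exact: continuous_dstep.
apply: cvgB; last exact: cvg_cst.
by apply: cvgMl; apply: cvgB; [exact: cvg_id|exact: cvg_cst].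
Qed.

Lemma continuous_rhor n : continuous (rhor n).
Proof.
move=> x; apply: cvgMl.
apply: (@continuous_comp _ _ _ (fun y => (y - b) / mesh n + 2)); last exact: continuous_dstep.
apply: cvgD; last exact: cvg_cst.
by apply: cvgMl; apply: cvgB; [exact: cvg_id|exact: cvg_cst].
Qed.

Lemma continuous_cut n : continuous (cut n).
Proof.
by apply: (@is_derive_continuous _ _ (fun x => rhol n x - rhor n x)) => x; exact: is_derive_cut.
Qed.

Lemma cut_le1 n (x : R) : `|cut n x| <= 1.
Proof.
rewrite /cut ler_norml.
have /andP[] := step_itv ((x - a) / mesh n - 1).
have /andP[] := step_itv ((x - b) / mesh n + 2).
lra.
Qed.

Lemma cut_supp n (x : R) : x \notin `[a + mesh n, b - mesh n] -> cut n x = 0.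
Proof.
have m0 := mesh_gt0 n; have mi := mesh_inv n.
have n0 : 0 <= n%:R :> R by [].
have ba : b - a = (n%:R + 4) * mesh n by rewrite -mi mulfVK// gt_eqF.
rewrite in_itv/= negb_and -!ltNge /cut => /orP[xa|xb].
  rewrite (_ : step ((x - a) / mesh n - 1) = 0); last first.
    by apply: step_le0; rewrite subr_le0 ler_pdivrMr// ; lra.
  rewrite step_le0 ?subrr//.
  rewrite -lerBrDr sub0r ler_pdivrMr//; nra.
rewrite (_ : step ((x - b) / mesh n + 2) = 1); last first.
  by apply: step_ge1; rewrite -lerBlDr ler_pdivlMr//; lra.
rewrite step_ge1 ?subrr//.
rewrite lerBrDr ler_pdivlMr//; nra.
Qed.

Lemma cut_cvg (x : R) : x \in `]a, b[ -> cut ^~ x @ \oo --> (1 : R).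
Proof.
rewrite in_itv/= => /andP[ax xb]; apply: cvg_near_cst.
near=> n; have m0 := mesh_gt0 n.
have h1 : 2 * mesh n <= x - a by near: n; apply: mesh_near; rewrite subr_gt0.
have h2 : 2 * mesh n <= b - x by near: n; apply: mesh_near; rewrite subr_gt0.
rewrite /cut step_ge1; last by rewrite lerBrDr ler_pdivlMr//; lra.
by rewrite step_le0 ?subr0// -lerBrDr ler_pdivrMr//; lra.
Unshelve. all: by end_near. Qed.

Lemma rhol_cvg (h : R -> R) : {within `[a, b], continuous h} ->
  (fun n => \int[mu]_(x in `[a, b]) (h x * rhol n x)) @ \oo --> (h a : R).
Proof.
move=> hc; apply: delta_cvg => //.
- by rewrite in_itv/= lexx ltW.
- exact: continuous_rhol.
- by move=> n x; rewrite divr_ge0 ?dstep_ge0// ltW// mesh_gt0.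
- apply: nearW => n; have m0 := mesh_gt0 n; have mi := mesh_inv n.
  have rc : {within `[a, b], continuous (rhol n)}.
    by apply: continuous_subspaceT; exact: continuous_rhol.
  rewrite -integral_oo_cc; last exact: within_continuous_integrable.
  have -> := @FTC2 _ (rhol n) (fun x => step ((x - a) / mesh n - 1)) a b (ltW ab)
    (fun x _ => is_derive_rhol n x) rc.
  rewrite mi step_ge1 ?subrr ?mul0r ?step_le0; first by rewrite subr0.
  + lra.
  + by have : 0 <= n%:R :> R by []; lra.
- move=> e e0; near=> n => x ex; have m0 := mesh_gt0 n.
  have me : 2 * mesh n <= e by near: n; exact: mesh_near.
  rewrite /rhol; have [xa|ax] := leP a x.
    rewrite dstep_ge1 ?mul0r// lerBrDr ler_pdivlMr//.
    by move: ex; rewrite ger0_norm ?subr_ge0//; lra.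
  by rewrite dstep_le0 ?mul0r// subr_le0 ler_pdivrMr//; lra.
Unshelve. all: by end_near. Qed.

Lemma rhor_cvg (h : R -> R) : {within `[a, b], continuous h} ->
  (fun n => \int[mu]_(x in `[a, b]) (h x * rhor n x)) @ \oo --> (h b : R).
Proof.
move=> hc; apply: delta_cvg => //.
- by rewrite in_itv/= lexx ltW.
- exact: continuous_rhor.
- by move=> n x; rewrite divr_ge0 ?dstep_ge0// ltW// mesh_gt0.
- apply: nearW => n; have m0 := mesh_gt0 n; have mi := mesh_inv n.
  have rc : {within `[a, b], continuous (rhor n)}.
    by apply: continuous_subspaceT; exact: continuous_rhor.
  rewrite -integral_oo_cc; last exact: within_continuous_integrable.
  have -> := @FTC2 _ (rhor n) (fun x => step ((x - b) / mesh n + 2)) a b (ltW ab)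
    (fun x _ => is_derive_rhor n x) rc.
  rewrite -(opprB b a) mulNr mi subrr mul0r step_ge1 ?step_le0; first by rewrite subr0.
  + by have : 0 <= n%:R :> R by []; lra.
  + lra.
- move=> e e0; near=> n => x ex; have m0 := mesh_gt0 n.
  have me : 2 * mesh n <= e by near: n; exact: mesh_near.
  rewrite /rhor; have [xb|bx] := leP b x.
    by rewrite dstep_ge1 ?mul0r// -lerBlDr ler_pdivlMr//; lra.
  rewrite dstep_le0 ?mul0r// -lerBrDr sub0r ler_pdivrMr//.
  by move: ex; rewrite ltr0_norm ?subr_lt0//; lra.
Unshelve. all: by end_near. Qed.

Lemma cut_int_cvg F : mu.-integrable `]a, b[ (EFin \o F) ->
  (fun n => \int[mu]_(x in `]a, b[) (F x * cut n x)) @ \oo -->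
  (\int[mu]_(x in `]a, b[) F x : R).
Proof.
move=> Fi; have mF : measurable_fun `]a, b[ F.
  by have /measurable_EFinP := measurable_int mu Fi.
apply: (@Rintegral_dominated _ _ _ _ _ _ _ (fun x => `|F x|)) => //.
- move=> n; apply: measurable_funM => //.
  by apply: measurable_funTS; apply: continuous_measurable_fun; exact: continuous_cut.
- exact: integrable_norm.
- by move=> n x _; rewrite normrM ler_piMr// cut_le1.
- move=> x xab; rewrite -[X in _ --> X]mulr1; apply: cvgMr.
  exact: cut_cvg.
Qed.

End cutoff.

Section weak_derivative.
Context {R : realType}.
Notation mu := (@lebesgue_measure R).

(** A free left end lets the notion serve twice: for space slices of u, and for the weak formulation
    regarded as an identity in time. *)
Definition test_in (a b : R) (psi dpsi : R -> R) :=
  [/\ forall x : R, is_derive x 1 psi (dpsi x), continuous dpsi &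
      exists a' b', [/\ a < a', b' < b & forall x, x \notin `[a', b'] -> psi x = 0]].

Lemma within_continuousM (f g : R -> R) (D : set R) : {within D, continuous f} ->
  {within D, continuous g} -> {within D, continuous (fun x => f x * g x)}.
Proof. by move=> fc gc x; apply: continuousM; [exact: fc|exact: gc]. Qed.

Lemma integrable_mul_continuous (a b : R) (f h : R -> R) :
  mu.-integrable `]a, b[ (EFin \o f) -> continuous h ->
  mu.-integrable `]a, b[ (EFin \o (fun x => f x * h x)).
Proof.
move=> fi hc; have [ba|ab] := leP b a.
  by rewrite set_itv_ge ?bnd_simp -?leNgt//; exact: integrable_set0.
have nhc : {within `[a, b], continuous (fun x => `|h x|)}.
  apply: continuous_subspaceT => x.
  by apply: continuous_comp; [exact: hc|exact: norm_continuous].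
have [c _ cM] := EVT_max (ltW ab) nhc.
apply: (@integrableMl _ _ _ mu `]a, b[ _ (EFin \o f) h) => //.
  by apply: measurable_funTS; exact: continuous_measurable_fun.
exists `|h c|; split; first exact: num_real.
move=> y hy x xab /=; apply: le_trans (ltW hy); apply: cM.
exact: subset_itv_oo_cc.
Qed.

(* Cutting off h near the end points produces the boundary terms. *)
Lemma weak_ibp (a b : R) (w dw h dh : R -> R) : a < b ->
  {within `[a, b], continuous w} -> mu.-integrable `]a, b[ (EFin \o dw) ->
  (forall psi dpsi, test_in a b psi dpsi ->
    \int[mu]_(x in `]a, b[) (w x * dpsi x) =
    - \int[mu]_(x in `]a, b[) (dw x * psi x)) ->
  (forall x : R, is_derive x 1 h (dh x)) -> continuous dh ->
  \int[mu]_(x in `]a, b[) (w x * dh x) =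
  w b * h b - w a * h a - \int[mu]_(x in `]a, b[) (dw x * h x).
Proof.
move=> ab wc dwi wdw hd dhc.
have hc := is_derive_continuous hd.
have wch (f : R -> R) : continuous f -> {within `[a, b], continuous f}.
  by move=> fc; exact: continuous_subspaceT.
have tst n : test_in a b (fun x => h x * cut a b n x)
    (fun x => h x * (rhol a b n x - rhor a b n x) + cut a b n x * dh x).
  split.
  - move=> x; have h1 := hd x; have h2 := is_derive_cut a b n x.
    exact: is_deriveM.
  - move=> x; apply: cvgD.
      apply: cvgM; first exact: hc.
      by apply: cvgB; [exact: continuous_rhol|exact: continuous_rhor].
    by apply: cvgM; [exact: continuous_cut|exact: dhc].
  - exists (a + mesh a b n), (b - mesh a b n).
    have m0 := mesh_gt0 ab n; split; [lra|lra|].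
    by move=> x /(cut_supp ab) ->; rewrite mulr0.
have whc := within_continuousM wc (wch _ hc).
have wdhi : mu.-integrable `]a, b[ (EFin \o (fun x => w x * dh x)).
  by apply: within_continuous_integrable_oo; apply: within_continuousM => //; exact: wch.
have dwhi : mu.-integrable `]a, b[ (EFin \o (fun x => dw x * h x)).
  exact: integrable_mul_continuous.
have c1 := rhol_cvg ab whc; have c2 := rhor_cvg ab whc.
have c3 := cut_int_cvg ab wdhi; have c4 := cut_int_cvg ab dwhi.
have c5 := cvgD (cvgD (cvgB c1 c2) c3) c4.
suff c6 : w a * h a - w b * h b + \int[mu]_(x in `]a, b[) (w x * dh x) +
    \int[mu]_(x in `]a, b[) (dw x * h x) = 0.
  by move: c6; lra.
(* The sum of the four cut-off terms is zero for every n, by the weak identity tested with h * cut,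
   and it tends to the left side. *)
apply: (cvg_unique (@Rhausdorff R) (c5 _ _ _)).
apply: cvg_near_cst; apply: nearW => n /=; have {}wdw := wdw _ _ (tst n).
rewrite !fctE/=.
rewrite (_ : \int[mu]_(x in `]a, b[) (dw x * h x * cut a b n x) =
  \int[mu]_(x in `]a, b[) (dw x * (h x * cut a b n x))); last first.
  by apply: eq_Rintegral => x _; rewrite mulrA.
apply/eqP; rewrite addr_eq0 -wdw; apply/eqP.
have rl : {within `[a, b], continuous (fun x => w x * h x * rhol a b n x)}.
  by apply: within_continuousM => //; apply: wch; exact: continuous_rhol.
have rr : {within `[a, b], continuous (fun x => w x * h x * rhor a b n x)}.
  by apply: within_continuousM => //; apply: wch; exact: continuous_rhor.
have cc : {within `[a, b], continuous (fun x => w x * dh x * cut a b n x)}.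
  apply: within_continuousM => //; last by apply: wch; exact: continuous_cut.
  by apply: within_continuousM => //; exact: wch.
rewrite -!integral_oo_cc; try exact: within_continuous_integrable.
rewrite -RintegralB//; try exact: within_continuous_integrable_oo.
rewrite -RintegralD//; try exact: within_continuous_integrable_oo.
  by apply: eq_Rintegral => x _; ring.
by apply: itgB => //; exact: within_continuous_integrable_oo.
Qed.

End weak_derivative.

(** * Density of test functions in L2 *)

Section density.
Context {R : realType}.
Notation mu := (@lebesgue_measure R).
Notation L2 := (Lfun mu 2%:E).
Variable l : R.
Hypothesis l0 : 0 < l.
Implicit Types f g G : R -> R.

Definition approximable f := forall e, 0 < e ->
  exists psi dpsi, test1 l psi dpsi /\ \int[mu]_x ((f x - psi x) ^+ 2) <= e.

Lemma test1_L2 psi dpsi : test1 l psi dpsi -> psi \in L2.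
Proof.
move=> [pd _ [a [b [a0 bl ps]]]].
have pc := is_derive_continuous pd.
suff <- : psi \_ `[a, b] = psi by exact: continuous_L2.
apply/funext => x; rewrite patchE; case: ifPn => // xab.
by rewrite ps//; apply: contra xab; rewrite inE.
Qed.

Lemma approximable_cvg (f_ : nat -> R -> R) f :
  (forall n, approximable (f_ n)) -> L2cvg \oo f_ f -> approximable f.
Proof.
move=> fa [fL_ fL /cvgrPdist_le f0] e e0.
have e40 : 0 < e / 4 by rewrite divr_gt0.
have [n [fn fnL]] : exists n, \int[mu]_x ((f_ n x - f x) ^+ 2) <= e / 4 /\ f_ n \in L2.
  apply: (@filter_ex _ \oo); near=> n; split; last by near: n.
  have : `|0 - \int[mu]_x ((f_ n x - f x) ^+ 2)| <= e / 4 by near: n; exact: f0.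
  by rewrite sub0r normrN ger0_norm// int_sqr_ge0.
have [psi [dpsi [pt pe]]] := fa n _ e40.
exists psi, dpsi; split=> //.
have pL := test1_L2 pt.
have h1 := L2_intX (L2B fnL fL); have h2 := L2_intX (L2B fnL pL).
apply: (@le_trans _ _ (\int[mu]_x (2 * (f_ n x - f x) ^+ 2 + 2 * (f_ n x - psi x) ^+ 2))).
  apply: le_Rintegral => //; first exact/L2_intX/L2B.
    by apply: itgD => //; exact: itgZ.
  by move=> x _; have := sqr_ge0 ((f_ n x - f x) + (f_ n x - psi x)); nra.
rewrite RintegralD//; try exact: itgZ.
by rewrite !RintegralZl//; lra.
Unshelve. all: by end_near. Qed.

Lemma antiderivative g (a : R) : continuous g -> (forall x, x <= a -> g x = 0) ->
  exists2 G, forall x : R, is_derive x 1 G (g x) & forall x, x <= a -> G x = 0.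
Proof.
move=> gc g0.
(* The base point lies strictly to the left of a, where g vanishes, so that the fundamental theorem
   applies at x = a as well. *)
exists (fun x => \int[mu]_(t in `[a - 1, x]) g t); last first.
  move=> x xa; rewrite (@eq_Rintegral _ _ _ _ _ (cst 0)) ?Rintegral_cst ?mul0r//.
  move=> t; rewrite inE/= in_itv/= => /andP[_ tx]; apply: g0; exact: le_trans xa.
move=> x; have [xa|ax] := ltP x a.
  rewrite g0 ?ltW//; apply: (@near_eq_is_derive _ _ _ (cst 0)).
    near=> y; rewrite (@eq_Rintegral _ _ _ _ _ (cst 0)) ?Rintegral_cst ?mul0r//.
    move=> t; rewrite inE/= in_itv/= => /andP[_ tx]; apply: g0.
    by apply: le_trans tx _; apply: ltW; near: y; exact: lt_nbhsl.
have ax1 : a - 1 < x by lra.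
have xx1 : x < x + 1 by lra.
have gi : mu.-integrable `[a - 1, x + 1] (EFin \o g).
  by apply: within_continuous_integrable; exact: continuous_subspaceT.
have [dG dGE] := continuous_FTC1_closed xx1 gi ax1 (gc x).
by rewrite -dGE derive1E; exact: derivableP.
Unshelve. all: by end_near. Qed.

Lemma cst_L2 (K a b : R) : (cst K) \_ `[a, b] \in L2.
Proof. by apply: continuous_L2; exact: cst_continuous. Qed.

(** Mollification by sliding means: [psi n x] is the mean of g over [x, x + h n], expressed by the
    primitive G. It is C^1, inherits the bound K, and tends to g x because G has derivative g. *)
Lemma approximable_compact g (a b K : R) : 0 < a -> b < l -> continuous g ->
  (forall x, x \notin `[a, b] -> g x = 0) -> (forall x, `|g x| <= K) ->
  approximable g.
Proof.
move=> a0 bl gc gs gK.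
have ga x : x < a -> g x = 0 by move=> xa; apply: gs; rewrite in_itv/= leNgt xa.
have gb x : b < x -> g x = 0.
  by move=> xa; apply: gs; rewrite in_itv/= (leNgt x b) xa andbF.
have [G GD G0] : exists2 G, forall x : R, is_derive x 1 G (g x) &
    forall x, x <= a * (3 / 4) -> G x = 0.
  by apply: antiderivative => // x xa; apply: ga; lra.
(* A shift of at most a / 4: since G vanishes up to 3 a / 4, [psi n] vanishes to the left of a / 2
   and its support stays inside ]0, l[. *)
pose h n : R := a / 4 / (n%:R + 1).
have n1 n : 0 < n%:R + 1 :> R by rewrite ltr_wpDl.
have h0 n : 0 < h n by rewrite divr_gt0// divr_gt0.
have ha n : h n <= a / 4.
  by rewrite ler_pdivrMr// ler_peMr ?lerDr// ltW// divr_gt0.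
pose psi n x := (G (x + h n) - G x) / h n.
have mvt n x : exists2 c, x <= c <= x + h n & psi n x = g c.
  have xh : x <= x + h n by rewrite lerDl ltW.
  have [c cx cE] := @MVT_segment _ G g x (x + h n) xh (fun y _ => GD y)
    (continuous_subspaceT (is_derive_continuous GD)).
  exists c; first by rewrite in_itv/= in cx.
  by rewrite /psi cE addrAC subrr add0r mulfK// gt_eqF.
have psiK n x : `|psi n x| <= K by have [c _ ->] := mvt n x; exact: gK.
have psis n x : x \notin `[a / 2, b] -> psi n x = 0.
  rewrite in_itv/= negb_and -!ltNge => /orP[xa|xb].
    have := ha n; have := h0 n => hn0 hna.
    by rewrite /psi !G0 ?subrr ?mul0r//; lra.
  by have [c /andP[xc _] ->] := mvt n x; apply: gb; exact: lt_le_trans xc.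
have psiT n : test1 l (psi n) (fun x => (g (x + h n) - g x) / h n).
  split.
  - move=> x; have GDh : is_derive x 1 (fun x => G (x + h n)) (g (x + h n)).
      rewrite -[X in is_derive _ _ _ X]mulr1; apply: is_derive1_compf => //.
      by apply: is_derive_eq; rewrite addr0.
    have GDx := GD x.
    by rewrite /psi; apply: is_derive_eq; rewrite /GRing.scale/=; ring.
  - move=> x; apply: cvgMl; apply: cvgB; last exact: gc.
    apply: (@continuous_comp _ _ _ (fun x => x + h n) g); last exact: gc.
    by apply: cvgD; [exact: cvg_id|exact: cvg_cst].
  - exists (a / 2), b; split=> //; first by rewrite divr_gt0.
    exact: psis.
apply: (@approximable_cvg psi).
  move=> n e e0; exists (psi n), (fun x => (g (x + h n) - g x) / h n); split=> //.
  rewrite (@eq_Rintegral _ _ _ _ _ (cst 0)) ?Rintegral_cst ?mul0r ?ltW//.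
  by move=> x _; rewrite subrr expr0n.
have K0 : 0 <= K by exact: le_trans (gK 0).
apply: (L2cvg_dominated _ _ (cst_L2 K 0 l)).
- by move=> n; exact: L2_measurable (test1_L2 (psiT n)).
- by apply: continuous_measurable_fun.
- move=> n x; rewrite patchE; case: ifPn => // xl; rewrite psis ?normr0//.
  apply: contra xl; rewrite mem_setE !in_itv/= => /andP[? ?]; lra.
- move=> x; rewrite patchE; case: ifPn => // xl; rewrite gs ?normr0//.
  apply: contra xl; rewrite mem_setE !in_itv/= => /andP[? ?]; lra.
apply: aeW => x; have /is_derive_quotP := GD x => /cvgr_dnbhsP Gq.
have := Gq (fun n => x + h n) _.
have -> : (fun n => (G (x + h n) - G x) / (x + h n - x)) = psi ^~ x.
  by apply/funext => n; rewrite /psi; congr (_ / _); ring.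
apply; split.
  by move=> n; rewrite gt_eqF// ltrDl.
rewrite -[X in _ --> X]addr0; apply: cvgD; first exact: cvg_cst.
apply/cvgrPdist_le => e e0; near=> n.
rewrite sub0r normrN ger0_norm ?(ltW (h0 n))// ler_pdivrMr//.
have : a / 4 / e <= n%:R by near: n; exact: nbhs_infty_ger.
by rewrite ler_pdivrMr//; lra.
Unshelve. all: by end_near. Qed.

Lemma approximable_continuous g (K : R) : continuous g -> (forall x, `|g x| <= K) ->
  approximable (g \_ `]0, l[).
Proof.
move=> gc gK; have K0 : 0 <= K by exact: le_trans (gK 0).
have cc n : continuous (fun x => g x * cut 0 l n x).
  by move=> x; apply: cvgM; [exact: gc|exact: continuous_cut].
have gcK n x : `|g x * cut 0 l n x| <= K.
  by rewrite normrM -[leRHS]mulr1 ler_pM// cut_le1.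
apply: (@approximable_cvg (fun n x => g x * cut 0 l n x)).
  move=> n; have m0 := mesh_gt0 l0 n.
  apply: (@approximable_compact _ (0 + mesh 0 l n) (l - mesh 0 l n) K) => //.
  - by rewrite add0r.
  - lra.
  - by move=> x /(cut_supp l0) ->; rewrite mulr0.
apply: (L2cvg_dominated _ _ (cst_L2 K 0 l)).
- by move=> n; exact: continuous_measurable_fun.
- apply/(measurable_restrictT _ _).1 => //.
  by apply: measurable_funTS; exact: continuous_measurable_fun.
- move=> n x; rewrite patchE; case: ifPn => // xl; rewrite (cut_supp l0) ?mulr0 ?normr0//.
  have m0 := mesh_gt0 l0 n.
  apply: contra xl; rewrite mem_setE !in_itv/= => /andP[? ?]; lra.
- move=> x; rewrite !patchE; case: ifPn => xl; case: ifPn => // xl'; rewrite ?normr0//.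
  by move: xl xl'; rewrite !mem_setE => /subset_itv_oo_cc ->.
apply: aeW => x; rewrite patchE; case: ifPn => xl.
  by rewrite -[X in _ --> X]mulr1; apply: cvgMr; apply: cut_cvg; rewrite mem_setE in xl.
apply: cvg_near_cst; apply: nearW => n; rewrite (cut_supp l0) ?mulr0//.
have m0 := mesh_gt0 l0 n.
by apply: contra xl; rewrite mem_setE !in_itv/= => /andP[? ?]; lra.
Qed.

(** Starts from continuous approximants [g_] in L1. Clamping them to [- K, K] does not increase the
    distance to f, and then |k n - f|^2 <= 2 K |f - g_ n| upgrades L1 convergence to L2
    convergence. *)
Lemma approximable_bounded f (K : R) : measurable_fun setT f ->
  (forall x, `|f x| <= K) -> approximable (f \_ `]0, l[).
Proof.
move=> mf fK; have K0 : 0 <= K by exact: le_trans (fK 0).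
have mE : measurable (`]0, l[ : set R) by [].
have fiE : mu.-integrable `]0, l[ (EFin \o f).
  apply: measurable_bounded_integrable => //; first exact: itv_mu_fin.
    exact: measurable_funTS.
  by exists K; split; [exact: num_real|move=> y Ky x _; exact: le_trans (ltW Ky)].
have [g_ [gc gi gcv]] := approximation_continuous_integrable mE (itv_mu_fin _ _ _ _) fiE.
pose k n (x : R) : R := Num.max (- K) (Num.min K (g_ n x)).
have kc n : continuous (k n).
  rewrite /k => x; apply: (@continuous_max _ _ (cst (- K)) (fun x => Num.min K (g_ n x))).
    exact: cst_continuous.
  apply: (@continuous_min _ _ (cst K) (g_ n)); [exact: cst_continuous|exact: gc].
have kK n x : `|k n x| <= K.
  rewrite /k ler_norml; have [h|h] := leP K (g_ n x).
    by rewrite max_r ?lexx ?andbT//; lra.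
  by have [h'|h'] := leP (- K) (g_ n x); apply/andP; split; lra.
have kf n x : (k n x - f x) ^+ 2 <= 2 * K * `|f x - g_ n x|.
  have : `|k n x - f x| <= `|f x - g_ n x|.
    have := fK x; rewrite ler_norml => /andP[f1 f2].
    rewrite /k; have [h|h] := leP K (g_ n x).
      rewrite max_r; last by lra.
      by rewrite ger0_norm ?subr_ge0// ler0_norm ?subr_le0; lra.
    have [h'|h'] := leP (- K) (g_ n x); first by rewrite distrC.
    by rewrite ler0_norm ?subr_le0// ger0_norm ?subr_ge0; lra.
  have : `|k n x - f x| <= 2 * K.
    by rewrite (le_trans (ler_normB _ _))// (_ : 2 * K = K + K) ?lerD//; ring.
  by rewrite -real_normK ?num_real//; have := normr_ge0 (k n x - f x); nra.
apply: (@approximable_cvg (fun n => k n \_ `]0, l[)).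
  by move=> n; exact: (@approximable_continuous _ K).
have kL n : (k n) \_ `]0, l[ \in L2.
  apply: (@L2_bounded _ _ _ _ K) => //.
  by apply: measurable_funTS; exact: continuous_measurable_fun.
have fL : f \_ `]0, l[ \in L2.
  by apply: (@L2_bounded _ _ _ _ K) => //; exact: measurable_funTS.
split=> //; first exact: nearW.
have hcv : (fun n => \int[mu]_(x in `]0, l[) `|f x - g_ n x|) @ \oo --> (0 : R).
  exact: fine_cvg gcv.
have h2 : (fun n => 2 * K * \int[mu]_(x in `]0, l[) `|f x - g_ n x|) @ \oo --> (0 : R).
  by rewrite -[X in _ --> X](mulr0 (2 * K)); exact: cvgMr.
apply: squeeze_cvgr (cvg_cst 0) h2; apply: nearW => n.
rewrite int_sqr_ge0/=.
have fgi : mu.-integrable `]0, l[ (EFin \o (fun x => `|f x - g_ n x|)).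
  by apply: integrable_norm; exact: itgB.
have sqE : (fun x => ((k n \_ `]0, l[) x - (f \_ `]0, l[) x) ^+ 2) =
    (fun x => (k n x - f x) ^+ 2) \_ `]0, l[.
  apply/funext => x; rewrite !patchE; case: ifP => // _.
  by rewrite subrr expr0n.
rewrite -RintegralZl// sqE -Rintegral_mkcond.
apply: le_Rintegral => //.
- have H := L2_intX (L2B (kL n) fL).
  have : mu.-integrable `]0, l[ (EFin \o (fun x => ((k n \_ `]0, l[) x -
      (f \_ `]0, l[) x) ^+ 2)) by exact: itg_sub.
  by apply: eq_integrable => // x xE /=; rewrite !patchE xE.
- exact: itgZ.
Qed.

(** Truncation at height n reduces to bounded functions: the truncations are dominated by |g| and at
    each point eventually equal to g. *)
Lemma approximable_L2 f : f \_ `]0, l[ \in L2 -> approximable (f \_ `]0, l[).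
Proof.
set g := f \_ _ => gL.
have mg := L2_measurable gL.
pose k (n : nat) (x : R) : R := Num.max (- n%:R) (Num.min n%:R (g x)).
have mk n : measurable_fun setT (k n).
  by apply: measurable_maxr; [exact: measurable_cst|apply: measurable_minr].
have kK n x : `|k n x| <= n%:R.
  have n0 : 0 <= n%:R :> R by [].
  rewrite /k ler_norml; have [h|h] := leP n%:R (g x).
    by rewrite max_r ?lexx ?andbT//; lra.
  by have [h'|h'] := leP (- n%:R) (g x); apply/andP; split; lra.
have kg n x : `|k n x| <= `|g x|.
  have n0 : 0 <= n%:R :> R by [].
  rewrite /k; have [h|h] := leP n%:R (g x).
    by rewrite max_r ?ger0_norm//; lra.
  have [h'|h'] := leP (- n%:R) (g x) => //.
  by rewrite !ler0_norm; lra.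
apply: (@approximable_cvg (fun n => k n \_ `]0, l[)).
  by move=> n; apply: (@approximable_bounded _ n%:R).
have nL : (fun x => `|g x|) \in L2.
  by apply: (L2_le _ gL) => [|x]; rewrite ?normr_id//; exact: measurableT_comp.
apply: (L2cvg_dominated _ _ nL) => //.
- move=> n; apply/(measurable_restrictT _ _).1 => //; exact: measurable_funTS.
- by move=> n x; rewrite patchE; case: ifP => // _; rewrite normr0.
apply: aeW => x; apply: cvg_near_cst; near=> n; rewrite patchE; case: ifPn => xl.
  have : `|g x| <= n%:R by near: n; exact: nbhs_infty_ger.
  by rewrite ler_norml /k => /andP[h1 h2]; rewrite min_r// max_r.
by rewrite /g patchE (negbTE xl).
Unshelve. all: by end_near. Qed.

End density.

(** * Uniform difference quotients of translates *)

Section translates.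
Context {R : realType}.
Notation mu := (@lebesgue_measure R).
Notation L2 := (Lfun mu 2%:E).

(** The mean value theorem writes the quotient as [da c] with c between t + y and s + y. Then c - y
    is a time no further from t than s, and the continuity of da (r + y) at r = t, uniform for y in
    [- M, M], applies at that time. *)
Lemma quotient_unif (a da : R -> R) (t M : R) :
  (forall x : R, is_derive x 1 a (da x)) -> continuous da -> forall e, 0 < e ->
  \forall s \near t^', forall y, y \in `[- M, M] ->
    `|(a (s + y) - a (t + y)) / (s - t) - da (t + y)| <= e.
Proof.
move=> ad dac e e0.
have kc : continuous (fun z : R * R => da (z.1 + z.2)).
  move=> z; apply: (@continuous_comp _ _ _ (fun z : R * R => z.1 + z.2) da); last exact: dac.
  by apply: cvgD; [exact: cvg_fst|exact: cvg_snd].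
have := @unif_cvg_compact R (fun s y => da (s + y)) (- M) M t kc e e0.
move=> /nbhs_ballP[d /= d0 hd].
have ac := is_derive_continuous ad.
near=> s => y yM.
have st : s != t by near: s; exact: nbhs_dnbhs_neq.
have sd : `|t - s| < d by near: s; apply: nbhs_dnbhs; exact: nbhsx_ballx.
have MVTs (p q : R) : p < q -> exists2 c, c \in `[p, q] & a q - a p = da c * (q - p).
  move=> pq; apply: MVT_segment; first exact: ltW.
  exact: continuous_subspaceT.
have [ts|st'] := ltP t s.
  have [|c] := MVTs (t + y) (s + y); first by rewrite ltrD2r.
  rewrite in_itv/= => /andP[c1 c2] ->.
  rewrite (_ : s + y - (t + y) = s - t); last by ring.
  rewrite mulfK ?subr_eq0//.
  have := hd (c - y) _ _ yM; rewrite subrK; apply.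
  rewrite /ball/= ler0_norm; last by lra.
  by move: sd; rewrite ltr0_norm ?subr_lt0//; lra.
have {}st' : s < t by rewrite lt_neqAle st.
have [|c] := MVTs (s + y) (t + y); first by rewrite ltrD2r.
rewrite in_itv/= => /andP[c1 c2] aE.
have -> : (a (s + y) - a (t + y)) / (s - t) = da c.
  rewrite -opprB aE (_ : t + y - (s + y) = - (s - t)); last by ring.
  by rewrite mulrN opprK mulfK ?subr_eq0.
have := hd (c - y) _ _ yM; rewrite subrK; apply.
rewrite /ball/= ger0_norm; last by lra.
by move: sd; rewrite gtr0_norm ?subr_gt0//; lra.
Unshelve. all: by end_near. Qed.

Lemma L2cvgD {T : Type} (F : set_system T) {FF : Filter F}
    (f_ g_ : T -> R -> R) (f g : R -> R) : L2cvg F f_ f -> L2cvg F g_ g ->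
  L2cvg F (fun s x => f_ s x + g_ s x) (fun x => f x + g x).
Proof.
move=> hf hg.
have z : (cst 0 : R -> R) \in L2.
  apply/L2P; split; first exact: measurable_cst.
  rewrite (_ : _ \o _ = cst 0%E); first exact: integrable0.
  by apply/funext => x /=; rewrite expr0n.
have := L2cvgB hf (L2cvgB (L2cvg_cst (F:=F) z) hg).
rewrite (_ : (fun x => f x - _) = (fun x => f x + g x)); last first.
  by apply/funext => x /=; rewrite sub0r opprK.
rewrite (_ : (fun s x => f_ s x - _) = (fun s x => f_ s x + g_ s x)); first exact.
by apply/funext => s; apply/funext => x /=; rewrite sub0r opprK.
Qed.

Lemma integral_near_cst (f : R -> R) (a b C e : R) : a <= b ->
  mu.-integrable `]a, b[ (EFin \o f) ->
  (forall x, x \in `]a, b[ -> `|f x - C| <= e) ->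
  `|\int[mu]_(x in `]a, b[) f x - C * (b - a)| <= e * (b - a).
Proof.
move=> ab fi fC.
have ci (k : R) : mu.-integrable `]a, b[ (EFin \o cst k).
  by apply: within_continuous_integrable_oo; apply: continuous_subspaceT; exact: cst_continuous.
have cE (k : R) : k * (b - a) = \int[mu]_(x in `]a, b[) (cst k x).
  rewrite Rintegral_cst//= lebesgue_measure_itv/= lte_fin.
  have [//|ba] := ltP a b.
  by rewrite (_ : b = a) ?subrr//; apply/eqP; rewrite eq_le ab ba.
rewrite !cE -RintegralB//.
apply: le_trans (le_normr_Rintegral _ (itgB _ _ _)) _ => //.
apply: le_Rintegral => //.
by apply: integrable_norm; exact: itgB.
Qed.

Lemma test_in_deriv0 (a b : R) (psi dpsi : R -> R) (x : R) :
  (forall x : R, is_derive x 1 psi (dpsi x)) ->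
  (forall x, x \notin `[a, b] -> psi x = 0) -> x \notin `[a, b] -> dpsi x = 0.
Proof.
move=> pd p0 xab.
have : is_derive x 1 psi 0.
  apply: (@near_eq_is_derive _ _ _ (cst 0)).
  have : nbhs x (~` [set` `[a, b]]).
    apply: open_nbhs_nbhs; split; first exact/closed_openC/interval_closed.
    by move=> /= xi; rewrite xi in xab.
  apply: filterS => y /= yab; rewrite p0//; exact/negP.
by move=> [_ <-]; have [_ ->] := pd x.
Qed.

End translates.

Section restriction_ip.
Context {R : realType}.
Notation mu := (@lebesgue_measure R).

(** Only the window of w follows the moving end; the kernel lives on the fixed segment [0, M], where
    uniform convergence gives L2 convergence. *)
Lemma integral_ip (w k : R -> R) (m M : R) : m <= M ->
  \int[mu]_(x in `]0, m[) (w x * k x) =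
  \int[mu]_x ((w \_ `]0, m[) x * (k \_ `[0, M]) x).
Proof.
move=> mM; rewrite Rintegral_mkcond; apply: eq_Rintegral => x _.
rewrite !patchE; case: ifPn => xm; last by rewrite mul0r.
rewrite ifT//; move: xm; rewrite !mem_setE !in_itv/= => /andP[x0 xm].
by rewrite (ltW x0)/= (le_trans (ltW xm)).
Qed.

Lemma restrict_restrict_itv (w : R -> R) (m l : R) : m <= l ->
  (w \_ `]0, l[) \_ `]0, m[ = w \_ `]0, m[.
Proof.
move=> ml; apply/funext => x; rewrite !patchE; case: ifPn => // xm.
rewrite ifT//; move: xm; rewrite !mem_setE !in_itv/= => /andP[-> xm]/=.
exact: lt_le_trans xm ml.
Qed.

Lemma inL2_integrable (l m : R) (w : R -> R) : inL2 l w -> m <= l ->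
  mu.-integrable `]0, m[ (EFin \o w).
Proof.
move=> wL ml.
have H := L2_intM (L2_restrict (measurable_itv `]0, m[) wL) (cst_L2 1 0 m).
have : mu.-integrable `]0, m[ (EFin \o (fun x =>
    ((w \_ `]0, l[) \_ `]0, m[) x * ((cst (1 : R)) \_ `[0, m]) x)) by exact: itg_sub.
apply: eq_integrable => // x xm /=.
rewrite restrict_restrict_itv// !patchE xm.
by rewrite mem_setE (subset_itv_oo_cc _)/= ?mulr1//; rewrite mem_setE in xm.
Qed.

End restriction_ip.

(** * Integration by parts for functions of V_0 *)

Section H1.
Context {R : realType}.
Notation mu := (@lebesgue_measure R).
Notation L2 := (Lfun mu 2%:E).
Variables (l : R) (w dw : R -> R).
Hypothesis wV : inV0 l w dw.

(** The upper limit m may lie inside the interval because slices at two times are compared on their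
    common part. A test function for ]0, m[ is one for ]0, l[, and w 0 = 0 removes the left boundary
    term. *)
Lemma V0_ibp (m : R) (h dh : R -> R) : 0 <= m <= l ->
  (forall x : R, is_derive x 1 h (dh x)) -> continuous dh ->
  \int[mu]_(x in `]0, m[) (w x * dh x) =
  w m * h m - \int[mu]_(x in `]0, m[) (dw x * h x).
Proof.
move=> /andP[m0 ml] hd dhc; have [[wL dwL wc wt] w0] := wV.
move: m0; rewrite le_eqVlt => /predU1P[<-|m0].
  by rewrite set_itv_ge ?bnd_simp ?ltxx// !Rintegral_set0 w0 mul0r subrr.
rewrite (@weak_ibp _ 0 m w dw h dh)// ?w0 ?mul0r ?subr0//.
- by apply: continuous_subspaceW wc; apply: subset_itvl; rewrite bnd_simp.
- exact: inL2_integrable dwL ml.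
move=> psi dpsi [pd dpc [a [b [a0 bm ps]]]].
have := wt psi dpsi.
have cut0 (f g : R -> R) : (forall x, x \notin `[a, b] -> g x = 0) ->
    \int[mu]_(x in `]0, l[) (f x * g x) = \int[mu]_(x in `]0, m[) (f x * g x).
  move=> g0; rewrite Rintegral_mkcond [RHS]Rintegral_mkcond; apply: eq_Rintegral => x _.
  rewrite !patchE; case: ifPn => xl; case: ifPn => xm //.
    rewrite g0 ?mulr0//; apply: contra xm; rewrite mem_setE !in_itv/= => /andP[? ?].
    by apply/andP; split; lra.
  by move: xl xm; rewrite !mem_setE !in_itv/= => /negP xl /andP[x0 xm]; exfalso;
    apply: xl; rewrite x0; exact: lt_le_trans xm ml.
rewrite !cut0//; last first.
  by move=> x; exact: test_in_deriv0.
apply; split=> //; exists a, b; split=> //; exact: lt_le_trans ml.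
Qed.

Lemma V0_FTC (m : R) : 0 <= m <= l -> w m = \int[mu]_(x in `]0, m[) dw x.
Proof.
move=> ml; have := @V0_ibp m (cst 1) (cst 0) ml (fun x => is_derive_cst _ _ _) (@cst_continuous _ _ 0).
rewrite mulr1 (@eq_Rintegral _ _ _ _ _ (cst 0)); last by move=> x _; rewrite mulr0.
have -> : \int[mu]_(x in `]0, m[) (dw x * cst 1 x) = \int[mu]_(x in `]0, m[) dw x.
  by apply: eq_Rintegral => x _; rewrite mulr1.
by rewrite Rintegral_cst// mul0r; lra.
Qed.

End H1.

(** * Traces and moments of the solution *)

Section wave.
Context {R : realType}.
Notation mu := (@lebesgue_measure R).
Notation L2 := (Lfun mu 2%:E).
Implicit Types (t s x e : R).
Variables (eta : R) (ell dell u0 u1 : R -> R) (u ux ut : R -> R -> R).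
Hypothesis ell_cont : {within `[0, +oo[, continuous ell}.
Hypothesis ell_gt0 : forall t, 0 <= t -> 0 < ell t.
Hypothesis ell_d : forall t : R, 0 < t -> is_derive t 1 ell (dell t).
Hypothesis u_sol : wave_solution eta ell dell u0 u1 u ux ut.

Local Notation near0 t := (within [set s : R | 0 <= s] (nbhs (t : R))).
Local Notation Z w := (fun s => (w^~ s) \_ `]0, ell s[).

Lemma cvg_near0 {T : Type} (f : R -> T) (G : set_system T) (t : R) : 0 < t ->
  f @ near0 t --> G -> f @ nbhs t --> G.
Proof.
move=> t0; apply: cvg_trans; apply: cvg_app => P Pt.
have {}Pt : \forall s \near t, 0 <= s -> P s by exact: Pt.
suff : \forall s \near t, P s by [].
have : \forall s \near t, 0 <= s.
  by near=> s; apply: ltW; near: s; exact: lt_nbhsr.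
by apply: filterS2 Pt => s; exact.
Unshelve. all: by end_near. Qed.

Lemma ell_cvg t : 0 <= t -> ell @ near0 t --> ell t.
Proof.
move=> t0; have /subspace_continuousP/(_ t) := ell_cont.
rewrite (_ : [set` `[0, +oo[] = [set s : R | 0 <= s]); first exact.
by apply/seteqP; split=> s /=; rewrite in_itv/= andbT.
Qed.

Lemma near0_ge0 t : \forall s \near near0 t, 0 <= s.
Proof. by rewrite near_withinE; exact: nearW. Qed.

Lemma restrict_setT (f : R -> R) : f \_ setT = f.
Proof. by apply/funext => x; rewrite patchE in_setT. Qed.

Lemma L2continuous_L2cvg (w : R -> R -> R) t : 0 <= t ->
  (forall s, 0 <= s -> inL2 (ell s) (w^~ s)) -> L2continuous ell w ->
  L2cvg (near0 t) (Z w) (Z w t).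
Proof.
move=> t0 wL wc; have wZ s : 0 <= s -> Z w s \in L2 by exact: wL.
split; [by apply: filterS (near0_ge0 t) => s; exact: wZ|exact: wZ|].
have := L2norm_cvg _ (wc t t0).
rewrite (_ : (fun s => \int[mu]_x _) = (fun s => \int[mu]_x ((Z w s x - Z w t x) ^+ 2))).
  apply; apply: filterS (near0_ge0 t) => s s0.
  by rewrite restrict_setT; apply: L2B; exact: wZ.
by apply/funext => s; apply: eq_Rintegral => x _; rewrite restrict_setT.
Qed.

Lemma ux_L2cvg t : 0 <= t -> L2cvg (near0 t) (Z ux) (Z ux t).
Proof.
move=> t0; apply: L2continuous_L2cvg => //; last exact: wave_contx u_sol.
by move=> s s0; have [[_ ? _ _] _] := wave_V0 u_sol s0.
Qed.

Lemma ut_L2cvg t : 0 <= t -> L2cvg (near0 t) (Z ut) (Z ut t).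
Proof.
move=> t0; apply: L2continuous_L2cvg => //; last exact: wave_contt u_sol.
exact: wave_L2t u_sol.
Qed.

Lemma pairing_cvg (w k : R -> R -> R) t : 0 <= t -> L2cvg (near0 t) (Z w) (Z w t) ->
  continuous (fun z : R * R => k z.1 z.2) ->
  (fun s => \int[mu]_(x in `]0, ell s[) (w x s * k s x)) @ near0 t -->
  (\int[mu]_(x in `]0, ell t[) (w x t * k t x) : R).
Proof.
(* A fixed window that contains ]0, ell s[ for all s near t. *)
move=> t0 wL kc; pose M := ell t + 1.
have M0 : 0 <= M by rewrite addr_ge0// ltW// ell_gt0.
have kL : L2cvg (near0 t) (fun s => (k s) \_ `[0, M]) ((k t) \_ `[0, M]).
  apply: (@L2cvg_comp _ _ _ _ (nbhs t) _ id (fun s => (k s) \_ `[0, M]));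
    last exact: L2cvg_unif_continuous.
  exact: cvg_within.
rewrite (integral_ip _ _ (_ : ell t <= M)); last by rewrite lerDl.
apply: cvg_trans (L2cvg_ip wL kL); apply: near_eq_cvg; near=> s.
rewrite (integral_ip _ _ (_ : ell s <= M))//.
near: s; apply: (cvgr_le (ell t)); first exact: ell_cvg.
by rewrite ltrDl.
Unshelve. all: by end_near. Qed.

Lemma ell_nbhs t : 0 < t -> ell @ nbhs t --> ell t.
Proof. by move=> t0; apply: cvg_near0 => //; apply: ell_cvg; exact: ltW. Qed.

Lemma u_cvg t e : 0 < t -> 0 < e -> exists2 d, 0 < d & forall x s,
  `|x - ell t| < d -> `|s - t| < d -> 0 <= s -> 0 <= x <= ell s ->
  `|u x s - u (ell t) t| <= e.
Proof.
move=> t0 e0; have t0' := ltW t0.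
pose G := within [set p : R * R | 0 <= p.2 /\ 0 <= p.1 <= ell p.2] (nbhs (ell t, t)).
have FG : Filter G by exact: within_filter.
pose M := ell t + 1.
have uG : (fun p => u p.1 p.2) @ G --> u (ell t) t.
  have lt0 := ell_gt0 t0'.
  have oneL := cst_L2 (1 : R) 0 M.
  have h1 : L2cvg G (fun p => Z ux p.2) (Z ux t).
    apply: (@L2cvg_comp _ _ _ _ (near0 t) _ (fun p : R * R => p.2) (Z ux)); last exact: ux_L2cvg.
    move=> P Pt; have {}Pt : \forall s \near t, 0 <= s -> P s by exact: Pt.
    have c2 : (fun p : R * R => p.2) @ nbhs (ell t, t) --> nbhs t by exact: cvg_snd.
    have {}c2 : \forall p \near (ell t, t), 0 <= p.2 -> P p.2 by exact: (c2 _ Pt).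
    by apply: filterS c2 => p /= Pp [p0 _]; exact: Pp.
  have h2 : L2cvg G (fun p => ((cst (1 : R)) \_ `[0, M]) \_ `]0, p.1[)
      (((cst (1 : R)) \_ `[0, M]) \_ `]0, ell t[).
    apply: (@L2cvg_comp _ _ _ _ (nbhs (ell t)) _ (fun p : R * R => p.1)
      (fun r => ((cst (1 : R)) \_ `[0, M]) \_ `]0, r[)); last exact: L2cvg_itv.
    have : (fun p : R * R => p.1) @ nbhs (ell t, t) --> ell t by exact: cvg_fst.
    by apply: cvg_trans; apply: cvg_app; exact: cvg_within.
  have := L2cvg_ip h1 h2; move/(_ FG).
  have uE x s : 0 <= s -> 0 <= x <= ell s -> x <= M -> u x s =
    \int[mu]_y (Z ux s y * (((cst (1 : R)) \_ `[0, M]) \_ `]0, x[) y).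
    move=> s0 xs xM; rewrite (V0_FTC (wave_V0 u_sol s0) xs).
    rewrite Rintegral_mkcond; apply: eq_Rintegral => y _.
    rewrite !patchE; case: ifPn => yx; last by rewrite mulr0.
    have /andP[x0 xl] := xs.
    move: yx; rewrite !mem_setE !in_itv/= => /andP[y0 yx].
    by rewrite y0 (lt_le_trans yx xl) (ltW y0) (le_trans (ltW yx) xM)/= mulr1.
  rewrite -uE//; [|by rewrite ltW//= lexx|by rewrite lerDl].
  apply: cvg_trans; apply: near_eq_cvg.
  near=> p; have [p0 pl] : 0 <= p.2 /\ 0 <= p.1 <= ell p.2.
    by near: p; rewrite near_withinE; exact: nearW.
  rewrite /= uE//; near: p; rewrite near_withinE.
  have : \forall p \near (ell t, t), p.1 <= M.
    have f1 : (fun p : R * R => p.1) @ nbhs (ell t, t) --> ell t by exact: cvg_fst.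
    by apply: (cvgr_le (ell t) f1); rewrite ltrDl.
  exact: filterS.
have /cvgrPdist_le/(_ _ e0) := uG.
rewrite near_withinE => -[[/= A B]] /= [/nbhs_ballP[d1 /= d10 h1] /nbhs_ballP[d2 /= d20 h2]] AB.
exists (Num.min d1 d2); first by rewrite lt_min d10 d20.
move=> x s; rewrite !lt_min => /andP[x1 _] /andP[_ s2] s0 xs.
have := AB (x, s); rewrite distrC; apply => //=.
by split; [apply: h1|apply: h2]; rewrite /ball/= distrC.
Unshelve. all: by end_near. Qed.

Lemma trace_cvg t : 0 <= t -> (fun s => u (ell s) s) @ near0 t --> u (ell t) t.
Proof.
move=> t0.
have uE s : 0 <= s -> u (ell s) s = \int[mu]_(x in `]0, ell s[) (ux x s * 1).
  move=> s0; rewrite (V0_FTC (wave_V0 u_sol s0)); last by rewrite lexx ltW// ell_gt0.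
  by apply: eq_Rintegral => x _; rewrite mulr1.
rewrite uE//; have := @pairing_cvg ux (fun _ _ => 1) t t0 (ux_L2cvg t0) (@cst_continuous _ _ (1 : R)).
apply: cvg_trans; apply: near_eq_cvg.
by apply: filterS (near0_ge0 t) => s /uE.
Qed.

Lemma uk_cvg (k : R -> R -> R) t e : 0 < t -> 0 < e ->
  continuous (fun z : R * R => k z.1 z.2) -> exists2 d, 0 < d & forall x s,
  `|x - ell t| < d -> `|s - t| < d -> 0 <= s -> 0 <= x <= ell s ->
  `|u x s * k s x - u (ell t) t * k t (ell t)| <= e.
Proof.
move=> t0 e0 kc; set U := u (ell t) t; set K := k t (ell t).
have K1 : 0 < `|K| + 1 by rewrite ltr_wpDl.
have U1 : 0 < `|U| + 1 by rewrite ltr_wpDl.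
pose e1 := e / 2 / (`|K| + 1); pose e2 := Num.min 1 (e / 2 / (`|U| + 1)).
have e10 : 0 < e1 by rewrite !divr_gt0.
have e20 : 0 < e2 by rewrite lt_min ltr01 !divr_gt0.
have [d1 d10 h1] := u_cvg t0 e10.
have /cvgrPdist_le/(_ _ e20) := kc (t, ell t).
move=> [[/= A B] /= [/nbhs_ballP[d2 /= d20 h2] /nbhs_ballP[d3 /= d30 h3]] AB].
exists (Num.min d1 (Num.min d2 d3)); first by rewrite !lt_min d10 d20 d30.
move=> x s; rewrite !lt_min => /and3P[x1 _ x3] /and3P[s1 s2 _] s0 xs.
have uU := h1 x s x1 s1 s0 xs.
have kK : `|k s x - K| <= e2.
  rewrite distrC; apply: (AB (s, x)); split => /=; [apply: h2|apply: h3];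
    by rewrite /ball/= distrC.
have -> : u x s * k s x - U * K = (u x s - U) * k s x + U * (k s x - K) by ring.
have kK1 : `|k s x| <= `|K| + 1.
  rewrite -(subrK K (k s x)) (le_trans (ler_normD _ _))// addrC lerD2l.
  by rewrite (le_trans kK)// ge_min lexx.
rewrite (splitr e) (le_trans (ler_normD _ _))// !normrM lerD//.
  rewrite (le_trans (ler_pM _ _ uU kK1))//.
  by rewrite /e1 mulfVK// gt_eqF.
have kK2 : `|k s x - K| <= e / 2 / (`|U| + 1).
  by rewrite (le_trans kK)// ge_min lexx orbT.
rewrite (le_trans (ler_pM _ _ (_ : `|U| <= `|U| + 1) kK2))//.
  by rewrite lerDl.
by rewrite mulrC mulfVK// gt_eqF.
Qed.

Lemma cvg_near0' {T : Type} (f : R -> T) (G : set_system T) t : 0 < t ->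
  f @ within [set s : R | 0 <= s] t^' --> G -> f @ t^' --> G.
Proof.
move=> t0; apply: cvg_trans; apply: cvg_app => P Pt.
have {}Pt : \forall s \near t^', 0 <= s -> P s by exact: Pt.
suff : \forall s \near t^', P s by [].
have : \forall s \near t^', 0 <= s.
  by apply: nbhs_dnbhs; near=> s; apply: ltW; near: s; exact: lt_nbhsr.
by apply: filterS2 Pt => s; exact.
Unshelve. all: by end_near. Qed.

Lemma integral_split (f : R -> R) (m l : R) : 0 <= m <= l ->
  {within `[0, l], continuous f} ->
  \int[mu]_(x in `]0, l[) f x =
  \int[mu]_(x in `]0, m[) f x + \int[mu]_(x in `]m, l[) f x.
Proof.
move=> /andP[m0 ml] fc; have fi := within_continuous_integrable fc.
have s1 : `[0, m] `<=` (`[0, l] : set R) by apply: subset_itvl; rewrite bnd_simp.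
have s2 : `]m, l] `<=` (`[0, l] : set R).
  by move=> x /=; rewrite !in_itv/= => /andP[mx ->]; rewrite (le_trans m0 (ltW mx)).
have s3 : `]m, l[ `<=` (`[0, l] : set R) by apply: subset_trans s2; exact: subset_itv_oo_oc.
have i1 : mu.-integrable `[0, m] (EFin \o f) by apply: integrableS fi.
have i2 : mu.-integrable `]m, l[ (EFin \o f) by apply: integrableS fi.
rewrite (integral_oo_cc fi) (integral_oo_cc i1) (Rintegral_itv_bndo_bndc i2).
have := @Rintegral_itvB _ f (BLeft 0) (BRight l) m fi.
rewrite !bnd_simp => /(_ m0 ml) <-.
by rewrite addrC subrK.
Qed.

Lemma layer_dist (x m l l' d : R) : m < x -> x < l -> l' - m < d -> l - l' < d ->
  `|x - l'| < d.
Proof. by move=> ? ? ? ?; rewrite ltr_norml; apply/andP; split; lra. Qed.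

(** * Time derivative of a moment of u over the moving interval *)

Section moment.
Variables (a da : R -> R).
Hypothesis ad : forall x : R, is_derive x 1 a (da x).
Hypothesis dac : continuous da.

Let k s x := da (s + x) - da (s - x).
Let c s x := da (s + x) + da (s - x).
Let b s x := a (s + x) + a (s - x).

Lemma shift_continuous (f : R -> R) : continuous f ->
  continuous (fun z : R * R => f (z.1 + z.2)) /\
  continuous (fun z : R * R => f (z.1 - z.2)).
Proof.
move=> fc; split=> z.
  apply: (@continuous_comp _ _ _ (fun z : R * R => z.1 + z.2) f); last exact: fc.
  by apply: cvgD; [exact: cvg_fst|exact: cvg_snd].
apply: (@continuous_comp _ _ _ (fun z : R * R => z.1 - z.2) f); last exact: fc.
by apply: cvgB; [exact: cvg_fst|exact: cvg_snd].
Qed.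

Lemma kernel_continuous (f : R -> R) : continuous f ->
  continuous (fun z : R * R => f (z.1 + z.2) - f (z.1 - z.2)) /\
  continuous (fun z : R * R => f (z.1 + z.2) + f (z.1 - z.2)).
Proof.
move=> /shift_continuous[fp fm]; split=> z.
  by apply: cvgB; [exact: fp|exact: fm].
by apply: cvgD; [exact: fp|exact: fm].
Qed.

Lemma slice_continuous (f : R -> R -> R) s :
  continuous (fun z : R * R => f z.1 z.2) -> continuous (f s).
Proof.
move=> fc x; apply: (@continuous_comp _ _ _ (fun x : R => (s, x)) (fun z => f z.1 z.2)).
  by apply: cvg_pair_nbhs; [exact: cvg_cst|exact: cvg_id].
exact: fc.
Qed.

Lemma b_derive s x : is_derive x 1 (b s) (k s x).
Proof.
have dp : is_derive x 1 (fun x => a (s + x)) (da (s + x) * 1).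
  by apply: is_derive1_compf; apply: is_derive_eq; rewrite add0r.
have dm : is_derive x 1 (fun x => a (s - x)) (da (s - x) * -1).
  apply: is_derive1_compf; have := @is_deriveB _ _ _ (cst s) id x 1 0 1.
  by rewrite sub0r; apply.
by rewrite /b /k; apply: is_derive_eq; rewrite /GRing.scale/=; ring.
Qed.

Lemma b_quotient t (M : R) e : 0 < e -> \forall s \near t^', forall x, x \in `[0, M] ->
  `|(b s x - b t x) / (s - t) - c t x| <= e.
Proof.
move=> e0; have e20 : 0 < e / 2 by rewrite divr_gt0.
have := quotient_unif t M ad dac e20; apply: filterS => s h x.
rewrite in_itv/= => /andP[x0 xM].
have := h x; rewrite in_itv/= xM andbT => /(_ _)h1.
have := h (- x); rewrite in_itv/= => /(_ _)h2.
rewrite /b /c.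
have -> : (a (s + x) + a (s - x) - (a (t + x) + a (t - x))) / (s - t)
    - (da (t + x) + da (t - x)) =
  ((a (s + x) - a (t + x)) / (s - t) - da (t + x)) +
  ((a (s - x) - a (t - x)) / (s - t) - da (t - x)) by ring.
rewrite (splitr e) (le_trans (ler_normD _ _))// lerD//.
  by apply: h1; lra.
by apply: h2; lra.
Qed.

Lemma moment_split s m : 0 <= s -> 0 <= m <= ell s ->
  \int[mu]_(x in `]0, ell s[) (u x s * k s x) =
  \int[mu]_(x in `]0, m[) (u x s * k s x) + \int[mu]_(x in `]m, ell s[) (u x s * k s x).
Proof.
move=> s0 ms; apply: integral_split => //.
have [[_ _ uc _] _] := wave_V0 u_sol s0.
apply: within_continuousM => //; apply: continuous_subspaceT.
exact: slice_continuous (proj1 (kernel_continuous dac)).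
Qed.

Lemma moment_integrable s s' m : 0 <= s -> 0 <= m <= ell s ->
  mu.-integrable `]0, m[ (EFin \o (fun x => u x s * k s' x)) /\
  mu.-integrable `]m, ell s[ (EFin \o (fun x => u x s * k s' x)).
Proof.
move=> s0 /andP[m0 ms]; have [[_ _ uc _] _] := wave_V0 u_sol s0.
have kc : {within `[0, ell s], continuous k s'}.
  apply: continuous_subspaceT.
  exact: slice_continuous (proj1 (kernel_continuous dac)).
have := within_continuous_integrable (within_continuousM uc kc) => H.
split; apply: integrableS H => //.
  by move=> x /=; rewrite !in_itv/= => /andP[/ltW -> /ltW xm]/=; exact: le_trans ms.
by move=> x /=; rewrite !in_itv/= => /andP[/ltW mx /ltW ->]; rewrite (le_trans m0 mx).
Qed.

Let m t s := Num.min (ell s) (ell t).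

(** A discrete product rule on the common interval ]0, m t s[, plus the layers beyond it. The kernel
    [k] is built from [da], which is only continuous, so its time quotient need not converge. Since
    [k] is the space derivative of [b], that quotient is integrated by parts against [u] and only
    the time quotient of the C^1 function [b] remains. *)
Lemma moment_quotient t s : 0 <= t -> 0 <= s -> s != t ->
  (\int[mu]_(x in `]0, ell s[) (u x s * k s x) -
   \int[mu]_(x in `]0, ell t[) (u x t * k t x)) / (s - t) =
  \int[mu]_(x in `]0, m t s[) ((u x s - u x t) / (s - t) * k s x) +
  u (m t s) t * ((b s (m t s) - b t (m t s)) / (s - t)) -
  \int[mu]_(x in `]0, m t s[) (ux x t * ((b s x - b t x) / (s - t))) +
  (\int[mu]_(x in `]m t s, ell s[) (u x s * k s x) -
   \int[mu]_(x in `]m t s, ell t[) (u x t * k t x)) / (s - t).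
Proof.
move=> t0 s0 st.
have st0 : s - t != 0 by rewrite subr_eq0.
have m0 : 0 <= m t s by rewrite le_min !ltW ?ell_gt0.
have ms : 0 <= m t s <= ell s by rewrite m0 ge_min lexx.
have mt : 0 <= m t s <= ell t by rewrite m0 ge_min lexx orbT.
have mt2 : m t s <= ell t by case/andP: mt.
rewrite (moment_split s0 ms) (moment_split t0 mt).
have [i1 _] := moment_integrable s s0 ms.
have [i2 _] := moment_integrable s t0 mt.
have [i3 _] := moment_integrable t t0 mt.
have hb x : is_derive x 1 (fun x => (b s x - b t x) / (s - t)) ((k s x - k t x) / (s - t)).
  have bs := b_derive s x; have bt := b_derive t x.
  by apply: is_derive_eq; rewrite /GRing.scale/=; ring.
have kc s' : continuous (k s') by exact: slice_continuous (proj1 (kernel_continuous dac)).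
have hc : continuous (fun x => (k s x - k t x) / (s - t)).
  by move=> x; apply: cvgMl; apply: cvgB; exact: kc.
have E := V0_ibp (wave_V0 u_sol t0) mt hb hc.
have E1 : \int[mu]_(x in `]0, m t s[) ((u x s - u x t) / (s - t) * k s x) =
    (\int[mu]_(x in `]0, m t s[) (u x s * k s x) -
     \int[mu]_(x in `]0, m t s[) (u x t * k s x)) / (s - t).
  rewrite -RintegralB// -RintegralZr//; last exact: itgB.
  by apply: eq_Rintegral => x _; field.
have E2 : \int[mu]_(x in `]0, m t s[) (u x t * ((k s x - k t x) / (s - t))) =
    (\int[mu]_(x in `]0, m t s[) (u x t * k s x) -
     \int[mu]_(x in `]0, m t s[) (u x t * k t x)) / (s - t).
  rewrite -RintegralB// -RintegralZr//; last exact: itgB.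
  by apply: eq_Rintegral => x _; field.
move: E; rewrite E1 E2 => E.
rewrite -[X in _ = X + _]addrA -E.
by field.
Qed.

Lemma m_cvg t : 0 < t -> (m t) @ t^' --> ell t.
Proof.
move=> t0; apply/cvgrPdist_le => e e0.
have /cvgrPdist_le/(_ _ e0) := ell_nbhs t0 => h.
apply: nbhs_dnbhs; apply: filterS h => s; rewrite /m.
have [//|st] := leP (ell s) (ell t); rewrite subrr normr0 => h; exact: ltW.
Qed.

Lemma moment_t_cvg t : 0 < t ->
  (fun s => \int[mu]_(x in `]0, m t s[) ((u x s - u x t) / (s - t) * k s x)) @ t^' -->
  (\int[mu]_(x in `]0, ell t[) (ut x t * k t x) : R).
Proof.
move=> t0; have t0' := ltW t0; pose M := ell t.
have M0 : 0 <= M by rewrite ltW// ell_gt0.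
have uL s : 0 <= s -> Z u s \in L2 by move=> s0; have [[? _ _ _] _] := wave_V0 u_sol s0.
have utL : Z ut t \in L2 := wave_L2t u_sol t0'.
have ms s : m t s <= ell s by rewrite ge_min lexx.
have mt s : m t s <= ell t by rewrite ge_min lexx orbT.
have uLm s s' : 0 <= s' -> m t s <= ell s' -> (u^~ s') \_ `]0, m t s[ \in L2.
  move=> s'0 h; rewrite -(restrict_restrict_itv _ h).
  by apply: L2_restrict => //; exact: uL.
have utLm s : (ut^~ t) \_ `]0, m t s[ \in L2.
  by rewrite -(restrict_restrict_itv _ (mt s)); exact: L2_restrict.
pose D s := (fun x => (u x s - u x t) / (s - t)) \_ `]0, m t s[.
have DL s : 0 <= s -> D s \in L2.
  move=> s0; rewrite (_ : D s = (fun x => (s - t)^-1 *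
    (((u^~ s) \_ `]0, m t s[) x - ((u^~ t) \_ `]0, m t s[) x))).
    by apply: L2Z; apply: L2B; apply: uLm.
  apply/funext => x; rewrite /D !patchE; case: ifPn => _; first by rewrite mulrC.
  by rewrite subrr mulr0.
have near_ge0 : \forall s \near t^', 0 <= s.
  by apply: nbhs_dnbhs; near=> s; apply: ltW; near: s; exact: lt_nbhsr.
have DE s : (fun x => D s x - ((ut^~ t) \_ `]0, m t s[) x) =
    (fun x => (u x s - u x t) / (s - t) - ut x t) \_ `]0, m t s[.
  by apply/funext => x; rewrite /D !patchE; case: ifPn => // _; rewrite subrr.
(* [L2deriv] controls the quotient on the common interval only; that this interval fills ]0, ell t[
   is the separate limit [D2]. *)
have D1 : L2cvg t^' (fun s x => D s x - ((ut^~ t) \_ `]0, m t s[) x) (cst 0).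
  split.
  - by apply: filterS near_ge0 => s s0; apply: L2B; [exact: DL|exact: utLm].
  - have : (fun x => Z ut t x - Z ut t x) \in L2 by exact: L2B.
    by under eq_fun do rewrite subrr.
  - have := @L2norm_cvg _ _ (t^') _ _ _ _ (cvg_near0' t0 (wave_deriv u_sol t0')).
    rewrite (_ : (fun s => \int[mu]_x _) =
      (fun s => \int[mu]_x ((D s x - ((ut^~ t) \_ `]0, m t s[) x - cst 0 x) ^+ 2))).
      apply; apply: filterS near_ge0 => s s0.
      by rewrite -DE; apply: L2B; [exact: DL|exact: utLm].
    apply/funext => s; apply: eq_Rintegral => x _.
    by rewrite subr0 -(DE s).
have D2 : L2cvg t^' (fun s => (ut^~ t) \_ `]0, m t s[) (Z ut t).
  have FF : Filter t^' by exact: _.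
  have := @L2cvg_comp _ _ _ _ _ FF _ _ _ (m_cvg t0) (L2cvg_itv (ell t) utL).
  rewrite restrict_restrict_itv//.
  apply: L2cvg_near; apply: nearW => s /=; exact: restrict_restrict_itv.
have := L2cvgD D1 D2.
rewrite (_ : (fun s x => _ + _) = D); last first.
  by apply/funext => s; apply/funext => x; rewrite subrK.
rewrite (_ : (fun x => _ + _) = Z ut t); last first.
  by apply/funext => x; rewrite add0r.
have FF : Filter t^' by exact: _.
move=> /(_ FF) D3.
have kL : L2cvg t^' (fun s => (k s) \_ `[0, M]) ((k t) \_ `[0, M]).
  apply: (@L2cvg_comp _ _ _ _ (nbhs t) _ id (fun s => (k s) \_ `[0, M])).
    exact: cvg_within.
  by apply: L2cvg_unif_continuous => //; exact: (proj1 (kernel_continuous dac)).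
rewrite (integral_ip _ _ (_ : ell t <= M))//.
apply: cvg_trans (L2cvg_ip D3 kL); apply: near_eq_cvg; apply: nearW => s.
by rewrite (integral_ip _ _ (_ : m t s <= M)).
Unshelve. all: by end_near. Qed.

Lemma moment_x_cvg t : 0 < t ->
  (fun s => \int[mu]_(x in `]0, m t s[) (ux x t * ((b s x - b t x) / (s - t)))) @ t^' -->
  (\int[mu]_(x in `]0, ell t[) (ux x t * c t x) : R).
Proof.
move=> t0; have t0' := ltW t0; pose M := ell t.
have M0 : 0 <= M by rewrite ltW// ell_gt0.
have [[_ uxL _ _] _] := wave_V0 u_sol t0'.
have mt s : m t s <= ell t by rewrite ge_min lexx orbT.
have D2 : L2cvg t^' (fun s => (ux^~ t) \_ `]0, m t s[) (Z ux t).
  have FF : Filter t^' by exact: _.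
  have := @L2cvg_comp _ _ _ _ _ FF _ _ _ (m_cvg t0) (L2cvg_itv (ell t) uxL).
  rewrite restrict_restrict_itv//.
  apply: L2cvg_near; apply: nearW => s /=; exact: restrict_restrict_itv.
have kL : L2cvg t^' (fun s => (fun x => (b s x - b t x) / (s - t)) \_ `[0, M])
    ((c t) \_ `[0, M]).
  apply: L2cvg_unif => //.
  - apply: nearW => s; apply: continuous_L2 => x; apply: cvgMl.
    apply: cvgB; [exact: (is_derive_continuous (b_derive s))|
      exact: (is_derive_continuous (b_derive t))].
  - by apply: continuous_L2; exact: slice_continuous (proj2 (kernel_continuous dac)).
  - by move=> e e0; exact: b_quotient.
rewrite (integral_ip _ _ (_ : ell t <= M))//.
apply: cvg_trans (L2cvg_ip D2 kL); apply: near_eq_cvg; apply: nearW => s.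
by rewrite (integral_ip _ _ (_ : m t s <= M)).
Qed.

Lemma moment_trace_cvg t : 0 < t ->
  (fun s => u (m t s) t * ((b s (m t s) - b t (m t s)) / (s - t))) @ t^' -->
  (u (ell t) t * c t (ell t) : R).
Proof.
move=> t0; have t0' := ltW t0.
have m0 s : 0 <= s -> 0 <= m t s by move=> s0; rewrite le_min !ltW ?ell_gt0.
have mt s : m t s <= ell t by rewrite ge_min lexx orbT.
have near_ge0 : \forall s \near t^', 0 <= s.
  by apply: nbhs_dnbhs; near=> s; apply: ltW; near: s; exact: lt_nbhsr.
apply: cvgM.
  apply/cvgrPdist_le => e e0; have [d d0 h] := u_cvg t0 e0.
  have /cvgrPdist_lt/(_ _ d0) := m_cvg t0; apply: filterS2 near_ge0 => s s0 ms.
  by rewrite distrC; apply: h; rewrite ?subrr ?normr0// 1?distrC// m0//= mt.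
have cc : continuous (c t) by exact: slice_continuous (proj2 (kernel_continuous dac)).
have c1 : (fun s => c t (m t s)) @ t^' --> c t (ell t).
  by apply: continuous_cvg; [exact: cc|exact: m_cvg].
apply: cvg_sub0 c1; apply/cvgrPdist_le => e e0.
have := b_quotient t (ell t) e0; apply: filterS2 near_ge0 => s s0 h.
by rewrite sub0r normrN; apply: h; rewrite in_itv/= m0//= mt.
Unshelve. all: by end_near. Qed.

(** Between ell s and ell t the integrand is close to its value [C] at the corner, so the quotient
    behaves like C (ell s - ell t) / (s - t). *)
Lemma moment_layer_cvg t : 0 < t ->
  (fun s => (\int[mu]_(x in `]m t s, ell s[) (u x s * k s x) -
   \int[mu]_(x in `]m t s, ell t[) (u x t * k t x)) / (s - t)) @ t^' -->
  (u (ell t) t * k t (ell t) * dell t : R).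
Proof.
move=> t0; have t0' := ltW t0; set C := _ * k t (ell t).
have /is_derive_quotP lq := ell_d t0.
pose q s := (ell s - ell t) / (s - t).
have Cq : (fun s => C * q s) @ t^' --> C * dell t by apply: cvgMr.
apply: cvg_sub0 Cq; apply/cvgrPdist_le => e e0.
have d1 : 0 < `|dell t| + 1 by rewrite ltr_wpDl.
(* The admissible error of the integrand: the layer has width |q s| |s - t|, and |q s| <= |dell t| +
   1 for s near t. *)
pose e1 := e / (`|dell t| + 1).
have e10 : 0 < e1 by rewrite divr_gt0.
have [d d0 h] := uk_cvg (k := k) t0 e10 (proj1 (kernel_continuous dac)).
near=> s.
have s0 : 0 <= s.
  by near: s; apply: nbhs_dnbhs; near=> s; apply: ltW; near: s; exact: lt_nbhsr.
have st : s != t by near: s; exact: nbhs_dnbhs_neq.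
have sd : `|s - t| < d.
  rewrite distrC; near: s; apply: nbhs_dnbhs; exact: nbhsx_ballx.
have ld : `|ell s - ell t| < d.
  rewrite distrC; near: s; apply: nbhs_dnbhs.
  by have /cvgrPdist_lt/(_ _ d0) := ell_nbhs t0.
have qd : `|q s| <= `|dell t| + 1.
  have : `|dell t - q s| <= 1 by near: s; move/cvgrPdist_le : lq; exact.
  move=> h1; rewrite -(subrK (dell t) (q s)) addrC (le_trans (ler_normD _ _))//.
  by rewrite lerD2l distrC.
have m0 : 0 <= m t s by rewrite le_min !ltW ?ell_gt0.
have mls : m t s <= ell s by rewrite ge_min lexx.
have mlt : m t s <= ell t by rewrite ge_min lexx orbT.
have md : `|ell t - m t s| <= `|ell s - ell t|.
  rewrite /m; have [_|_] := leP (ell s) (ell t); first by rewrite distrC.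
  by rewrite subrr normr0.
have tt : `|t - t| < d by rewrite subrr normr0.
have [_ i1] := moment_integrable s s0 (introT andP (conj m0 mls)).
have [_ i2] := moment_integrable t t0' (introT andP (conj m0 mlt)).
have := integral_near_cst mls i1 (C := C) (e := e1) _; move=> /(_ _)H1.
have := integral_near_cst mlt i2 (C := C) (e := e1) _; move=> /(_ _)H2.
have {}H1 : `|\int[mu]_(x in `]m t s, ell s[) (u x s * k s x) - C * (ell s - m t s)| <=
    e1 * (ell s - m t s).
  apply: H1 => x; rewrite in_itv/= => /andP[mx xl].
  apply: h => //; last by rewrite (ltW (le_lt_trans m0 mx)) ltW.
  have h1 : ell t - m t s < d := le_lt_trans (ler_norm _) (le_lt_trans md ld).
  have h2 : ell s - ell t < d := le_lt_trans (ler_norm _) ld.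
  exact: layer_dist mx xl h1 h2.
have {}H2 : `|\int[mu]_(x in `]m t s, ell t[) (u x t * k t x) - C * (ell t - m t s)| <=
    e1 * (ell t - m t s).
  apply: H2 => x; rewrite in_itv/= => /andP[mx xl].
  apply: h => //; last by rewrite (ltW (le_lt_trans m0 mx)) ltW.
  rewrite ltr0_norm ?subr_lt0// opprB; apply: le_lt_trans ld.
  by apply: le_trans md; rewrite ger0_norm ?subr_ge0// lerB// ltW.
have st0 : s - t != 0 by rewrite subr_eq0.
(* One of the two layers is empty, so both error bounds together cost only the distance of the end
   points. *)
have mm : (ell s - m t s) + (ell t - m t s) = `|ell s - ell t|.
  rewrite /m; have [le|lt] := leP (ell s) (ell t).
    by rewrite subrr add0r ler0_norm ?subr_le0// opprB.
  by rewrite subrr addr0 gtr0_norm ?subr_gt0.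
rewrite sub0r normrN !fctE.
set I1 := \int[mu]_(x in `]m t s, ell s[) _ in H1 *.
set I2 := \int[mu]_(x in `]m t s, ell t[) _ in H2 *.
have -> : (I1 - I2) / (s - t) - C * q s =
    ((I1 - C * (ell s - m t s)) - (I2 - C * (ell t - m t s))) / (s - t).
  by rewrite /q; field.
rewrite normrM normfV ler_pdivrMr ?normr_gt0//.
apply: le_trans (ler_normB _ _) _; apply: le_trans (lerD H1 H2) _.
rewrite -mulrDr mm.
have -> : `|ell s - ell t| = `|q s| * `|s - t|.
  by rewrite -normrM /q mulfVK.
rewrite mulrA ler_wpM2r//.
apply: le_trans (ler_wpM2l (ltW e10) qd) _.
by rewrite /e1 mulfVK// gt_eqF.
Unshelve. all: by end_near. Qed.

(** The limit of [moment_quotient], term by term. At the moving end only the trace of u occurs; its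
    factor is the derivative of t -> b t (ell t). *)
Lemma moment_derive t : 0 < t ->
  is_derive t 1 (fun s => \int[mu]_(x in `]0, ell s[) (u x s * k s x))
   (\int[mu]_(x in `]0, ell t[) (ut x t * k t x) -
    \int[mu]_(x in `]0, ell t[) (ux x t * c t x) +
    u (ell t) t * (c t (ell t) + dell t * k t (ell t))).
Proof.
move=> t0; apply/is_derive_quotP.
have := cvgD (cvgB (cvgD (moment_t_cvg t0) (moment_trace_cvg t0)) (moment_x_cvg t0))
  (moment_layer_cvg t0).
have FF : Filter t^' by exact: _.
move/(_ FF FF FF).
rewrite (_ : _ + _ - _ + _ = \int[mu]_(x in `]0, ell t[) (ut x t * k t x) -
    \int[mu]_(x in `]0, ell t[) (ux x t * c t x) +
    u (ell t) t * (c t (ell t) + dell t * k t (ell t))); last by ring.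
apply: cvg_trans; apply: near_eq_cvg; near=> s.
have s0 : 0 <= s.
  by near: s; apply: nbhs_dnbhs; near=> s; apply: ltW; near: s; exact: lt_nbhsr.
have st : s != t by near: s; exact: nbhs_dnbhs_neq.
rewrite !fctE; exact: (esym (moment_quotient (ltW t0) s0 st)).
Unshelve. all: by end_near. Qed.

End moment.

End wave.

(** * Conservation of the dual pairing *)

Lemma within_continuous_for {R : realType} (f : R -> R) (a b : R) :
  (forall t, t \in `[a, b] -> {for t, continuous f}) -> {within `[a, b], continuous f}.
Proof.
move=> fc; apply/subspace_continuousP => t tab.
by apply: cvg_trans (fc t tab); apply: cvg_app; exact: cvg_within.
Qed.

Section duality.
Context {R : realType}.
Notation mu := (@lebesgue_measure R).
Implicit Types (t s x e : R).
Variables (eta : R) (ell dell u0 u1 : R -> R) (u ux ut : R -> R -> R).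
Hypothesis ell_cont : {within `[0, +oo[, continuous ell}.
Hypothesis ell_gt0 : forall t, 0 <= t -> 0 < ell t.
Hypothesis ell_d : forall t : R, 0 < t -> is_derive t 1 ell (dell t).
Hypothesis dell_c : forall t : R, 0 < t -> {for t, continuous dell}.
Hypothesis u_sol : wave_solution eta ell dell u0 u1 u ux ut.

(** This is J_a. For u = f (t + x) - f (t - x) it equals twice the integral of f' a over
    [t - ell t, t + ell t]. *)
Definition pairing (a : R -> R) t := \int[mu]_(x in `]0, ell t[)
  ((ut x t + ux x t) * a (t + x) - (ut x t - ux x t) * a (t - x)).

Variables (a da : R -> R).
Hypothesis ad : forall x : R, is_derive x 1 a (da x).
Hypothesis dac : continuous da.

Let ac : continuous a := is_derive_continuous ad.
Let V t x := a (t + x) - a (t - x).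
Let b t x := a (t + x) + a (t - x).
Let k t x := da (t + x) - da (t - x).
Let c t x := da (t + x) + da (t - x).

Let Vc : continuous (fun z : R * R => V z.1 z.2) := proj1 (kernel_continuous ac).
Let bc : continuous (fun z : R * R => b z.1 z.2) := proj2 (kernel_continuous ac).
Let kc : continuous (fun z : R * R => k z.1 z.2) := proj1 (kernel_continuous dac).
Let cc : continuous (fun z : R * R => c z.1 z.2) := proj2 (kernel_continuous dac).

Let I (w f : R -> R -> R) t := \int[mu]_(x in `]0, ell t[) (w x t * f t x).
Let U t := u (ell t) t.

Lemma I_integrable (w f : R -> R -> R) t : inL2 (ell t) (w^~ t) ->
  continuous (fun z : R * R => f z.1 z.2) ->
  mu.-integrable `]0, ell t[ (EFin \o (fun x => w x t * f t x)).
Proof.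
move=> wL fc; apply: integrable_mul_continuous; first exact: inL2_integrable wL _.
exact: slice_continuous.
Qed.

Lemma ux_inL2 t : 0 <= t -> inL2 (ell t) (ux^~ t).
Proof. by move=> t0; have [[_ ? _ _] _] := wave_V0 u_sol t0. Qed.

Lemma pairingE t : 0 <= t -> pairing a t = I ut V t + I ux b t.
Proof.
move=> t0; rewrite /I -RintegralD//.
- by apply: eq_Rintegral => x _; rewrite /V /b; ring.
- by apply: I_integrable => //; exact: wave_L2t u_sol t t0.
- by apply: I_integrable => //; exact: ux_inL2.
Qed.

Lemma pairing_continuous t : 0 <= t ->
  pairing a @ within [set s : R | 0 <= s] (nbhs t) --> pairing a t.
Proof.
move=> t0; rewrite pairingE//.
have h1 := pairing_cvg ell_cont ell_gt0 t0 (ut_L2cvg u_sol t0) Vc.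
have h2 := pairing_cvg ell_cont ell_gt0 t0 (ux_L2cvg u_sol t0) bc.
have FF : Filter (within [set s : R | 0 <= s] (nbhs t)) by exact: _.
have := cvgD h1 h2; move/(_ FF); apply: cvg_trans; apply: near_eq_cvg.
by apply: filterS (near0_ge0 t) => s s0; rewrite pairingE.
Qed.

Lemma I_continuous_ut (f : R -> R -> R) t : 0 < t ->
  continuous (fun z : R * R => f z.1 z.2) -> {for t, continuous (I ut f)}.
Proof.
move=> t0 fc; apply: (cvg_near0 t0); have t0' := ltW t0.
exact: (pairing_cvg ell_cont ell_gt0 t0' (ut_L2cvg u_sol t0') fc).
Qed.

Lemma I_continuous_ux (f : R -> R -> R) t : 0 < t ->
  continuous (fun z : R * R => f z.1 z.2) -> {for t, continuous (I ux f)}.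
Proof.
move=> t0 fc; apply: (cvg_near0 t0); have t0' := ltW t0.
exact: (pairing_cvg ell_cont ell_gt0 t0' (ux_L2cvg u_sol t0') fc).
Qed.

Lemma U_continuous t : 0 < t -> {for t, continuous U}.
Proof.
move=> t0; apply: (cvg_near0 t0).
exact: (trace_cvg ell_cont ell_gt0 u_sol (ltW t0)).
Qed.

Lemma ell_continuous t : 0 < t -> {for t, continuous ell}.
Proof. by move=> t0; exact: ell_nbhs. Qed.

Lemma end_continuous (f : R -> R -> R) t : 0 < t ->
  continuous (fun z : R * R => f z.1 z.2) -> {for t, continuous (fun s => f s (ell s))}.
Proof.
move=> t0 fc.
apply: (@continuous_comp _ _ _ (fun s : R => (s, ell s)) (fun z => f z.1 z.2)).
  by apply: cvg_pair_nbhs; [exact: cvg_id|exact: ell_continuous].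
exact: fc.
Qed.

(* [pairing a = GG - N], where [N] is the moment differentiated in [moment_derive].
   The weak formulation, tested with [chi t * V t x], says [GG' = - H], and when [a]
   is dual to the boundary condition [N' = - H] as well. *)
Let GG t := I ut V t + eta * (U t * V t (ell t)).
Let H t := I ux c t - I ut k t - eta * (U t * (k t (ell t) + dell t * c t (ell t))).

Lemma GG_continuous t : 0 < t -> {for t, continuous GG}.
Proof.
move=> t0; apply: cvgD; first exact: I_continuous_ut.
by apply: cvgMr; apply: cvgM; [exact: U_continuous|exact: end_continuous].
Qed.

Lemma H_continuous t : 0 < t -> {for t, continuous H}.
Proof.
move=> t0; apply: cvgB; first apply: cvgB; [exact: I_continuous_ux|exact: I_continuous_ut|].
apply: cvgMr; apply: cvgM; first exact: U_continuous.
apply: cvgD; first exact: end_continuous.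
by apply: cvgM; [exact: dell_c|exact: end_continuous].
Qed.

Section interval.
Variables (t0 t1 : R).
Hypothesis (t00 : 0 < t0) (t01 : t0 < t1).

Let pos t : t \in `[t0, t1] -> 0 < t.
Proof. by rewrite in_itv/= => /andP[h _]; exact: lt_le_trans h. Qed.

Lemma weak_in_time (chi dchi : R -> R) : test_in t0 t1 chi dchi ->
  \int[mu]_(t in `]t0, t1[) (GG t * dchi t) = - \int[mu]_(t in `]t0, t1[) (- H t * chi t).
Proof.
move=> [chid dchic [a' [b' [ta bt chis]]]].
have dchis x : x \notin `[a', b'] -> dchi x = 0 by exact: test_in_deriv0.
have chic := is_derive_continuous chid.
(* [V t] is odd in x, so v vanishes at x = 0 as [test2] requires; at the moving end it is free, and
   there the boundary condition enters. *)
pose v x t := chi t * V t x.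
pose vx x t := chi t * c t x.
pose vt x t := dchi t * V t x + chi t * k t x.
have tv : test2 v vx vt.
  split.
  - move=> x t; split.
      have dp : is_derive x 1 (fun x => a (t + x)) (da (t + x) * 1).
        by apply: is_derive1_compf; apply: is_derive_eq; rewrite add0r.
      have dm : is_derive x 1 (fun x => a (t - x)) (da (t - x) * -1).
        apply: is_derive1_compf; have := @is_deriveB _ _ _ (cst t) id x 1 0 1.
        by rewrite sub0r; apply.
      by rewrite /v /vx /V /c; apply: is_derive_eq; rewrite /GRing.scale/=; ring.
    have dp : is_derive t 1 (fun t => a (t + x)) (da (t + x) * 1).
      by apply: is_derive1_compf; apply: is_derive_eq; rewrite addr0.
    have dm : is_derive t 1 (fun t => a (t - x)) (da (t - x) * 1).
      by apply: is_derive1_compf; apply: is_derive_eq; rewrite subr0.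
    have dc := chid t.
    by rewrite /v /vt /V /k; apply: is_derive_eq; rewrite /GRing.scale/=; ring.
  - move=> z; apply: cvgM.
      by apply: (@continuous_comp _ _ _ snd chi); [exact: cvg_snd|exact: chic].
    apply: (@continuous_comp _ _ _ (fun z : R * R => (z.2, z.1)) (fun z => c z.1 z.2)).
      by apply: cvg_pair_nbhs; [exact: cvg_snd|exact: cvg_fst].
    exact: cc.
  - move=> z; apply: cvgD; apply: cvgM.
    + by apply: (@continuous_comp _ _ _ snd dchi); [exact: cvg_snd|exact: dchic].
    + apply: (@continuous_comp _ _ _ (fun z : R * R => (z.2, z.1)) (fun z => V z.1 z.2)).
        by apply: cvg_pair_nbhs; [exact: cvg_snd|exact: cvg_fst].
      exact: Vc.
    + by apply: (@continuous_comp _ _ _ snd chi); [exact: cvg_snd|exact: chic].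
    + apply: (@continuous_comp _ _ _ (fun z : R * R => (z.2, z.1)) (fun z => k z.1 z.2)).
        by apply: cvg_pair_nbhs; [exact: cvg_snd|exact: cvg_fst].
      exact: kc.
  - by move=> t; rewrite /v /V addr0 subr0 subrr mulr0.
  - exists a', b'; split; first exact: lt_trans ta.
    by move=> x t /chis; rewrite /v => ->; rewrite mul0r.
have := wave_weak u_sol tv.
have cut0 (f : R -> R) : (forall t, t \notin `[a', b'] -> f t = 0) ->
    \int[mu]_(t in `]0, +oo[) f t = \int[mu]_(t in `]t0, t1[) f t.
  move=> f0; rewrite Rintegral_mkcond [RHS]Rintegral_mkcond; apply: eq_Rintegral => t _.
  rewrite !patchE; case: ifPn => tl; case: ifPn => tm //.
    rewrite f0//; apply: contra tm; rewrite mem_setE !in_itv/= => /andP[? ?].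
    by apply/andP; split; lra.
  by move: tl tm; rewrite !mem_setE !in_itv/= andbT => /negP tl /andP[? _]; exfalso;
    apply: tl; exact: lt_trans t00 _.
rewrite cut0; last first.
  move=> t tab; rewrite (@eq_Rintegral _ _ _ _ _ (cst 0)) ?Rintegral_cst ?mul0r//.
  by move=> x _; rewrite /vx /vt chis// dchis// !mul0r addr0 !mulr0 subrr.
rewrite cut0; last first.
  by move=> t tab; rewrite /vx /vt chis// dchis// !mul0r addr0 !mulr0 addr0 mulr0.
have inner t : t \in `]t0, t1[ -> \int[mu]_(x in `]0, ell t[) (ux x t * vx x t - ut x t * vt x t) =
    chi t * I ux c t - (dchi t * I ut V t + chi t * I ut k t).
  move=> tt; have t0' : 0 <= t by apply: ltW; apply: pos; exact: subset_itv_oo_cc.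
  have i1 := I_integrable (ux_inL2 t0') cc.
  have i2 := I_integrable (wave_L2t u_sol t0') Vc.
  have i3 := I_integrable (wave_L2t u_sol t0') kc.
  rewrite /I -!RintegralZl// -RintegralD//; try exact: itgZ.
  rewrite -RintegralB//; try (by apply: itgD => //; exact: itgZ); try exact: itgZ.
  by apply: eq_Rintegral => x _; rewrite /vx /vt; ring.
have -> : \int[mu]_(t in `]t0, t1[)
    \int[mu]_(x in `]0, ell t[) (ux x t * vx x t - ut x t * vt x t) =
    \int[mu]_(t in `]t0, t1[)
      (chi t * I ux c t - (dchi t * I ut V t + chi t * I ut k t)).
  by apply: eq_Rintegral => t; rewrite inE => /inner.
have wc (f : R -> R) : (forall t, 0 < t -> {for t, continuous f}) -> {within `[t0, t1], continuous f}.
  by move=> fc; apply: within_continuous_for => t /pos; exact: fc.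
have iE (f : R -> R) : (forall t, 0 < t -> {for t, continuous f}) -> mu.-integrable `]t0, t1[ (EFin \o f).
  by move=> fc; apply: within_continuous_integrable_oo; exact: wc.
have iL : mu.-integrable `]t0, t1[ (EFin \o (fun t => chi t * I ux c t - (dchi t * I ut V t + chi t * I ut k t))).
  apply: iE => t tp; apply: cvgB.
    by apply: cvgM; [exact: chic|exact: I_continuous_ux].
  apply: cvgD; first by apply: cvgM; [exact: dchic|exact: I_continuous_ut].
  by apply: cvgM; [exact: chic|exact: I_continuous_ut].
have iR : mu.-integrable `]t0, t1[ (EFin \o (fun t => u (ell t) t * (vt (ell t) t + dell t * vx (ell t) t))).
  apply: iE => t tp; apply: cvgM; first exact: U_continuous.
  apply: cvgD.
    by apply: cvgD; apply: cvgM; [exact: dchic|exact: end_continuous|exact: chic|exact: end_continuous].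
  by apply: cvgM; [exact: dell_c|apply: cvgM; [exact: chic|exact: end_continuous]].
have iG : mu.-integrable `]t0, t1[ (EFin \o (fun t => GG t * dchi t)).
  by apply: iE => t tp; apply: cvgM; [exact: GG_continuous|exact: dchic].
have iH : mu.-integrable `]t0, t1[ (EFin \o (fun t => - H t * chi t)).
  by apply: iE => t tp; apply: cvgM; [apply: cvgN; exact: H_continuous|exact: chic].
move=> E; apply/eqP; rewrite -addr_eq0 -RintegralD//.
move/eqP: E; rewrite -RintegralZl// eq_sym -subr_eq0 -RintegralB//; last exact: itgZ.
congr (_ == 0); apply: eq_Rintegral => t _.
by rewrite /GG /H /vt /vx /U; ring.
Qed.

(** The relation a (t - ell t) = kap * a (t + ell t) cleared of its denominator, in the shape in
    which it exchanges eta V with b at the moving end. *)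
Hypothesis dual : forall t, t \in `[t0, t1] ->
  eta * (a (t + ell t) - a (t - ell t)) = a (t + ell t) + a (t - ell t).

(** Differentiates [dual] along the moving end, inside the interval, where [dual] holds on a
    neighbourhood. It equates the trace term of [H] with that of the derivative of the moment. *)
Lemma dual_derive t : t \in `]t0, t1[ ->
  eta * (k t (ell t) + dell t * c t (ell t)) = c t (ell t) + dell t * k t (ell t).
Proof.
move=> tt; have tp : 0 < t by apply: pos; exact: subset_itv_oo_cc.
have ld := ell_d tp.
have dp : is_derive t 1 (fun t => a (t + ell t)) (da (t + ell t) * (1 + dell t)).
  by apply: is_derive1_compf; apply: is_derive_eq.
have dm : is_derive t 1 (fun t => a (t - ell t)) (da (t - ell t) * (1 - dell t)).
  by apply: is_derive1_compf; apply: is_derive_eq.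
have [_ h1] : is_derive t 1 (fun t => eta * (a (t + ell t) - a (t - ell t)))
    (eta * (k t (ell t) + dell t * c t (ell t))).
  by apply: is_derive_eq; rewrite /GRing.scale/= /k /c; ring.
have d2 : is_derive t 1 (fun t => a (t + ell t) + a (t - ell t))
    (c t (ell t) + dell t * k t (ell t)).
  by apply: is_derive_eq; rewrite /k /c; ring.
have [_ <-] : is_derive t 1 (fun t => eta * (a (t + ell t) - a (t - ell t)))
    (c t (ell t) + dell t * k t (ell t)).
  apply: near_eq_is_derive d2.
  have : nbhs t [set` `]t0, t1[].
    by apply: open_nbhs_nbhs; split; [exact: interval_open|].
  by apply: filterS => s ss; rewrite dual//; exact: subset_itv_oo_cc.
by rewrite h1.
Qed.

Lemma pairing_const_pos : pairing a t1 = pairing a t0.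
Proof.
have wc (f : R -> R) : (forall t, 0 < t -> {for t, continuous f}) -> {within `[t0, t1], continuous f}.
  by move=> fc; apply: within_continuous_for => t /pos; exact: fc.
have NH : {within `[t0, t1], continuous (fun t => - H t)}.
  by apply: wc => t tp; apply: cvgN; exact: H_continuous.
(* The constant 1 takes the place of a compactly supported test function, which upgrades the weak
   identity to the increment of [GG] over [t0, t1]. *)
have E1 := weak_ibp t01 (wc _ GG_continuous) (within_continuous_integrable_oo NH)
  weak_in_time (fun x => is_derive_cst (1 : R) x 1) (@cst_continuous _ _ (0 : R)).
have t0c : t0 \in `[t0, t1] by rewrite in_itv/= lexx ltW.
have t1c : t1 \in `[t0, t1] by rewrite in_itv/= lexx ltW.
pose N s := \int[mu]_(x in `]0, ell s[) (u x s * k s x).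
pose dN s := I ut k s - I ux c s + U s * (c s (ell s) + dell s * k s (ell s)).
have Nd s : s \in `[t0, t1] -> is_derive s 1 N (dN s).
  by move=> /pos; exact: (moment_derive ell_cont ell_gt0 ell_d u_sol ad dac).
have dNc : {within `[t0, t1], continuous dN}.
  apply: wc => t tp; apply: cvgD.
    by apply: cvgB; [exact: I_continuous_ut|exact: I_continuous_ux].
  apply: cvgM; first exact: U_continuous.
  apply: cvgD; first exact: end_continuous.
  by apply: cvgM; [exact: dell_c|exact: end_continuous].
have E2 := FTC2 (ltW t01) Nd dNc.
have EN t : t \in `[t0, t1] -> pairing a t = GG t - N t.
  move=> /[dup] tt /pos tp; have tp' := ltW tp; rewrite pairingE// /GG /N.
  have mt : 0 <= ell t <= ell t by rewrite lexx andbT ltW// ell_gt0.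
  rewrite (V0_ibp (wave_V0 u_sol tp') mt (fun x => b_derive ad t x)); last first.
    exact: slice_continuous kc.
  (* Integrating [ux] by parts left the trace of u times b; by duality this is the boundary term of
     [GG]. *)
  have -> : a (t + ell t) + a (t - ell t) = eta * V t (ell t) by rewrite -dual.
  rewrite /U /I /b; ring.
have HN : \int[mu]_(t in `]t0, t1[) dN t = \int[mu]_(t in `]t0, t1[) (- H t * cst 1 t).
  apply: eq_Rintegral => t; rewrite inE/= => tt.
  by rewrite /dN /H /cst mulr1 -(dual_derive tt); ring.
have Z0 : \int[mu]_(t in `]t0, t1[) (GG t * cst 0 t) = 0.
  rewrite (@eq_Rintegral _ _ _ _ _ (cst 0)) ?Rintegral_cst ?mul0r//.
  by move=> x _; rewrite mulr0.
rewrite !EN//; move: E1 E2; rewrite Z0 HN /cst; lra.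
Qed.

End interval.

Lemma pairing_const t0 t1 : 0 <= t0 -> t0 <= t1 ->
  (forall t, t \in `[t0, t1] ->
    eta * (a (t + ell t) - a (t - ell t)) = a (t + ell t) + a (t - ell t)) ->
  pairing a t1 = pairing a t0.
Proof.
rewrite le_eqVlt => /predU1P[<-|t00]; last first.
  by rewrite le_eqVlt => /predU1P[->//|t01] h; exact: pairing_const_pos.
rewrite le_eqVlt => /predU1P[<-//|t10] h.
(* The weak formulation sees only positive times; time 0 is reached by continuity from the right. *)
have := pairing_continuous (lexx 0) => pc.
have p1 : pairing a @ (0 : R)^'+ --> pairing a 0.
  apply: cvg_trans pc; apply: cvg_app => P [e /= e0 Pe].
  by exists e => // x xe x0; apply: Pe => //=; exact: ltW.
apply: (cvg_unique (@Rhausdorff R) _ p1); apply: cvg_near_cst.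
near=> s.
have s0 : 0 < s by near: s; exact: nbhs_right_gt.
have s1 : s < t1 by near: s; exact: nbhs_right_lt.
apply/esym/pairing_const_pos => // t; rewrite in_itv/= => /andP[st tt1].
by apply: h; rewrite in_itv/= tt1 andbT (le_trans (ltW s0)).
Unshelve. all: by end_near. Qed.

End duality.

(** * The moving end point *)

Section C1_extension.
Context {R : realType}.
Implicit Types (f g : R -> R).

Lemma deriv_within_interior (D : set R) f (df : R -> R) (x : R) :
  deriv_within D f df -> nbhs x D -> is_derive x 1 f (df x).
Proof.
move=> fD Dx; apply/is_derive_quotP; apply: cvg_trans (fD x (nbhs_singleton Dx)).
apply: cvg_app => P PD.
have {}PD : \forall y \near x^', D y -> P y by exact: PD.
have DD : \forall y \near x^', D y by exact: nbhs_dnbhs.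
suff : \forall y \near x^', P y by [].
by apply: filterS2 PD DD => y; exact.
Qed.

Lemma deriv_within_right (A x : R) f (df : R -> R) : A <= x ->
  deriv_within `[A, +oo[ f df -> (fun y => (f y - f x) / (y - x)) @ x^'+ --> df x.
Proof.
move=> Ax fD; have := fD x; rewrite /= in_itv/= Ax => /(_ isT).
apply: cvg_trans; apply: cvg_app => P PD.
have {}PD : \forall y \near x^', y \in `[A, +oo[ -> P y by exact: PD.
have [e /= e0 eP] := PD; exists e => // y ye xy.
apply: (eP y ye); first by rewrite gt_eqF.
by rewrite in_itv/= andbT (le_trans Ax)// ltW.
Qed.

Lemma is_derive_affine (p q z x : R) : is_derive x 1 (fun y => p + q * (y - z)) q.
Proof. by apply: is_derive_eq; rewrite /GRing.scale/=; ring. Qed.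

Lemma quot_left f (x d : R) : is_derive x 1 f d ->
  (fun y => (f y - f x) / (y - x)) @ x^'- --> d.
Proof.
move=> /is_derive_quotP; apply: cvg_trans; apply: cvg_app => P [e /= e0 eP].
by exists e => // y ye yx; apply: eP => //; rewrite lt_eqF.
Qed.

Lemma quot_right f (x d : R) : is_derive x 1 f d ->
  (fun y => (f y - f x) / (y - x)) @ x^'+ --> d.
Proof.
move=> /is_derive_quotP; apply: cvg_trans; apply: cvg_app => P [e /= e0 eP].
by exists e => // y ye yx; apply: eP => //; rewrite gt_eqF.
Qed.

(** Outside [A, B] the function is continued along its tangents, so dg is df composed with the clamp
    [cl] onto [A, B]. Hence dg takes only values of df on a compact segment and inherits a positive
    lower bound from there. *)
Lemma C1_extension (A B : R) f (df : R -> R) : A < B ->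
  deriv_within `[A, +oo[ f df -> {within `[A, +oo[, continuous df} ->
  exists g dg, [/\ forall y : R, is_derive y 1 g (dg y), continuous dg,
    forall y, y \in `[A, B] -> g y = f y /\ dg y = df y &
    forall y, exists2 z, z \in `[A, B] & dg y = df z].
Proof.
move=> AB fD dfc.
pose l y := f A + df A * (y - A); pose r y := f B + df B * (y - B).
pose h y := if y < B then f y else r y.
pose g y := if y < A then l y else h y.
pose cl y := Num.max A (Num.min y B).
have clE y : y \in `[A, B] -> cl y = y.
  by rewrite in_itv/= => /andP[Ay yB]; rewrite /cl min_l// max_r.
have clI y : cl y \in `[A, B].
  by rewrite in_itv/= /cl le_max lexx/= ge_max (ltW AB) ge_min lexx orbT.
have lA : l A = f A by rewrite /l subrr mulr0 addr0.
have rB : r B = f B by rewrite /r subrr mulr0 addr0.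
have intD x : A < x -> is_derive x 1 f (df x).
  move=> Ax; apply: (deriv_within_interior fD).
  have : \forall y \near x, A < y by exact: lt_nbhsr.
  by apply: filterS => y Ay /=; rewrite in_itv/= andbT ltW.
exists g, (df \o cl); split.
- move=> y; rewrite /=; have [yA|Ay|->] := ltgtP y A.
  + have -> : cl y = A by rewrite /cl min_l ?max_l//; apply: ltW => //; exact: lt_trans AB.
    apply: near_eq_is_derive (is_derive_affine (f A) (df A) A y).
    have : \forall z \near y, z < A by exact: lt_nbhsl.
    by apply: filterS => z zA; rewrite /g zA.
  + have nA : \forall z \near y, A < z by exact: lt_nbhsr.
    have [yB|By|yB] := ltgtP y B.
    * rewrite clE; last by rewrite in_itv/= !ltW.
      apply: near_eq_is_derive (intD y Ay).
      have : \forall z \near y, z < B by exact: lt_nbhsl.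
      by apply: filterS2 nA => z Az zB; rewrite /g ltNge (ltW Az)/= /h zB.
    * have -> : cl y = B by rewrite /cl min_r ?max_r// ltW.
      apply: near_eq_is_derive (is_derive_affine (f B) (df B) B y).
      have : \forall z \near y, B < z by exact: lt_nbhsr.
      by apply: filterS2 nA => z Az zB; rewrite /g ltNge (ltW Az)/= /h ltNge (ltW zB).
    * rewrite yB clE; last by rewrite in_itv/= lexx ltW.
      have hB : is_derive B 1 h (df B).
        apply: is_derive_glue => //; first exact/quot_left/intD.
        exact/quot_right/is_derive_affine.
      apply: near_eq_is_derive hB.
      have : \forall z \near B, A < z by exact: lt_nbhsr.
      by apply: filterS => z Az; rewrite /g ltNge (ltW Az).
  + rewrite clE; last by rewrite in_itv/= lexx ltW.
    have hA : h A = f A by rewrite /h AB.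
    apply: is_derive_glue; first by rewrite lA.
      exact/quot_left/is_derive_affine.
    apply: cvg_trans (deriv_within_right (lexx A) fD); apply: near_eq_cvg; near=> z.
    by rewrite hA /h ifT//; near: z; exact: nbhs_right_lt.
- move=> y; move/subspace_continuousP : dfc => /(_ (cl y)).
  have clA : A <= cl y by have := clI y; rewrite in_itv/= => /andP[].
  rewrite /= in_itv/= clA => /(_ isT) dfc.
  have clc : {for y, continuous cl}.
    apply: (@continuous_max _ _ (cst A) (fun x => Num.min x B)); first exact: cst_continuous.
    by apply: (@continuous_min _ _ id (cst B)); [exact: cvg_id|exact: cst_continuous].
  move=> P /= Py; have {}dfc : \forall z \near cl y, z \in `[A, +oo[ -> P (df z) by exact: (dfc P Py).
  have {}clc : \forall z \near y, cl z \in `[A, +oo[ -> P (df (cl z)) by exact: (clc _ dfc).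
  have : \forall z \near y, P (df (cl z)).
    apply: filterS clc => z; apply; have := clI z.
    by rewrite !in_itv/= andbT => /andP[].
  exact.
- move=> y /[dup] yAB /clE clEy; rewrite /= clEy; split=> //.
  move: yAB; rewrite in_itv/= => /andP[Ay yB]; rewrite /g ltNge Ay/= /h.
  by case: ltP => // By; have -> : y = B by apply/eqP; rewrite eq_le yB By.
- by move=> y; exists (cl y); [exact: clI|].
Unshelve. all: by end_near. Qed.

(** A slope of at least d makes g grow at least linearly in both directions: this gives injectivity,
    and surjectivity by intermediate values on the segment between 0 and (w - g 0) / d. *)
Lemma C1_inverse g (dg : R -> R) (d : R) : 0 < d ->
  (forall y : R, is_derive y 1 g (dg y)) -> continuous dg -> (forall y, d <= dg y) ->
  exists h, [/\ cancel g h, cancel h g,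
    forall z : R, is_derive z 1 h (dg (h z))^-1 & continuous (fun z => (dg (h z))^-1)].
Proof.
move=> d0 gd dgc dgd.
have gc := is_derive_continuous gd.
have grow y z : y <= z -> g y + d * (z - y) <= g z.
  move=> yz; have [c _ E] := @MVT_segment _ g dg y z yz (fun x _ => gd x) (continuous_subspaceT gc).
  rewrite -lerBrDl E ler_wpM2r// subr_ge0//.
have surj w : exists y, g y = w.
  have [h|h] := leP (g 0) w.
    have y0 : 0 <= (w - g 0) / d by rewrite divr_ge0 ?subr_ge0// ltW.
    have G := grow _ _ y0; rewrite subr0 mulrC divfK ?gt_eqF// addrC subrK in G.
    have [||c _ cw] := @IVT _ g 0 ((w - g 0) / d) w y0.
    - exact: continuous_subspaceT.
    - by rewrite ge_min h le_max G orbT.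
    - by exists c.
  have y0 : (w - g 0) / d <= 0 by rewrite pmulr_lle0 ?invr_gt0// subr_le0 ltW.
  have G := grow _ _ y0; rewrite sub0r mulrN (mulrC d) divfK ?gt_eqF// in G.
  have [||c _ cw] := @IVT _ g ((w - g 0) / d) 0 w y0.
  - exact: continuous_subspaceT.
  - by rewrite ge_min le_max (ltW h) orbT andbT; apply/orP; left; lra.
  - by exists c.
have [h hE] := choice surj.
have gi : injective g.
  move=> y z gyz; apply/eqP; rewrite eq_le; apply/andP; split; rewrite leNgt; apply/negP => yz.
    by have := grow _ _ (ltW yz); rewrite gyz; have := mulr_gt0 d0 (_ : 0 < y - z); rewrite subr_gt0 => /(_ yz); lra.
  by have := grow _ _ (ltW yz); rewrite gyz; have := mulr_gt0 d0 (_ : 0 < z - y); rewrite subr_gt0 => /(_ yz); lra.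
have gK : cancel g h by move=> y; apply: gi; rewrite hE.
have hd (z : R) : is_derive z 1 h (dg (h z))^-1.
  rewrite -{1}(hE z); apply: (@is_derive_inverse _ g).
  - by exists 1 => [|y _]; [rewrite /= ltr01|exact: gK].
  - by exists 1 => [|y _]; [rewrite /= ltr01|exact: gc].
  - by rewrite gt_eqF// (lt_le_trans d0).
exists h; split=> // z; apply: cvgV; first by rewrite gt_eqF// (lt_le_trans d0).
apply: (@continuous_comp _ _ _ h dg); last exact: dgc.
exact: (is_derive_continuous hd).
Qed.

End C1_extension.

Section geometry.
Context {R : realType}.
Implicit Types (s t x y : R).
Variables (ell dell phi dphi : R -> R).
Hypothesis ell_cont : {within `[0, +oo[, continuous ell}.
Hypothesis ell_gt0 : forall t, 0 <= t -> 0 < ell t.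
Hypothesis ell_deriv : deriv_within `[0, +oo[ ell dell.
Hypothesis dell_lt1 : forall t, 0 <= t -> `|dell t| < 1.
Hypothesis phi_deriv : deriv_within `[- ell 0, +oo[ phi dphi.
Hypothesis dphi_cont : {within `[- ell 0, +oo[, continuous dphi}.
Hypothesis dphi_gt0 : forall y, - ell 0 <= y -> 0 < dphi y.
Hypothesis phi_ell : forall t, 0 <= t -> phi (t + ell t) - phi (t - ell t) = 2.

Lemma ell_is_derive t : 0 < t -> is_derive t 1 ell (dell t).
Proof.
move=> t0; apply: (deriv_within_interior ell_deriv).
have : \forall y \near t, 0 < y by exact: lt_nbhsr.
by apply: filterS => y y0 /=; rewrite in_itv/= andbT ltW.
Qed.

Lemma ell_within s t : 0 <= s -> {within `[s, t], continuous ell}.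
Proof.
move=> s0; apply: continuous_subspaceW ell_cont => x /=.
by rewrite !in_itv/= andbT => /andP[/(le_trans s0)].
Qed.

Lemma ell_lip s t : 0 <= s -> s < t -> `|ell t - ell s| < t - s.
Proof.
move=> s0 st.
have [||c cst ->] := @MVT _ ell dell s t st.
- by move=> x; rewrite in_itv/= => /andP[sx _]; apply: ell_is_derive; exact: le_lt_trans sx.
- exact: ell_within.
have c0 : 0 <= c by move: cst; rewrite in_itv/= => /andP[/ltW sc _]; exact: le_trans sc.
have ts : 0 < t - s by rewrite subr_gt0.
by rewrite normrM (gtr0_norm ts) gtr_pMl// dell_lt1.
Qed.

Lemma lower_lt s t : 0 <= s -> s < t -> s - ell s < t - ell t.
Proof. by move=> s0 st; have := ell_lip s0 st; rewrite ltr_norml => /andP[]; lra. Qed.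

Lemma upper_lt s t : 0 <= s -> s < t -> s + ell s < t + ell t.
Proof. by move=> s0 st; have := ell_lip s0 st; rewrite ltr_norml => /andP[]; lra. Qed.

Lemma lower_le s t : 0 <= s -> s <= t -> s - ell s <= t - ell t.
Proof. by move=> s0; rewrite le_eqVlt => /predU1P[->//|st]; exact/ltW/lower_lt. Qed.

Lemma upper_le s t : 0 <= s -> s <= t -> s + ell s <= t + ell t.
Proof. by move=> s0; rewrite le_eqVlt => /predU1P[->//|st]; exact/ltW/upper_lt. Qed.

Lemma lower_ge t : 0 <= t -> - ell 0 <= t - ell t.
Proof. by move=> t0; have := lower_le (lexx 0) t0; rewrite sub0r. Qed.

Lemma upper_ge t : 0 <= t -> - ell 0 < t + ell t.
Proof. by move=> t0; have := lower_ge t0; have := ell_gt0 t0; lra. Qed.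

Lemma phi_is_derive y : - ell 0 < y -> is_derive y 1 phi (dphi y).
Proof.
move=> t0; apply: (deriv_within_interior phi_deriv).
have : \forall z \near y, - ell 0 < z by exact: lt_nbhsr.
by apply: filterS => z z0 /=; rewrite in_itv/= andbT ltW.
Qed.

Lemma dphi_ell t : 0 < t ->
  dphi (t + ell t) * (1 + dell t) = dphi (t - ell t) * (1 - dell t).
Proof.
move=> t0; have ld := ell_is_derive t0.
have ml : - ell 0 < t - ell t by have := lower_lt (lexx 0) t0; rewrite sub0r.
have pl := upper_ge (ltW t0).
have phip := phi_is_derive pl; have phim := phi_is_derive ml.
have dp : is_derive t 1 (fun t => phi (t + ell t)) (dphi (t + ell t) * (1 + dell t)).
  by apply: is_derive1_compf; apply: is_derive_eq.
have dm : is_derive t 1 (fun t => phi (t - ell t)) (dphi (t - ell t) * (1 - dell t)).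
  by apply: is_derive1_compf; apply: is_derive_eq.
have [_ h1] := is_deriveB dp dm.
have : is_derive t 1 (fun t => phi (t + ell t) - phi (t - ell t)) 0.
  apply: (@near_eq_is_derive R R R (cst (2 : R))).
  have : \forall z \near t, 0 < z by exact: lt_nbhsr.
  by apply: filterS => z z0; rewrite phi_ell// ltW.
move=> [_ h2]; move: h1; rewrite (_ : _ - _ = fun t => phi (t + ell t) - phi (t - ell t))//.
by rewrite h2; lra.
Qed.

Lemma dphi_continuous y : - ell 0 < y -> {for y, continuous dphi}.
Proof.
move=> y0; move/subspace_continuousP : dphi_cont => /(_ y).
rewrite /= in_itv/= (ltW y0) => /(_ isT).
apply: cvg_trans; apply: cvg_app => P PD.
have {}PD : \forall z \near y, z \in `[- ell 0, +oo[ -> P z by exact: PD.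
suff : \forall z \near y, P z by [].
have : \forall z \near y, - ell 0 < z by exact: lt_nbhsr.
by apply: filterS2 PD => z h z0; apply: h; rewrite in_itv/= andbT ltW.
Qed.

(** Continuity of ell' comes from phi: [dphi_ell] is linear in dell t, and solving it gives (m - p)
    / (p + m), whose denominator is positive. *)
Lemma dell_continuous t : 0 < t -> {for t, continuous dell}.
Proof.
move=> t0.
have lc : {for t, continuous ell}.
  apply: differentiable_continuous; apply/derivable1_diffP.
  by have [] := ell_is_derive t0.
pose p s := dphi (s + ell s); pose m s := dphi (s - ell s).
have pc : {for t, continuous p}.
  apply: (@continuous_comp _ _ _ (fun s => s + ell s) dphi).
    by apply: cvgD; [exact: cvg_id|exact: lc].
  exact: dphi_continuous (upper_ge (ltW t0)).
have mc : {for t, continuous m}.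
  apply: (@continuous_comp _ _ _ (fun s => s - ell s) dphi).
    by apply: cvgB; [exact: cvg_id|exact: lc].
  by apply: dphi_continuous; have := lower_lt (lexx 0) t0; rewrite sub0r.
have pos s : 0 < s -> 0 < p s + m s.
  by move=> /ltW s0; rewrite addr_gt0// dphi_gt0//; [exact/ltW/upper_ge|exact: lower_ge].
have dE s : 0 < s -> dell s = (m s - p s) / (p s + m s).
  move=> s0; have ps := pos s s0; apply: (canRL (mulfK _)); first by rewrite gt_eqF.
  by have := dphi_ell s0; rewrite /p /m; lra.
suff : dell @ nbhs t --> dell t by [].
rewrite dE//.
have h : (fun s => (m s - p s) / (p s + m s)) @ t --> (m t - p t) / (p t + m t).
  apply: cvgM; first by apply: cvgB; [exact: mc|exact: pc].
  by apply: cvgV; [rewrite gt_eqF// pos|apply: cvgD; [exact: pc|exact: mc]].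
apply: cvg_trans h; apply: near_eq_cvg.
have : \forall z \near t, 0 < z by exact: lt_nbhsr.
by apply: filterS => z /dE.
Qed.

End geometry.

(** * Weighted energies *)

Section chain.
Context {R : realType}.

(** Induction on the number of steps of length at most d. It globalises comparisons that reflection
    provides only for nearby times. *)
Lemma chain_nonincreasing (F : R -> R) (d a b : R) : 0 < d ->
  (forall s t, a <= s -> s <= t -> t <= b -> t - s <= d -> F t <= F s) ->
  forall s t, a <= s -> s <= t -> t <= b -> F t <= F s.
Proof.
move=> d0 Fd.
have H (n : nat) s t : a <= s -> s <= t -> t <= b -> t - s <= n%:R * d -> F t <= F s.
  elim: n s t => [|n IH] s t as_ st tb.
    by rewrite mul0r subr_le0 => ts; have -> : s = t by apply/eqP; rewrite eq_le st.
  move=> tn; have [tsd|dts] := leP (t - s) d; first exact: Fd.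
  apply: (@le_trans _ _ (F (s + d))).
    apply: IH => //; [lra|lra|].
    by move: tn; rewrite -natr1 mulrDl mul1r; lra.
  by apply: Fd => //; lra.
move=> s t as_ st tb; apply: (H (Num.bound ((t - s) / d))) => //.
rewrite -ler_pdivrMr//; apply: le_trans (ltW (archi_boundP _)) => //.
by rewrite divr_ge0 ?subr_ge0// ltW.
Qed.

Lemma L2_mul_continuous (l : R) (f k : R -> R) : inL2 l f -> continuous k ->
  inL2 l (fun x => f x * k x).
Proof.
move=> fL kc; have [l0|l0] := ltP l 0.
  rewrite /inL2 (_ : _ \_ _ = f \_ `]0, l[)//; apply/funext => x.
  rewrite !patchE; case: ifPn => //; rewrite mem_setE in_itv/= => /andP[x0 xl].
  by have := lt_trans (lt_trans x0 xl) l0; rewrite ltxx.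
have nkc : {within `[0, l], continuous (fun x => `|k x|)}.
  apply: continuous_subspaceT => x.
  by apply: continuous_comp; [exact: kc|exact: norm_continuous].
have [c _ cM] := EVT_max l0 nkc.
have E : (fun x => f x * k x) \_ `]0, l[ = (fun x => (f \_ `]0, l[) x * k x).
  by apply/funext => x; rewrite !patchE; case: ifPn => // _; rewrite mul0r.
apply: (L2_le _ (L2Z `|k c| fL)).
  rewrite E; apply: measurable_funM; first exact: L2_measurable.
  exact: continuous_measurable_fun.
move=> x; rewrite E !normrM normr_id !patchE; case: ifPn => xl; last by rewrite normr0 mul0r mulr0.
rewrite mulrC ler_wpM2r// cM//; move: xl; rewrite mem_setE; exact: subset_itv_oo_cc.
Qed.

Lemma primitive_right (f : R -> R) (c : R) : continuous f ->
  exists F, forall y : R, c < y -> is_derive y 1 F (f y).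
Proof.
move=> fc; exists (fun y => \int[@lebesgue_measure R]_(t in `[c, y]) f t) => y cy.
have yy : y < y + 1 by lra.
have fi : lebesgue_measure.-integrable `[c, y + 1] (EFin \o f).
  by apply: within_continuous_integrable; exact: continuous_subspaceT.
have [dF dFE] := continuous_FTC1_closed yy fi cy (fc y).
by rewrite -dFE derive1E; exact: derivableP.
Qed.

End chain.

(** * Legendre duality for the weighted energy *)

Section weighted_energy.
Context {R : realType}.
Notation mu := (@lebesgue_measure R).
Implicit Types (t s x y e : R).
Variables (eta : R) (ell dell u0 u1 : R -> R) (u ux ut : R -> R -> R).
Hypothesis eta_gt0 : 0 < eta.
Hypothesis eta_neq1 : eta != 1.
Hypothesis ell_cont : {within `[0, +oo[, continuous ell}.
Hypothesis ell_gt0 : forall t, 0 <= t -> 0 < ell t.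
Hypothesis ell_d : forall t : R, 0 < t -> is_derive t 1 ell (dell t).
Hypothesis dell_c : forall t : R, 0 < t -> {for t, continuous dell}.
Hypothesis lower : forall t, 0 <= t -> - ell 0 <= t - ell t.
Hypothesis u_sol : wave_solution eta ell dell u0 u1 u ux ut.

Variables (T : R) (Phi dPhi Psi dPsi : R -> R).
Hypothesis PhiD : forall y : R, is_derive y 1 Phi (dPhi y).
Hypothesis dPhi_c : continuous dPhi.
Hypothesis PsiD : forall y : R, is_derive y 1 Psi (dPsi y).
Hypothesis dPsi_c : continuous dPsi.
Hypothesis PhiK : cancel Phi Psi.
Hypothesis Phi_le : {homo Phi : x y / x <= y}.
Hypothesis Psi_le : {homo Psi : x y / x <= y}.
Hypothesis Phi_ell : forall t, 0 <= t <= T -> Phi (t + ell t) = Phi (t - ell t) + 2.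

Variable om : R -> R.
Hypothesis om_c : continuous om.
Hypothesis om_gt0 : forall y, 0 < om y.

Definition wenergy t := \int[mu]_(x in `]0, ell t[)
  ((ut x t + ux x t) ^+ 2 * om (t + x) + (ut x t - ux x t) ^+ 2 * om (t - x)).

(** The integral of a^2 / om over [t - ell t, t + ell t], folded onto ]0, ell t[ so that it can be
    compared with [wenergy] under one integral sign. *)
Definition dual_energy (a : R -> R) t := \int[mu]_(x in `]0, ell t[)
  (a (t + x) ^+ 2 / om (t + x) + a (t - x) ^+ 2 / om (t - x)).

Definition kap := (eta - 1) / (eta + 1).

Lemma kap_neq0 : kap != 0.
Proof. by rewrite mulf_neq0 ?subr_eq0// invr_eq0 gt_eqF// addr_gt0. Qed.

Lemma kap_dual (p m : R) : m = kap * p -> eta * (p - m) = p + m.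
Proof. by move=> ->; rewrite /kap; field; rewrite gt_eqF// addr_gt0. Qed.

Lemma plus_inL2 t : 0 <= t -> inL2 (ell t) (fun x => ut x t + ux x t).
Proof.
move=> t0; rewrite /inL2.
rewrite (_ : _ \_ _ = (fun x =>
    ((ut^~ t) \_ `]0, ell t[) x + ((ux^~ t) \_ `]0, ell t[) x)).
  exact: L2D (wave_L2t u_sol t0) (ux_inL2 u_sol t0).
apply/funext => x; rewrite !patchE; case: ifPn => // _.
by rewrite addr0.
Qed.

Lemma minus_inL2 t : 0 <= t -> inL2 (ell t) (fun x => ut x t - ux x t).
Proof.
move=> t0; rewrite /inL2.
rewrite (_ : _ \_ _ = (fun x =>
    ((ut^~ t) \_ `]0, ell t[) x - ((ux^~ t) \_ `]0, ell t[) x)).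
  exact: L2B (wave_L2t u_sol t0) (ux_inL2 u_sol t0).
apply/funext => x; rewrite !patchE; case: ifPn => // _.
by rewrite subrr.
Qed.

Lemma sqr_integrable l (f k : R -> R) : inL2 l f -> continuous k ->
  mu.-integrable `]0, l[ (EFin \o (fun x => f x ^+ 2 * k x)).
Proof.
move=> fL kc; apply: integrable_mul_continuous => //.
have H := L2_intX fL.
have : mu.-integrable `]0, l[ (EFin \o (fun x => (f \_ `]0, l[) x ^+ 2)) by exact: itg_sub.
by apply: eq_integrable => // x xl /=; rewrite patchE xl.
Qed.

Lemma shiftp_c (f : R -> R) t : continuous f -> continuous (fun x => f (t + x)).
Proof. by move=> fc; have := slice_continuous (f := fun s x => f (s + x)) (s := t) (proj1 (shift_continuous fc)). Qed.

Lemma shiftm_c (f : R -> R) t : continuous f -> continuous (fun x => f (t - x)).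
Proof. by move=> fc; have := slice_continuous (f := fun s x => f (s - x)) (s := t) (proj2 (shift_continuous fc)). Qed.

Lemma wenergy_integrable t : 0 <= t -> mu.-integrable `]0, ell t[ (EFin \o (fun x =>
  (ut x t + ux x t) ^+ 2 * om (t + x) + (ut x t - ux x t) ^+ 2 * om (t - x))).
Proof.
move=> t0; apply: itgD => //; apply: sqr_integrable.
- exact: plus_inL2.
- exact: shiftp_c.
- exact: minus_inL2.
- exact: shiftm_c.
Qed.

Lemma continuous_itg (f : R -> R) (a b : R) : continuous f ->
  mu.-integrable `]a, b[ (EFin \o f).
Proof.
by move=> fc; apply: within_continuous_integrable_oo; exact: continuous_subspaceT.
Qed.

Lemma density_c (a : R -> R) : continuous a -> continuous (fun y => a y ^+ 2 / om y).
Proof.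
move=> ac y; apply: cvgM.
  by rewrite expr2; apply: (cvgM (ac y) (ac y)).
by apply: cvgV; [rewrite gt_eqF|exact: om_c].
Qed.

Lemma dual_integrable (a : R -> R) t : continuous a ->
  mu.-integrable `]0, ell t[ (EFin \o (fun x =>
  a (t + x) ^+ 2 / om (t + x) + a (t - x) ^+ 2 / om (t - x))).
Proof.
move=> ac; apply: itgD => //; apply: continuous_itg.
  exact: (shiftp_c (density_c ac)).
exact: (shiftm_c (density_c ac)).
Qed.

Lemma pairing_integrable (a : R -> R) t : 0 <= t -> continuous a ->
  mu.-integrable `]0, ell t[ (EFin \o (fun x =>
  (ut x t + ux x t) * a (t + x) - (ut x t - ux x t) * a (t - x))).
Proof.
move=> t0 ac; apply: itgB => //; apply: integrable_mul_continuous.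
- exact: inL2_integrable (plus_inL2 t0) _.
- exact: shiftp_c.
- exact: inL2_integrable (minus_inL2 t0) _.
- exact: shiftm_c.
Qed.

(** Completion of the square. Kept as an identity, it gives the Legendre inequality and also the
    exact defect, which is needed for the converse. *)
Lemma young (p a w : R) : 0 < w -> 2 * (p * a) - a ^+ 2 / w = p ^+ 2 * w - (a - p * w) ^+ 2 / w.
Proof. by move=> w0; field; rewrite gt_eqF. Qed.

Lemma legendre_le (a : R -> R) t : 0 <= t -> continuous a ->
  2 * pairing ell ux ut a t - dual_energy a t <= wenergy t.
Proof.
move=> t0 ac; rewrite /pairing /dual_energy /wenergy.
have pI := pairing_integrable t0 ac; have dI := dual_integrable t ac.
rewrite -RintegralZl// -RintegralB//; last exact: itgZ.
apply: le_Rintegral => //; [by apply: itgB => //; exact: itgZ|exact: wenergy_integrable|].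
move=> x _; set p := ut x t + ux x t; set q := ut x t - ux x t.
have w1 := om_gt0 (t + x); have w2 := om_gt0 (t - x).
have h1 := young p (a (t + x)) w1; have h2 := young (- q) (a (t - x)) w2.
have s1 : 0 <= (a (t + x) - p * om (t + x)) ^+ 2 / om (t + x) by rewrite divr_ge0 ?sqr_ge0// ltW.
have s2 : 0 <= (a (t - x) - - q * om (t - x)) ^+ 2 / om (t - x) by rewrite divr_ge0 ?sqr_ge0// ltW.
by move: h1 h2; rewrite sqrrN mulNr; lra.
Qed.

(* Equality in [legendre_le] holds for [a (t + x) = p * om (t + x)] and
   [a (t - x) = - q * om (t - x)], with p = ut + ux and q = ut - ux. *)
Lemma legendre_ge (a al be : R -> R) t C e : 0 <= t -> continuous a ->
  al \in Lfun mu 2%:E -> be \in Lfun mu 2%:E -> 0 <= C ->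
  (forall x, x \in `]0, ell t[ -> a (t + x) = al x /\ a (t - x) = be x) ->
  (forall x, x \in `]0, ell t[ -> (om (t + x))^-1 <= C /\ (om (t - x))^-1 <= C) ->
  \int[mu]_x ((((fun x => (ut x t + ux x t) * om (t + x)) \_ `]0, ell t[) x - al x) ^+ 2) <= e ->
  \int[mu]_x ((((fun x => - (ut x t - ux x t) * om (t - x)) \_ `]0, ell t[) x - be x) ^+ 2) <= e ->
  wenergy t - 2 * C * e <= 2 * pairing ell ux ut a t - dual_energy a t.
Proof.
move=> t0 ac alL beL C0 aE omC e1 e2.
set f1 := _ \_ _ in e1; set f2 := _ \_ _ in e2.
have f1L : f1 \in Lfun mu 2%:E.
  by apply: (L2_mul_continuous (plus_inL2 t0)); exact: shiftp_c.
have f2L : f2 \in Lfun mu 2%:E.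
  have qL : inL2 (ell t) (fun x => - (ut x t - ux x t)).
    rewrite /inL2 (_ : _ \_ _ = (fun x => -1 * ((fun x => ut x t - ux x t) \_ `]0, ell t[) x)).
      exact: L2Z (minus_inL2 t0).
    by apply/funext => x; rewrite !patchE; case: ifPn => _; rewrite mulN1r// oppr0.
  by apply: (L2_mul_continuous qL); exact: shiftm_c.
have sub (f : R -> R) : f \in Lfun mu 2%:E ->
    mu.-integrable `]0, ell t[ (EFin \o (fun x => f x ^+ 2)) /\
    \int[mu]_(x in `]0, ell t[) (f x ^+ 2) <= \int[mu]_x (f x ^+ 2).
  move=> fL; have fi := L2_intX fL; split; first exact: itg_sub.
  rewrite Rintegral_mkcond; apply: le_Rintegral => //.
    have := L2_intX (L2_restrict (measurable_itv `]0, ell t[) fL).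
    by apply: eq_integrable => // x _ /=; rewrite !patchE; case: ifPn => // _; rewrite expr0n.
  by move=> x _; rewrite patchE; case: ifPn => // _; exact: sqr_ge0.
have [i1 h1] := sub _ (L2B f1L alL); have [i2 h2] := sub _ (L2B f2L beL).
have pI := pairing_integrable t0 ac; have dI := dual_integrable t ac.
have wI := wenergy_integrable t0.
(* By [young] the left side is the integral of the squared deviations from the optimal density,
   divided by om; and 1 / om <= C. *)
suff : wenergy t - (2 * pairing ell ux ut a t - dual_energy a t) <=
    C * (\int[mu]_(x in `]0, ell t[) ((f1 x - al x) ^+ 2) +
         \int[mu]_(x in `]0, ell t[) ((f2 x - be x) ^+ 2)).
  have : C * (\int[mu]_(x in `]0, ell t[) ((f1 x - al x) ^+ 2) +
         \int[mu]_(x in `]0, ell t[) ((f2 x - be x) ^+ 2)) <= C * (e + e).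
    by rewrite ler_wpM2l// lerD//; [exact: le_trans e1|exact: le_trans e2].
  by lra.
rewrite /wenergy /pairing /dual_energy -RintegralZl// -RintegralB//; last exact: itgZ.
rewrite -RintegralB//; last by apply: itgB => //; exact: itgZ.
rewrite -RintegralD// -RintegralZl//; last exact: itgD.
apply: le_Rintegral => //.
- by apply: itgB => //; apply: itgB => //; exact: itgZ.
- by apply: itgZ => //; exact: itgD.
move=> x xl; have [-> ->] := aE x xl; have [c1 c2] := omC x xl.
have w1 := om_gt0 (t + x); have w2 := om_gt0 (t - x).
rewrite /f1 /f2 !patchE mem_set//; set p := ut x t + ux x t; set q := ut x t - ux x t.
have y1 := young p (al x) w1; have y2 := young (- q) (be x) w2.
have s1 : (p * om (t + x) - al x) ^+ 2 / om (t + x) <= C * (p * om (t + x) - al x) ^+ 2.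
  by rewrite mulrC ler_wpM2r ?sqr_ge0.
have s2 : (- q * om (t - x) - be x) ^+ 2 / om (t - x) <= C * (- q * om (t - x) - be x) ^+ 2.
  by rewrite mulrC ler_wpM2r ?sqr_ge0.
have sqC (c d : R) : (c - d) ^+ 2 = (d - c) ^+ 2 by ring.
rewrite (sqC (al x)) in y1; rewrite (sqC (be x)) sqrrN in y2.
by rewrite mulrDr; lra.
Qed.

(** With F a primitive of a^2 / om, the dual integral is F (t + ell t) - F (t - ell t). The mean
    value theorem leaves boundary terms at a single time r, whose sign can be read off there. *)
Lemma dual_energy_variation (a : R -> R) (s t : R) : continuous a -> 0 <= s -> s < t ->
  exists2 r, r \in `]s, t[ & dual_energy a t - dual_energy a s =
    (a (r + ell r) ^+ 2 / om (r + ell r) * (1 + dell r) -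
     a (r - ell r) ^+ 2 / om (r - ell r) * (1 - dell r)) * (t - s).
Proof.
move=> ac s0 st; pose f y := a y ^+ 2 / om y.
have fc : continuous f := density_c ac.
(* [primitive_right] differentiates only to the right of its base point; by [lower] this one lies to
   the left of every r - ell r. *)
have [F FD] := primitive_right (- ell 0 - 1) fc.
have Fc y : - ell 0 - 1 < y -> {for y, continuous F}.
  by move=> /FD [Fd _]; apply: differentiable_continuous; exact/derivable1_diffP.
have lo r : 0 <= r -> - ell 0 - 1 < r - ell r by move=> /lower; lra.
have DE r : 0 <= r -> dual_energy a r = F (r + ell r) - F (r - ell r).
  move=> r0; have lr := ell_gt0 r0; have lor := lo r r0.
  have ip : mu.-integrable `]0, ell r[ (EFin \o (fun x => f (r + x))).
    by apply: continuous_itg; exact: shiftp_c.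
  have im : mu.-integrable `]0, ell r[ (EFin \o (fun x => f (r - x))).
    by apply: continuous_itg; exact: shiftm_c.
  rewrite /dual_energy RintegralD//.
  have Dp x : x \in `[0, ell r] -> is_derive x 1 (fun x => F (r + x)) (f (r + x)).
    rewrite in_itv/= => /andP[x0 xl]; rewrite -[X in is_derive _ _ _ X]mulr1.
    have FDx : is_derive (r + x) 1 F (f (r + x)) by apply: FD; lra.
    by apply: is_derive1_compf; apply: is_derive_eq; rewrite add0r.
  have Dm x : x \in `[0, ell r] -> is_derive x 1 (fun x => - F (r - x)) (f (r - x)).
    rewrite in_itv/= => /andP[x0 xl].
    have FDx : is_derive (r - x) 1 F (f (r - x)) by apply: FD; lra.
    have : is_derive x 1 (fun x => F (r - x)) (f (r - x) * -1).
      apply: is_derive1_compf; have := @is_deriveB _ _ _ (cst r) id x 1 0 1.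
      by rewrite sub0r; apply.
    by move=> h; apply: is_derive_eq; ring.
  rewrite (FTC2 (ltW lr) Dp); last by apply: continuous_subspaceT; exact: shiftp_c.
  rewrite (FTC2 (ltW lr) Dm); last by apply: continuous_subspaceT; exact: shiftm_c.
  by rewrite addr0 subr0; ring.
rewrite !DE//; last by rewrite (le_trans s0)// ltW.
pose G r := F (r + ell r) - F (r - ell r).
have rpos r : r \in `]s, t[ -> 0 < r.
  by rewrite in_itv/= => /andP[sr _]; exact: le_lt_trans sr.
apply: (@MVT _ G) => //.
- move=> r /rpos r0; have ld := ell_d r0.
  have lr := ell_gt0 (ltW r0); have lor := lo r (ltW r0).
  have FDp : is_derive (r + ell r) 1 F (f (r + ell r)) by apply: FD; lra.
  have FDm : is_derive (r - ell r) 1 F (f (r - ell r)) by apply: FD; lra.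
  have dp : is_derive r 1 (fun t => F (t + ell t)) (f (r + ell r) * (1 + dell r)).
    by apply: is_derive1_compf; apply: is_derive_eq.
  have dm : is_derive r 1 (fun t => F (t - ell t)) (f (r - ell r) * (1 - dell r)).
    by apply: is_derive1_compf; apply: is_derive_eq.
  exact: is_deriveB dp dm.
- apply/subspace_continuousP => r; rewrite /= in_itv/= => /andP[sr rt].
  have r0 : 0 <= r by exact: le_trans sr.
  have lr := ell_gt0 r0; have lor := lo r r0.
  have ec : ell @ within [set` `[s, t]] (nbhs r) --> ell r.
    have /subspace_continuousP/(_ r) := ell_cont.
    rewrite /= in_itv/= r0 => /(_ isT); apply: cvg_trans; apply: cvg_app.
    move=> P [e /= e0 eP]; exists e => // y ye; rewrite /= in_itv/= => /andP[sy _].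
    by apply: eP => //; rewrite in_itv/= andbT (le_trans s0).
  have idc : id @ within [set` `[s, t]] (nbhs r) --> r by exact: cvg_within.
  apply: cvgB.
    apply: (@cvg_comp _ _ _ (fun x => x + ell x) F _ (nbhs (r + ell r))); first exact: cvgD.
    by apply: Fc; lra.
  apply: (@cvg_comp _ _ _ (fun x => x - ell x) F _ (nbhs (r - ell r))); first exact: cvgB.
  exact: Fc.
Qed.

(** The characteristic arriving at the moving end at time t carries t + ell t, and the reflected one
    t - ell t. Through [Phi] the passage between them becomes a translation by 2, hence a monotone
    C^1 map of the whole line. *)
Let tau y := Psi (Phi y + 2).
Let utau y := Psi (Phi y - 2).

Lemma tau_le : {homo tau : x y / x <= y}.
Proof. by move=> x y /Phi_le h; apply: Psi_le; rewrite lerD2r. Qed.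

Lemma utau_le : {homo utau : x y / x <= y}.
Proof. by move=> x y /Phi_le h; apply: Psi_le; rewrite lerD2r. Qed.

Lemma tau_ell t : 0 <= t <= T -> tau (t - ell t) = t + ell t.
Proof. by move=> /Phi_ell h; rewrite /tau -h PhiK. Qed.

Lemma utau_ell t : 0 <= t <= T -> utau (t + ell t) = t - ell t.
Proof. by move=> /Phi_ell h; rewrite /utau h addrK PhiK. Qed.

Lemma comp_C1 (a0 da0 : R -> R) (z : R) :
  (forall y : R, is_derive y 1 a0 (da0 y)) -> continuous da0 ->
  let df y := da0 (Psi (Phi y + z)) * (dPsi (Phi y + z) * dPhi y) in
  (forall y : R, is_derive y 1 (fun y => a0 (Psi (Phi y + z))) (df y)) /\ continuous df.
Proof.
move=> ad dac df; have Phic := is_derive_continuous PhiD.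
have Psic := is_derive_continuous PsiD.
have shc : continuous (fun y => Phi y + z).
  by move=> y; apply: cvgD; [exact: Phic|exact: cvg_cst].
split=> y.
  apply: is_derive1_compf; apply: (is_derive1_compf (f := Psi)).
  by have h := PhiD y; apply: is_derive_eq; rewrite addr0.
apply: cvgM.
  apply: (@continuous_comp _ _ _ (fun y => Psi (Phi y + z)) da0); last exact: dac.
  by apply: (@continuous_comp _ _ _ (fun y => Phi y + z) Psi); [exact: shc|exact: Psic].
apply: cvgM; last exact: dPhi_c.
by apply: (@continuous_comp _ _ _ (fun y => Phi y + z) dPsi); [exact: shc|exact: dPsi_c].
Qed.

(* One reflection forwards and one backwards suffice as long as |t - t'| <= ell t'. *)
Lemma extend_dual (a0 da0 : R -> R) t' lo hi : 0 <= t' <= T ->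
  (forall y : R, is_derive y 1 a0 (da0 y)) -> continuous da0 ->
  t' - ell t' < lo -> hi < t' + ell t' ->
  (forall y, y \notin `[lo, hi] -> a0 y = 0) ->
  exists a da, [/\ forall y : R, is_derive y 1 a (da y), continuous da,
    forall y, t' - ell t' < y < t' + ell t' -> a y = a0 y &
    forall t, 0 <= t <= T -> `|t - t'| <= ell t' -> a (t - ell t) = kap * a (t + ell t)].
Proof.
move=> tT' ad dac lol hil a0s; have k0 := kap_neq0.
have [d1 c1] := comp_C1 2 ad dac; have [d2 c2] := comp_C1 (-2) ad dac.
have hi0 y : t' + ell t' <= y -> a0 y = 0.
  by move=> h; apply: a0s; rewrite in_itv/= (leNgt y hi) (lt_le_trans hil h) andbF.
have lo0 y : y <= t' - ell t' -> a0 y = 0.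
  by move=> h; apply: a0s; rewrite in_itv/= leNgt (le_lt_trans h lol).
have tau0 y : t' - ell t' <= y -> a0 (tau y) = 0.
  by move=> /tau_le; rewrite tau_ell//; exact: hi0.
have utau0 y : y <= t' + ell t' -> a0 (utau y) = 0.
  by move=> /utau_le; rewrite utau_ell//; exact: lo0.
(* On the base interval both reflected terms vanish; the one with [tau] supplies values to its left,
   the one with [utau] values to its right. *)
exists (fun y => a0 y + kap * a0 (tau y) + kap^-1 * a0 (utau y)),
  (fun y => da0 y + kap * (da0 (Psi (Phi y + 2)) * (dPsi (Phi y + 2) * dPhi y)) +
    kap^-1 * (da0 (Psi (Phi y + -2)) * (dPsi (Phi y + -2) * dPhi y))).
split.
- move=> y; have h := ad y; have h1 := d1 y; have h2 := d2 y.
  by rewrite /tau /utau; apply: is_derive_eq.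
- move=> y; apply: cvgD; first (apply: cvgD; first exact: dac).
    by apply: cvgMr; exact: c1.
  by apply: cvgMr; exact: c2.
- move=> y /andP[y1 y2]; rewrite tau0 ?(ltW y1)// utau0 ?(ltW y2)//.
  by rewrite !mulr0 !addr0.
- move=> t tT tt'; have t0 : 0 <= t by case/andP: tT.
  have lt0 := ell_gt0 t0; move: tt'; rewrite ler_norml => /andP[h1 h2].
  (* Because |t - t'| <= ell t', t - ell t lies below t' + ell t' and t + ell t above t' - ell t'.
     Hence one reflected term vanishes at each end, and the remaining ones agree up to the factor
     kap. *)
  rewrite tau_ell// utau_ell// utau0; last by lra.
  rewrite tau0; last by lra.
  by rewrite !mulr0 !addr0 mulrDr mulrA divff// mul1r addrC.
Qed.

Lemma om_inv_bound t : 0 <= t -> exists2 C, 0 < C & forall x, x \in `]0, ell t[ ->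
  (om (t + x))^-1 <= C /\ (om (t - x))^-1 <= C.
Proof.
move=> t0; have lt0 := ell_gt0 t0.
have ll : t - ell t <= t + ell t by lra.
have ic : {within `[t - ell t, t + ell t], continuous (fun y => (om y)^-1)}.
  by apply: continuous_subspaceT => y; apply: cvgV; [rewrite gt_eqF|exact: om_c].
have [c _ cM] := EVT_max ll ic.
exists (om c)^-1; first by rewrite invr_gt0.
by move=> x; rewrite in_itv/= => /andP[x0 xl]; split; apply: cM; rewrite in_itv/=;
  apply/andP; split; lra.
Qed.

Lemma itv_pm t l x : x \in `]0, l[ ->
  [/\ t - l < t + x < t + l, t - l < t - x < t + l, 0 < x & x < l].
Proof.
by rewrite in_itv/= => /andP[x0 xl]; split => //; apply/andP; split; lra.
Qed.

Lemma wenergy_le t' s : 0 <= t' <= T -> 0 <= s <= T -> `|s - t'| <= ell t' ->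
  (forall a, continuous a ->
    (forall t, 0 <= t <= T -> `|t - t'| <= ell t' -> a (t - ell t) = kap * a (t + ell t)) ->
    dual_energy a s <= dual_energy a t') ->
  wenergy t' <= wenergy s.
Proof.
move=> tT' sT st' dual_le.
have t0' : 0 <= t' by case/andP: tT'. have s0 : 0 <= s by case/andP: sT.
have l0 := ell_gt0 t0'.
have [C C0 omC] := om_inv_bound t0'.
apply/ler_addgt0Pr => e e0.
(* [legendre_ge] loses 2 C times the squared L2 error, so this accuracy costs exactly e. *)
have e20 : 0 < e / (2 * C) by rewrite divr_gt0// mulr_gt0.
have f1L : inL2 (ell t') (fun x => (ut x t' + ux x t') * om (t' + x)).
  by apply: (L2_mul_continuous (plus_inL2 t0')); exact: shiftp_c.
have f2L : inL2 (ell t') (fun x => - (ut x t' - ux x t') * om (t' - x)).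
  apply: L2_mul_continuous; last exact: shiftm_c.
  rewrite /inL2 (_ : _ \_ _ = (fun x => -1 * ((fun x => ut x t' - ux x t') \_ `]0, ell t'[) x)).
    exact: L2Z (minus_inL2 t0').
  by apply/funext => x; rewrite !patchE; case: ifPn => _; rewrite mulN1r// oppr0.
have [al [dal [alT al_e]]] := approximable_L2 l0 f1L e20.
have [be [dbe [beT be_e]]] := approximable_L2 l0 f2L e20.
have alL := test1_L2 alT; have beL := test1_L2 beT.
have [ald dalc [a1 [b1 [a10 b1l als]]]] := alT.
have [bed dbec [a2 [b2 [a20 b2l bes]]]] := beT.
(* A common right end for both supports; the 0 keeps t' between t' - bm and t' + bm. *)
pose bm := Num.max 0 (Num.max b1 b2).
have bm0 : 0 <= bm by rewrite le_max lexx.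
have bm1 : b1 <= bm by rewrite !le_max lexx orbT.
have bm2 : b2 <= bm by rewrite !le_max lexx !orbT.
have bml : bm < ell t' by rewrite !gt_max l0 b1l b2l.
have al0 x : x <= 0 -> al x = 0.
  by move=> x0; apply: als; rewrite in_itv/= leNgt (le_lt_trans x0).
have be0 x : x <= 0 -> be x = 0.
  by move=> x0; apply: bes; rewrite in_itv/= leNgt (le_lt_trans x0).
have alb x : bm < x -> al x = 0.
  by move=> x0; apply: als; rewrite in_itv/= (leNgt x) (le_lt_trans bm1 x0) andbF.
have beb x : bm < x -> be x = 0.
  by move=> x0; apply: bes; rewrite in_itv/= (leNgt x) (le_lt_trans bm2 x0) andbF.
(* [al] acts to the right of t' and [be] to the left, each vanishing for x <= 0, so the sum is C^1
   although the optimal density may jump at t'. *)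
pose a0 y := al (y - t') + be (t' - y).
pose da0 y := dal (y - t') - dbe (t' - y).
have a0d y : is_derive y 1 a0 (da0 y).
  have h1 : is_derive y 1 (fun y => al (y - t')) (dal (y - t') * 1).
    by apply: is_derive1_compf; apply: is_derive_eq; rewrite subr0.
  have h2 : is_derive y 1 (fun y => be (t' - y)) (dbe (t' - y) * -1).
    apply: is_derive1_compf; have := @is_deriveB _ _ _ (cst t') id y 1 0 1.
    by rewrite sub0r; apply.
  by rewrite /a0 /da0; apply: is_derive_eq; ring.
have da0c : continuous da0.
  move=> y; apply: cvgB.
    apply: (@continuous_comp _ _ _ (fun y => y - t') dal); last exact: dalc.
    by apply: cvgB; [exact: cvg_id|exact: cvg_cst].
  exact: (shiftm_c dbec).
have lo1 : t' - ell t' < t' - bm by lra.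
have hi1 : t' + bm < t' + ell t' by lra.
have a0s y : y \notin `[t' - bm, t' + bm] -> a0 y = 0.
  rewrite in_itv/= negb_and -!ltNge /a0 => /orP[yl|yh].
    by rewrite al0 ?beb ?addr0//; lra.
  by rewrite alb ?be0 ?addr0//; lra.
have [a [da [ad dac aE adual]]] := extend_dual tT' a0d da0c lo1 hi1 a0s.
have ac := is_derive_continuous ad.
have aE' x : x \in `]0, ell t'[ -> a (t' + x) = al x /\ a (t' - x) = be x.
  have e1 : t' + x - t' = x by rewrite addrAC subrr add0r.
  have e2 : t' - (t' + x) = - x by rewrite opprD addrA subrr add0r.
  have e3 : t' - x - t' = - x by rewrite addrAC subrr add0r.
  have e4 : t' - (t' - x) = x by rewrite opprB addrC subrK.
  move=> /(itv_pm t')[h1 h2 x0 xl]; have nx0 : - x <= 0 by rewrite oppr_le0 ltW.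
  by rewrite !aE// /a0 e1 e2 e3 e4 (be0 (- x))// (al0 (- x))// addr0 add0r.
have G := legendre_ge t0' ac alL beL (ltW C0) aE' omC al_e be_e.
have Lg := legendre_le s0 ac.
have D := dual_le a ac adual.
have P : pairing ell ux ut a t' = pairing ell ux ut a s.
  have K (r1 r2 : R) : 0 <= r1 <= T -> 0 <= r2 <= T -> r1 <= r2 ->
      `|r1 - t'| <= ell t' -> `|r2 - t'| <= ell t' ->
      pairing ell ux ut a r2 = pairing ell ux ut a r1.
    move=> /andP[r10 r1T] /andP[r20 r2T] r12 h1 h2.
    apply: (pairing_const ell_cont ell_gt0 ell_d dell_c u_sol ad dac r10 r12) => t.
    rewrite in_itv/= => /andP[rt tr]; apply: kap_dual; apply: adual.
      by apply/andP; split; lra.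
    by move: h1 h2; rewrite !ler_norml => /andP[? ?] /andP[? ?]; apply/andP; split; lra.
  have tt' : `|t' - t'| <= ell t' by rewrite subrr normr0 ltW.
  by have [h|/ltW h] := leP s t'; [apply: K|apply/esym/K].
have E : 2 * C * (e / (2 * C)) = e by field; rewrite gt_eqF.
by rewrite E P in G; lra.
Qed.

Lemma ell_lower_bound (a b : R) : 0 <= a -> a <= b ->
  exists2 d, 0 < d & forall t, t \in `[a, b] -> d <= ell t.
Proof.
move=> a0 ab; have lc : {within `[a, b], continuous ell}.
  apply: continuous_subspaceW ell_cont => x /=.
  by rewrite !in_itv/= andbT => /andP[/(le_trans a0)].
have [c cab cm] := EVT_min ab lc; exists (ell c) => //.
by apply: ell_gt0; move: cab; rewrite in_itv/= => /andP[/(le_trans a0)].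
Qed.

(** The later time plays the part of t' in [wenergy_le]: the weighted energy falls when the dual
    integral grows. The condition is the sign of the boundary terms of [dual_energy_variation] after
    a (r - ell r) is replaced by kap * a (r + ell r). *)
Lemma wenergy_nonincreasing (al be : R) : 0 <= al -> al <= be -> be <= T ->
  (forall t, t \in `]al, be[ -> kap ^+ 2 * (1 - dell t) * om (t + ell t) <=
     (1 + dell t) * om (t - ell t)) ->
  forall s t, al <= s -> s <= t -> t <= be -> wenergy t <= wenergy s.
Proof.
move=> al0 ab bT cond; have [d d0 dl] := ell_lower_bound al0 ab.
apply: (chain_nonincreasing d0) => s t as_ st tb tsd.
have s0 : 0 <= s by exact: le_trans as_. have t0 : 0 <= t by exact: le_trans st.
have dt : d <= ell t by apply: dl; rewrite in_itv/= tb (le_trans as_).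
have ds : `|s - t| <= ell t by rewrite ler0_norm ?subr_le0// opprB; exact: le_trans dt.
have tT : 0 <= t <= T by rewrite t0 (le_trans tb).
have sT : 0 <= s <= T by rewrite s0 (le_trans st)// (le_trans tb).
apply: wenergy_le => // a ac adual.
move: st; rewrite le_eqVlt => /predU1P[->//|st].
have [r rst E] := dual_energy_variation ac s0 st.
move: rst; rewrite in_itv/= => /andP[sr rt].
rewrite -subr_ge0 E mulr_ge0 ?subr_ge0 ?(ltW st)//.
have rT : 0 <= r <= T by apply/andP; split; lra.
rewrite adual//; last by move: ds; rewrite !ler_norml => /andP[? ?]; apply/andP; split; lra.
have wp := om_gt0 (r + ell r); have wm := om_gt0 (r - ell r).
have := cond r; rewrite in_itv/= (le_lt_trans as_ sr) (lt_le_trans rt tb) => /(_ isT) h.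
have -> : a (r + ell r) ^+ 2 / om (r + ell r) * (1 + dell r) =
  a (r + ell r) ^+ 2 / (om (r + ell r) * om (r - ell r)) * ((1 + dell r) * om (r - ell r)).
  by field; rewrite !gt_eqF.
have -> : (kap * a (r + ell r)) ^+ 2 / om (r - ell r) * (1 - dell r) =
  a (r + ell r) ^+ 2 / (om (r + ell r) * om (r - ell r)) *
  (kap ^+ 2 * (1 - dell r) * om (r + ell r)).
  by field; rewrite !gt_eqF.
by rewrite ler_wpM2l// divr_ge0 ?sqr_ge0// ltW// mulr_gt0.
Qed.

(** Here the earlier time carries the nearly optimal density, and the dual integral has to
    decrease. *)
Lemma wenergy_nondecreasing (al be : R) : 0 <= al -> al <= be -> be <= T ->
  (forall t, t \in `]al, be[ -> (1 + dell t) * om (t - ell t) <=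
     kap ^+ 2 * (1 - dell t) * om (t + ell t)) ->
  forall s t, al <= s -> s <= t -> t <= be -> wenergy s <= wenergy t.
Proof.
move=> al0 ab bT cond; have [d d0 dl] := ell_lower_bound al0 ab.
suff H s t : al <= s -> s <= t -> t <= be -> - wenergy t <= - wenergy s.
  by move=> s t h1 h2 h3; rewrite -lerN2; exact: H.
apply: (chain_nonincreasing (F := fun t => - wenergy t) d0) => {}s {}t as_ st tb tsd.
rewrite lerN2.
have s0 : 0 <= s by exact: le_trans as_. have t0 : 0 <= t by exact: le_trans st.
have dt : d <= ell s by apply: dl; rewrite in_itv/= as_ (le_trans st).
have ds : `|t - s| <= ell s by rewrite ger0_norm ?subr_ge0//; exact: le_trans dt.
have tT : 0 <= t <= T by rewrite t0 (le_trans tb).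
have sT : 0 <= s <= T by rewrite s0 (le_trans st)// (le_trans tb).
apply: wenergy_le => // a ac adual.
move: st; rewrite le_eqVlt => /predU1P[->//|st].
have [r rst E] := dual_energy_variation ac s0 st.
move: rst; rewrite in_itv/= => /andP[sr rt].
rewrite -subr_le0 E mulr_le0_ge0 ?subr_ge0 ?(ltW st)//.
have rT : 0 <= r <= T by apply/andP; split; lra.
rewrite adual//; last by move: ds; rewrite !ler_norml => /andP[? ?]; apply/andP; split; lra.
have wp := om_gt0 (r + ell r); have wm := om_gt0 (r - ell r).
have := cond r; rewrite in_itv/= (le_lt_trans as_ sr) (lt_le_trans rt tb) => /(_ isT) h.
have -> : a (r + ell r) ^+ 2 / om (r + ell r) * (1 + dell r) =
  a (r + ell r) ^+ 2 / (om (r + ell r) * om (r - ell r)) * ((1 + dell r) * om (r - ell r)).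
  by field; rewrite !gt_eqF.
have -> : (kap * a (r + ell r)) ^+ 2 / om (r - ell r) * (1 - dell r) =
  a (r + ell r) ^+ 2 / (om (r + ell r) * om (r - ell r)) *
  (kap ^+ 2 * (1 - dell r) * om (r + ell r)).
  by field; rewrite !gt_eqF.
by rewrite subr_le0 ler_wpM2l// divr_ge0 ?sqr_ge0// ltW// mulr_gt0.
Qed.

End weighted_energy.

(** * Energy bounds *)

Section bounds.
Context {R : realType}.
Notation mu := (@lebesgue_measure R).
Implicit Types (t s x y : R).
Variables (eta : R) (ell dell phi dphi u0 u1 : R -> R) (u ux ut : R -> R -> R).
Hypothesis eta_gt0 : 0 < eta.
Hypothesis eta_neq1 : eta != 1.
Hypothesis ell_cont : {within `[0, +oo[, continuous ell}.
Hypothesis ell_gt0 : forall t, 0 <= t -> 0 < ell t.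
Hypothesis ell_deriv : deriv_within `[0, +oo[ ell dell.
Hypothesis dell_lt1 : forall t, 0 <= t -> `|dell t| < 1.
Hypothesis phi_deriv : deriv_within `[- ell 0, +oo[ phi dphi.
Hypothesis dphi_cont : {within `[- ell 0, +oo[, continuous dphi}.
Hypothesis dphi_gt0 : forall y, - ell 0 <= y -> 0 < dphi y.
Hypothesis phi_ell : forall t, 0 <= t -> phi (t + ell t) - phi (t - ell t) = 2.
Hypothesis u_sol : wave_solution eta ell dell u0 u1 u ux ut.

Let ell_d := ell_is_derive ell_deriv.
Let dell_c : forall t, 0 < t -> {for t, continuous dell}.
Proof.
move=> t t0; exact: (dell_continuous ell_cont ell_gt0 ell_deriv dell_lt1 phi_deriv
  dphi_cont dphi_gt0 phi_ell t0).
Qed.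
Let lower : forall t, 0 <= t -> - ell 0 <= t - ell t.
Proof. by move=> t t0; exact: (lower_ge ell_cont ell_deriv dell_lt1 t0). Qed.
Let dphiE : forall t, 0 < t ->
  dphi (t + ell t) * (1 + dell t) = dphi (t - ell t) * (1 - dell t).
Proof.
by move=> t t0; exact: (dphi_ell ell_cont ell_gt0 ell_deriv dell_lt1 phi_deriv phi_ell t0).
Qed.
Let lo_le s t : 0 <= s -> s <= t -> s - ell s <= t - ell t.
Proof. exact: (lower_le ell_cont ell_deriv dell_lt1). Qed.
Let up_le s t : 0 <= s -> s <= t -> s + ell s <= t + ell t.
Proof. exact: (upper_le ell_cont ell_deriv dell_lt1). Qed.

Lemma derive_ge0_homo (f df : R -> R) : (forall y : R, is_derive y 1 f (df y)) ->
  (forall y, 0 <= df y) -> {homo f : x y / x <= y}.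
Proof.
move=> fd df0 x y xy.
have [c _ E] := @MVT_segment _ f df x y xy (fun z _ => fd z)
  (continuous_subspaceT (is_derive_continuous fd)).
by rewrite -subr_ge0 E mulr_ge0// subr_ge0.
Qed.

(** A finite horizon T is fixed because dphi has a positive minimum on the compact segment
    [- ell 0, T + ell T]; this minimum is the slope bound required by [C1_inverse]. All t - ell t
    and t + ell t with 0 <= t <= T lie in that segment. *)
Lemma phase_extension (T : R) : 0 <= T ->
  exists Phi dPhi Psi dPsi : R -> R,
  [/\ [/\ forall y : R, is_derive y 1 Phi (dPhi y), continuous dPhi &
          forall y, 0 < dPhi y],
      [/\ forall y : R, is_derive y 1 Psi (dPsi y), continuous dPsi & cancel Phi Psi],
      [/\ {homo Phi : x y / x <= y}, {homo Psi : x y / x <= y} &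
          forall t, 0 <= t <= T -> Phi (t + ell t) = Phi (t - ell t) + 2] &
      forall y, y \in `[- ell 0, T + ell T] -> Phi y = phi y /\ dPhi y = dphi y].
Proof.
move=> T0; have l0 := ell_gt0 (lexx 0); have lT := ell_gt0 T0.
have AB : - ell 0 < T + ell T by lra.
have [g [dg [gD dgc gE dgE]]] := C1_extension AB phi_deriv dphi_cont.
have dc : {within `[- ell 0, T + ell T], continuous dphi}.
  by apply: continuous_subspaceW dphi_cont; apply: subset_itvl; rewrite bnd_simp.
have [c cAB cm] := EVT_min (ltW AB) dc.
have d0 : 0 < dphi c by apply: dphi_gt0; move: cAB; rewrite in_itv/= => /andP[].
have dgd y : dphi c <= dg y by have [z /cm h ->] := dgE y.
have dg0 y : 0 < dg y := lt_le_trans d0 (dgd y).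
have [h [gK _ hD dhc]] := C1_inverse d0 gD dgc dgd.
exists g, dg, h, (fun z => (dg (h z))^-1); split => //; split => //.
- by apply: (derive_ge0_homo gD) => y; exact: ltW.
- by apply: (derive_ge0_homo hD) => y; rewrite invr_ge0 ltW.
move=> t /andP[t0 tT].
have lt0 := ell_gt0 t0; have h1 := lower t0; have h2 := up_le t0 tT.
have [-> _] : g (t + ell t) = phi (t + ell t) /\ dg (t + ell t) = dphi (t + ell t).
  by apply: gE; rewrite in_itv/= h2 andbT; lra.
have [-> _] : g (t - ell t) = phi (t - ell t) /\ dg (t - ell t) = dphi (t - ell t).
  by apply: gE; rewrite in_itv/= h1/=; lra.
by have := phi_ell t0; lra.
Qed.

Let lam := ln `|gamma eta|.

(** Since eta > 0, |1 - eta| < 1 + eta. It gives lam its sign, so that [decay] is nonincreasing. *)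
Lemma gamma_gt1 : 1 < `|gamma eta|.
Proof.
have e1 : 1 - eta != 0 by rewrite subr_eq0 eq_sym.
rewrite /gamma normrM normfV ltr_pdivlMr ?normr_gt0// mul1r.
have e2 : 0 <= 1 + eta by rewrite addr_ge0// ltW.
by have e0 := eta_gt0; rewrite [ltRHS]ger0_norm// ltr_norml; apply/andP; split; lra.
Qed.

Lemma lam_ge0 : 0 <= lam.
Proof. by rewrite ln_ge0// ltW// gamma_gt1. Qed.

Lemma expR_lam2 : expR (lam * 2) * kap eta ^+ 2 = 1.
Proof.
have g0 : 0 < `|gamma eta| by rewrite (lt_trans ltr01)// gamma_gt1.
have -> : expR (lam * 2) = gamma eta ^+ 2.
  rewrite mulr_natr mulr2n expRD /lam lnK ?posrE//.
  by rewrite -expr2 real_normK ?num_real.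
have e1 : 1 - eta != 0 by rewrite subr_eq0 eq_sym.
have e2 : eta + 1 != 0 by rewrite gt_eqF// addr_gt0.
by rewrite /gamma /kap; field; rewrite e1 e2.
Qed.

Lemma kap2_le1 : kap eta ^+ 2 <= 1.
Proof.
have h : 1 <= expR (lam * 2) by rewrite -expR0 ler_expR mulr_ge0// lam_ge0.
have := expR_lam2; have := sqr_ge0 (kap eta); nra.
Qed.

Lemma energyE t : 0 <= t -> wenergy ell ux ut (cst 1) t = 4 * energy ell ux ut t.
Proof.
move=> t0; have c1 : continuous (cst (1 : R)) := @cst_continuous R R 1.
have utI := sqr_integrable (wave_L2t u_sol t0) c1.
have uxI := sqr_integrable (ux_inL2 u_sol t0) c1.
have I : mu.-integrable `]0, ell t[ (EFin \o (fun x => ut x t ^+ 2 + ux x t ^+ 2)).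
  have : mu.-integrable `]0, ell t[ (EFin \o (fun x => ut x t ^+ 2 * 1 + ux x t ^+ 2 * 1)).
    exact: itgD.
  by apply: eq_integrable => // x _ /=; rewrite !mulr1.
rewrite /wenergy /energy mulrA (_ : 4 * 2^-1 = 2 :> R); last by field.
rewrite -RintegralZl//; apply: eq_Rintegral => x _ /=; ring.
Qed.

Lemma decay_gt0 (y : R) : 0 < decay eta y. Proof. exact: expR_gt0. Qed.


(** * The weight with constant weighted energy *)

Section weight.
Variables (T : R) (Phi dPhi Psi dPsi : R -> R).
Hypothesis PhiD : forall y : R, is_derive y 1 Phi (dPhi y).
Hypothesis dPhi_c : continuous dPhi.
Hypothesis dPhi_gt0 : forall y, 0 < dPhi y.
Hypothesis PsiD : forall y : R, is_derive y 1 Psi (dPsi y).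
Hypothesis dPsi_c : continuous dPsi.
Hypothesis PhiK : cancel Phi Psi.
Hypothesis Phi_le : {homo Phi : x y / x <= y}.
Hypothesis Psi_le : {homo Psi : x y / x <= y}.
Hypothesis Phi_ell : forall t, 0 <= t <= T -> Phi (t + ell t) = Phi (t - ell t) + 2.
Hypothesis PhiE : forall y, y \in `[- ell 0, T + ell T] -> Phi y = phi y /\ dPhi y = dphi y.
Hypothesis T0 : 0 <= T.

(* With [om = W] the boundary terms in [dual_energy_variation] cancel. *)
Let W y := expR (lam * Phi y) / dPhi y.

Lemma W_gt0 y : 0 < W y. Proof. by rewrite divr_gt0// expR_gt0. Qed.

Lemma W_continuous : continuous W.
Proof.
move=> y; apply: cvgM; last by apply: cvgV; [rewrite gt_eqF|exact: dPhi_c].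
apply: (@continuous_comp _ _ _ (fun y => lam * Phi y) expR); last exact: continuous_expR.
by apply: cvgMr; exact: (is_derive_continuous PhiD).
Qed.

Lemma range_itv t y : 0 <= t <= T -> t - ell t <= y <= t + ell t ->
  y \in `[- ell 0, T + ell T].
Proof.
move=> /andP[t0 tT] /andP[y1 y2]; rewrite in_itv/= (le_trans (lower t0) y1)/=.
exact: le_trans y2 (up_le t0 tT).
Qed.

Lemma W_reflection t : 0 < t -> t <= T ->
  kap eta ^+ 2 * (1 - dell t) * W (t + ell t) = (1 + dell t) * W (t - ell t).
Proof.
move=> t0 tT; have tt : 0 <= t <= T by rewrite (ltW t0).
have lt0 := ell_gt0 (ltW t0).
have [_ dp] : Phi (t + ell t) = phi (t + ell t) /\ dPhi (t + ell t) = dphi (t + ell t).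
  by apply/PhiE/(range_itv tt); rewrite lexx andbT; lra.
have [_ dm] : Phi (t - ell t) = phi (t - ell t) /\ dPhi (t - ell t) = dphi (t - ell t).
  by apply/PhiE/(range_itv tt); rewrite lexx/=; lra.
have -> : W (t + ell t) =
    expR (lam * Phi (t - ell t)) * expR (lam * 2) / dPhi (t + ell t).
  by rewrite /W (Phi_ell tt) mulrDr expRD.
have -> : W (t - ell t) = expR (lam * Phi (t - ell t)) / dPhi (t - ell t) by [].
have E := dphiE t0; rewrite -dp -dm in E.
have p0 := dPhi_gt0 (t + ell t); have m0 := dPhi_gt0 (t - ell t).
have -> : kap eta ^+ 2 * (1 - dell t) * (expR (lam * Phi (t - ell t)) * expR (lam * 2) / dPhi (t + ell t))
  = (expR (lam * 2) * kap eta ^+ 2) * (expR (lam * Phi (t - ell t)) /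
     (dPhi (t + ell t) * dPhi (t - ell t))) * (dPhi (t - ell t) * (1 - dell t)).
  by field; rewrite !gt_eqF.
by rewrite expR_lam2 -E; field; rewrite !gt_eqF.
Qed.

Let S := wenergy ell ux ut W.

Lemma wenergy_const s t : 0 <= s -> s <= t -> t <= T -> S t = S s.
Proof.
move=> s0 st tT; apply/eqP; rewrite eq_le; apply/andP; split.
  apply: (wenergy_nonincreasing eta_gt0 eta_neq1 ell_cont ell_gt0 ell_d dell_c lower u_sol
    PhiD dPhi_c PsiD dPsi_c PhiK Phi_le Psi_le Phi_ell W_continuous W_gt0
    (al := 0) (be := T)) => // r; rewrite in_itv/= => /andP[r0 rT].
  by rewrite W_reflection// ltW.
apply: (wenergy_nondecreasing eta_gt0 eta_neq1 ell_cont ell_gt0 ell_d dell_c lower u_sol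
  PhiD dPhi_c PsiD dPsi_c PhiK Phi_le Psi_le Phi_ell W_continuous W_gt0
  (al := 0) (be := T)) => // r; rewrite in_itv/= => /andP[r0 rT].
by rewrite W_reflection// ltW.
Qed.

(** On this range 1 / W y is dphi y * decay eta (phi y). As phi increases from t - ell t to t + ell
    t and [decay] is nonincreasing, the values of [decay] at the two ends bracket the second
    factor. *)
Lemma weight_bounds t y m M : 0 <= t <= T -> t - ell t <= y <= t + ell t ->
  m <= dphi y <= M ->
  m * decay eta (phi (t + ell t)) * W y <= 1 <= M * decay eta (phi (t - ell t)) * W y.
Proof.
move=> tT yI /andP[my yM]; have t0 : 0 <= t by case/andP: tT.
have lt0 := ell_gt0 t0; have [y1 y2] := andP yI.
have PE z : t - ell t <= z <= t + ell t -> Phi z = phi z.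
  by move=> zI; have [] := PhiE (range_itv tT zI).
have [Py dy] := PhiE (range_itv tT yI).
have d0 : 0 < dphi y by rewrite -dy.
have h1 : phi y <= phi (t + ell t).
  rewrite -Py -PE; last by rewrite lexx andbT; lra.
  exact: Phi_le.
have h2 : phi (t - ell t) <= phi y.
  rewrite -Py -PE; last by rewrite lexx/=; lra.
  exact: Phi_le.
have E (c z : R) : c * decay eta z * W y = (c / dphi y) * expR (lam * (phi y - z)).
  rewrite /W dy Py /decay -/lam mulrDr expRD mulrN -mulNr; ring.
rewrite !E; apply/andP; split.
  have e1 : expR (lam * (phi y - phi (t + ell t))) <= 1.
    by rewrite -expR0 ler_expR mulr_ge0_le0 ?lam_ge0// subr_le0.
  have q1 : m / dphi y <= 1 by rewrite ler_pdivrMr// mul1r.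
  apply: (@le_trans _ _ (1 * expR (lam * (phi y - phi (t + ell t))))).
    by rewrite ler_wpM2r ?expR_ge0.
  by rewrite mul1r.
have e1 : 1 <= expR (lam * (phi y - phi (t - ell t))).
  by rewrite -expR0 ler_expR mulr_ge0 ?lam_ge0// subr_ge0.
have q1 : 1 <= M / dphi y by rewrite ler_pdivlMr// mul1r.
by apply: le_trans e1 _; rewrite ler_peMl ?expR_ge0.
Qed.

Lemma sandwich t m M : 0 <= t <= T ->
  (forall y, t - ell t <= y <= t + ell t -> m <= dphi y <= M) ->
  m * decay eta (phi (t + ell t)) * S t <= 4 * energy ell ux ut t <=
  M * decay eta (phi (t - ell t)) * S t.
Proof.
move=> tT dB; have t0 : 0 <= t by case/andP: tT.
have SI := wenergy_integrable u_sol W_continuous t0.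
have EI := wenergy_integrable u_sol (@cst_continuous R R (1 : R)) t0.
have WB x : x \in `]0, ell t[ ->
    (m * decay eta (phi (t + ell t)) * W (t + x) <= 1 <=
       M * decay eta (phi (t - ell t)) * W (t + x)) /\
    (m * decay eta (phi (t + ell t)) * W (t - x) <= 1 <=
       M * decay eta (phi (t - ell t)) * W (t - x)).
  move=> /(itv_pm t)[/andP[a1 a2] /andP[b1 b2] _ _].
  have i1 : t - ell t <= t + x <= t + ell t by rewrite !ltW.
  have i2 : t - ell t <= t - x <= t + ell t by rewrite !ltW.
  by split; apply: weight_bounds => //; exact: dB.
rewrite -energyE// /S /wenergy -!RintegralZl//.
have key (c p q w1 w2 : R) : c * (p ^+ 2 * w1 + q ^+ 2 * w2) =
    p ^+ 2 * (c * w1) + q ^+ 2 * (c * w2) by ring.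
apply/andP; split; apply: le_Rintegral => //; try exact: itgZ.
  move=> x /WB[/andP[h1 _] /andP[h2 _]]; rewrite key.
  by rewrite lerD// ler_wpM2l ?sqr_ge0.
move=> x /WB[/andP[_ h1] /andP[_ h2]]; rewrite key.
by rewrite lerD// ler_wpM2l ?sqr_ge0.
Qed.

End weight.

(** The four bounds are left free so that the extrema of dphi and, for monotone dphi, its end values
    are both instances. [sandwich] brackets the energies at t and t0 by multiples of the same
    constant S, which is then eliminated. *)
Lemma energy_bounds t0 t m M m0 M0 : 0 <= t0 -> t0 <= t -> 0 < m -> 0 < m0 ->
  (forall y, t - ell t <= y <= t + ell t -> m <= dphi y <= M) ->
  (forall y, t0 - ell t0 <= y <= t0 + ell t0 -> m0 <= dphi y <= M0) ->
  (m * decay eta (phi (t + ell t))) / (M0 * decay eta (phi (t0 - ell t0))) *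
    energy ell ux ut t0 <= energy ell ux ut t /\
  energy ell ux ut t <=
  (M * decay eta (phi (t - ell t))) / (m0 * decay eta (phi (t0 + ell t0))) *
    energy ell ux ut t0.
Proof.
move=> t00 t0t m_gt0 m0_gt0 B B0; have t_ge0 := le_trans t00 t0t.
have [Phi [dPhi [Psi [dPsi [[PhiD dPhi_c dPhi_gt0] [PsiD dPsi_c PhiK]
  [Phi_le Psi_le Phi_ell] PhiE]]]]] := phase_extension t_ge0.
have tt : 0 <= t <= t by rewrite t_ge0 lexx.
have tt0 : 0 <= t0 <= t by rewrite t00.
have := sandwich PhiD dPhi_c dPhi_gt0 Phi_le PhiE tt B.
have := sandwich PhiD dPhi_c dPhi_gt0 Phi_le PhiE tt0 B0.
rewrite (wenergy_const PhiD dPhi_c dPhi_gt0 PsiD dPsi_c PhiK Phi_le Psi_le Phi_ell PhiE t_ge0 t00 t0t)//.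
set S := wenergy _ _ _ _ _.
have pos s a b : 0 <= s -> 0 < a -> (forall y, s - ell s <= y <= s + ell s -> a <= dphi y <= b) -> 0 < b.
  move=> s0 a0 /(_ s); rewrite gerBl lerDl (ltW (ell_gt0 s0)) => /(_ isT) /andP[h1 h2].
  exact: lt_le_trans a0 (le_trans h1 h2).
have M_gt0 := pos _ _ _ t_ge0 m_gt0 B; have M0_gt0 := pos _ _ _ t00 m0_gt0 B0.
have key (a A b b' e e0 : R) : 0 < a -> 0 < A -> 0 < b -> 0 < b' ->
    b * S <= 4 * e0 -> 4 * e0 <= b' * S -> a * S <= 4 * e -> 4 * e <= A * S ->
    a / b' * e0 <= e /\ e <= A / b * e0.
  move=> a0 A0 b0 b0' h1 h2 h3 h4; split.
    have q : 4 * e0 / b' <= S by rewrite ler_pdivrMr// (mulrC S).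
    have := ler_wpM2l (ltW a0) q.
    have -> : a * (4 * e0 / b') = 4 * (a / b' * e0) by ring.
    by move=> h5; have := le_trans h5 h3; rewrite ler_pM2l.
  have q : S <= 4 * e0 / b by rewrite ler_pdivlMr// (mulrC S).
  have := ler_wpM2l (ltW A0) q.
  have -> : A * (4 * e0 / b) = 4 * (A / b * e0) by ring.
  by move=> h5; have := le_trans h4 h5; rewrite ler_pM2l.
by move=> /andP[h1 h2] /andP[h3 h4]; apply: key h1 h2 h3 h4; rewrite mulr_gt0 ?decay_gt0.
Qed.

(** The points t - x and t + x sweep the compact interval [t - ell t, t + ell t], on which dphi
    attains its extrema. So the set of values is bounded, [inf] and [sup] are genuine, and the
    attained minimum is positive. *)
Lemma dphi_extrema t : 0 <= t -> 0 < mmin ell dphi t /\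
  forall y, t - ell t <= y <= t + ell t -> mmin ell dphi t <= dphi y <= mmax ell dphi t.
Proof.
move=> t0; have l0 := ell_gt0 t0.
have ll : t - ell t <= t + ell t by lra.
have dc : {within `[t - ell t, t + ell t], continuous dphi}.
  apply: continuous_subspaceW dphi_cont => x /=.
  by rewrite !in_itv/= andbT => /andP[/(le_trans (lower t0))].
have [c cI cm] := EVT_min ll dc; have [C _ CM] := EVT_max ll dc.
have c0 : 0 < dphi c.
  by apply: dphi_gt0; move: cI; rewrite in_itv/= => /andP[/(le_trans (lower t0))].
have vI v : dphi_values ell dphi t v -> exists2 y, y \in `[t - ell t, t + ell t] & v = dphi y.
  by move=> [x /andP[x0 xl] [->|->]]; eexists; try reflexivity; rewrite in_itv/=; apply/andP; split; lra.
have Iv y : t - ell t <= y <= t + ell t -> dphi_values ell dphi t (dphi y).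
  move=> /andP[y1 y2]; have [yt|/ltW ty] := leP y t.
    by exists (t - y); [apply/andP; split; lra|left; rewrite subKr].
  by exists (y - t); [apply/andP; split; lra|right; rewrite addrC subrK].
have lb : lbound (dphi_values ell dphi t) (dphi c) by move=> v /vI[y yI ->]; exact: cm.
have ub : ubound (dphi_values ell dphi t) (dphi C) by move=> v /vI[y yI ->]; exact: CM.
split.
  apply: lt_le_trans c0 _; apply: lb_le_inf => //.
  by exists (dphi t); apply: Iv; apply/andP; split; lra.
move=> y /Iv yv; apply/andP; split.
  by apply: ge_inf => //; exists (dphi c).
by apply: ub_le_sup => //; exists (dphi C).
Qed.

(** For t > 0 this is [dphi_ell] with 1 + dell t <= 1 - dell t. That relation comes from
    differentiation at positive times, so t = 0 is a limit from the right. *)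
Lemma dphi_le_shrinking t0 t1 : 0 <= t0 -> t0 < t1 ->
  (forall t, t0 <= t -> t <= t1 -> dell t <= 0) ->
  forall t, t0 <= t -> t <= t1 -> dphi (t - ell t) <= dphi (t + ell t).
Proof.
move=> t00 t01 dl; have t10 := le_lt_trans t00 t01.
have pos t : 0 < t -> t0 <= t -> t <= t1 -> dphi (t - ell t) <= dphi (t + ell t).
  move=> t_gt0 t0t tt1; have d0 := dl _ t0t tt1; have := dell_lt1 (ltW t_gt0).
  rewrite ltr_norml => /andP[d1 _]; have d1' : 0 < 1 + dell t by lra.
  rewrite -(ler_pM2r d1') dphiE// ler_wpM2l//; last by lra.
  by apply/ltW/dphi_gt0/lower/ltW.
move=> t t0t tt1; have := le_trans t00 t0t; rewrite le_eqVlt => /predU1P[t_eq0|]; last first.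
  by move=> t_gt0; exact: pos.
rewrite -{}t_eq0 in t0t tt1 *; have {t00 t0t} t0_eq0 : t0 = 0 by apply/eqP; rewrite eq_le t0t.
(* At t = 0 the argument - ell 0 is the end of the domain of phi; [dPhi] is continuous on the whole
   line and equals dphi on the relevant range. *)
have [Phi [dPhi [_ [_ [[_ dPhi_c _] _ _ PhiE]]]]] := phase_extension (ltW t10).
have dE s y : 0 <= s -> s <= t1 -> s - ell s <= y <= s + ell s -> dPhi y = dphi y.
  by move=> s0 st sy; have [] := PhiE _ (range_itv _ sy); rewrite ?s0.
have l0 := ell_gt0 (lexx 0).
have lc : ell @ 0^'+ --> ell 0.
  apply: cvg_trans (ell_cvg ell_cont (lexx 0)); apply: cvg_app => P [e /= e0 eP].
  by exists e => // y ye y0; apply: eP => //; exact: ltW.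
have ic : id @ (0 : R)^'+ --> (0 : R) by exact: cvg_at_right_filter.
have E y : 0 - ell 0 <= y <= 0 + ell 0 -> dPhi y = dphi y by apply: dE => //; exact: ltW.
rewrite -!E; try (by apply/andP; split; lra).
have mc : (fun s => dPhi (s - ell s)) @ 0^'+ --> dPhi (0 - ell 0).
  by apply: continuous_cvg; [exact: dPhi_c|exact: cvgB].
have pc : (fun s => dPhi (s + ell s)) @ 0^'+ --> dPhi (0 + ell 0).
  by apply: continuous_cvg; [exact: dPhi_c|exact: cvgD].
apply: (ler_cvg_to mc pc); near=> s.
have s0 : 0 < s by [].
have st : s <= t1 by near: s; exact: nbhs_right_le.
have ls := ell_gt0 (ltW s0).
have Es y : s - ell s <= y <= s + ell s -> dPhi y = dphi y by apply: dE => //; exact: ltW.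
rewrite !Es; [by apply: pos => //; rewrite t0_eq0 ltW| |]; by apply/andP; split; lra.
Unshelve. all: by end_near. Qed.

(** * Consequences of a monotone phase derivative *)

Section phase_monotone.
Variables t0 t1 : R.
Hypotheses (t00 : 0 <= t0) (t01 : t0 < t1).
Let J := `[t0 - ell t0, t1 + ell t1].

Let range_J t y : t0 <= t <= t1 -> t - ell t <= y <= t + ell t -> y \in J.
Proof.
move=> /andP[tt0 tt1] /andP[y1 y2]; rewrite in_itv/=.
rewrite (le_trans (lo_le t00 tt0) y1)/=.
by apply: le_trans y2 (up_le _ tt1); exact: le_trans tt0.
Qed.

Let bounds_nondecreasing : {in J &, {homo dphi : y z / y <= z}} ->
  forall t, t0 <= t <= t1 -> forall y, t - ell t <= y <= t + ell t ->
  dphi (t - ell t) <= dphi y <= dphi (t + ell t).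
Proof.
move=> nd t tI y yI; have [y1 y2] := andP yI; have ll := le_trans y1 y2.
by rewrite !nd//; apply: (range_J tI) => //; rewrite lexx ?andbT.
Qed.

Let bounds_nonincreasing : {in J &, {homo dphi : y z /~ y <= z}} ->
  forall t, t0 <= t <= t1 -> forall y, t - ell t <= y <= t + ell t ->
  dphi (t + ell t) <= dphi y <= dphi (t - ell t).
Proof.
move=> ni t tI y yI; have [y1 y2] := andP yI; have ll := le_trans y1 y2.
by rewrite !ni//; apply: (range_J tI) => //; rewrite lexx ?andbT.
Qed.

Let dphi_pos t y : 0 <= t -> t - ell t <= y -> 0 < dphi y.
Proof. by move=> t_ge0 /(le_trans (lower t_ge0)); exact: dphi_gt0. Qed.

Lemma nondecreasing_bounds : {in J &, {homo dphi : y z / y <= z}} ->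
  forall t, t0 <= t <= t1 ->
  (dphi (t - ell t) * decay eta (phi (t + ell t))) /
    (dphi (t0 + ell t0) * decay eta (phi (t0 - ell t0))) * energy ell ux ut t0
    <= energy ell ux ut t /\
  energy ell ux ut t <=
  (dphi (t + ell t) * decay eta (phi (t - ell t))) /
    (dphi (t0 - ell t0) * decay eta (phi (t0 + ell t0))) * energy ell ux ut t0.
Proof.
move=> nd t tI; have [tt0 tt1] := andP tI; have t_ge0 := le_trans t00 tt0.
apply: energy_bounds => //.
- exact: (dphi_pos t_ge0).
- exact: (dphi_pos t00).
- exact: bounds_nondecreasing.
- by apply: bounds_nondecreasing => //; rewrite lexx ltW.
Qed.

Lemma nonincreasing_bounds : {in J &, {homo dphi : y z /~ y <= z}} ->
  forall t, t0 <= t <= t1 ->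
  (dphi (t + ell t) * decay eta (phi (t + ell t))) /
    (dphi (t0 - ell t0) * decay eta (phi (t0 - ell t0))) * energy ell ux ut t0
    <= energy ell ux ut t /\
  energy ell ux ut t <=
  (dphi (t - ell t) * decay eta (phi (t - ell t))) /
    (dphi (t0 + ell t0) * decay eta (phi (t0 + ell t0))) * energy ell ux ut t0.
Proof.
move=> ni t tI; have [tt0 tt1] := andP tI; have t_ge0 := le_trans t00 tt0.
have l1 := ell_gt0 t_ge0; have l0 := ell_gt0 t00.
apply: energy_bounds => //.
- by apply: (dphi_pos t_ge0); lra.
- by apply: (dphi_pos t00); lra.
- exact: bounds_nonincreasing.
- by apply: bounds_nonincreasing => //; rewrite lexx ltW.
Qed.

(* If [dphi] were nonincreasing, it would be constant on each [t - ell t, t + ell t],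
   and these intervals form a chain. *)
Lemma shrinking_nondecreasing :
  {in J &, {homo dphi : y z / y <= z}} \/ {in J &, {homo dphi : y z /~ y <= z}} ->
  (forall t, t0 <= t -> t <= t1 -> dphi (t - ell t) <= dphi (t + ell t)) ->
  {in J &, {homo dphi : y z / y <= z}}.
Proof.
move=> [//|ni] le_dphi.
have cst_on t y z : t0 <= t <= t1 -> t - ell t <= y <= t + ell t ->
    t - ell t <= z <= t + ell t -> dphi y = dphi z.
  move=> tI yI zI; have [tt0 tt1] := andP tI; have h := le_dphi t tt0 tt1.
  have /andP[a1 a2] := bounds_nonincreasing ni tI yI.
  have /andP[b1 b2] := bounds_nonincreasing ni tI zI.
  apply/eqP; rewrite eq_le; apply/andP; split; first exact: le_trans a2 (le_trans h b1).
  exact: le_trans b2 (le_trans h a1).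
(* Times s <= t with t - s <= d both lie in [t - ell t, t + ell t], so finitely many steps carry the
   value of dphi along [t0, t1]. *)
have [d d0 dl] := ell_lower_bound ell_cont ell_gt0 t00 (ltW t01).
have mid t : t0 <= t -> t - ell t <= t <= t + ell t.
  by move=> tt0; rewrite gerBl lerDl ltW ?ell_gt0// (le_trans t00).
have chain : forall s t, t0 <= s -> s <= t -> t <= t1 -> dphi s <= dphi t.
  move=> s t h1 h2 h3; rewrite -lerN2.
  apply: (chain_nonincreasing (F := fun t => - dphi t) d0 _ h1 h2 h3).
  move=> {}s {}t {}h1 {}h2 {}h3 ts; rewrite lerN2.
  have tt0 := le_trans h1 h2; have tI : t0 <= t <= t1 by rewrite tt0.
  have dt : d <= ell t by apply: dl; rewrite in_itv.
  by rewrite (cst_on t s t)// ?mid//; apply/andP; split; have := ell_gt0 (le_trans t00 tt0); lra.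
have tI0 : t0 <= t0 <= t1 by rewrite lexx ltW.
have tI1 : t0 <= t1 <= t1 by rewrite lexx ltW.
have mid_const t : t0 <= t <= t1 -> dphi t = dphi t0.
  move=> tI; have [tt0 tt1] := andP tI; apply/eqP; rewrite eq_le (chain t0 t)// andbT.
  have tJ0 := range_J tI0 (mid t0 (lexx t0)); have tJ := range_J tI (mid t tt0).
  exact: ni.
have const y : y \in J -> dphi y = dphi t0.
  rewrite in_itv/= => /andP[y1 y2].
  have [h|/ltW h] := leP y t0.
    by apply: (cst_on t0) => //; [apply/andP; split => //; have := ell_gt0 t00; lra|exact: mid].
  have [h'|/ltW h'] := leP y t1; first by apply: mid_const; rewrite h.
  rewrite -(mid_const t1)//; apply: (cst_on t1) => //; last by apply: mid; exact: ltW.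
  by apply/andP; split => //; have := ell_gt0 (le_trans t00 (ltW t01)); lra.
by move=> y z yJ zJ _; rewrite !const.
Qed.

(** One time is enough: at t1, [dphi_ell] with dell t1 > 0 forces dphi (t1 + ell t1) < dphi (t1 -
    ell t1), which a nondecreasing dphi contradicts. *)
Lemma growing_nonincreasing :
  {in J &, {homo dphi : y z / y <= z}} \/ {in J &, {homo dphi : y z /~ y <= z}} ->
  0 < dell t1 -> {in J &, {homo dphi : y z /~ y <= z}}.
Proof.
move=> [nd|//] d0; have t10 := le_lt_trans t00 t01.
have tI1 : t0 <= t1 <= t1 by rewrite lexx ltW.
have l1 := ell_gt0 (ltW t10).
have m1 : t1 - ell t1 <= t1 <= t1 + ell t1 by apply/andP; split; lra.
have /andP[a1 a2] := bounds_nondecreasing nd tI1 m1.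
have p0 : 0 < dphi (t1 + ell t1) by apply: (dphi_pos (ltW t10)); lra.
have E := dphiE t10; have h := le_trans a1 a2.
have d1 : 0 < 1 - dell t1 by have := dell_lt1 (ltW t10); rewrite ltr_norml => /andP[]; lra.
have := ler_wpM2r (ltW d1) h; rewrite -E ler_pM2l//.
lra.
Qed.

(** For om = 1 the condition of [wenergy_nonincreasing] reads kap^2 (1 - dell r) <= 1 + dell r; it
    follows from kap^2 <= 1 and 0 < dell r < 1. *)
Lemma growing_energy : (forall t, t0 <= t <= t1 -> 0 < dell t) ->
  {in `[t0, t1] &, {homo energy ell ux ut : s t /~ s <= t}}.
Proof.
move=> d0; have t10 := le_lt_trans t00 t01.
have [Phi [dPhi [Psi [dPsi [[PhiD dPhi_c dPhi_gt0] [PsiD dPsi_c PhiK]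
  [Phi_le Psi_le Phi_ell] PhiE]]]]] := phase_extension (ltW t10).
move=> t s; rewrite !in_itv/= => /andP[tt0 tt1] /andP[st0 st1] st.
have s0 := le_trans t00 st0; have t_ge0 := le_trans t00 tt0.
suff : wenergy ell ux ut (cst 1) t <= wenergy ell ux ut (cst 1) s.
  by rewrite !energyE// ler_pM2l.
apply: (wenergy_nonincreasing eta_gt0 eta_neq1 ell_cont ell_gt0 ell_d dell_c lower u_sol
    PhiD dPhi_c PsiD dPsi_c PhiK Phi_le Psi_le Phi_ell (@cst_continuous R R (1 : R))
    (fun=> ltr01) t00 (ltW t01) (lexx t1)) => // r; rewrite in_itv/= => /andP[r0 r1].
rewrite !mulr1; have dr : 0 < dell r by apply: d0; rewrite !ltW.
have dr1 : 0 <= 1 - dell r.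
  have := dell_lt1 (le_trans t00 (ltW r0)); rewrite ltr_norml => /andP[_].
  by rewrite subr_ge0 => /ltW.
apply: (@le_trans _ _ (1 * (1 - dell r))); first by rewrite ler_wpM2r// kap2_le1.
by rewrite mul1r lerD2l lerNl (le_trans _ (ltW dr))// oppr_le0 ltW.
Qed.

End phase_monotone.


End bounds.

Unset Implicit Arguments.

(** Monotonicity of phi' for times in [t0, t1] is read on [t0 - ell t0, t1 + ell t1], which contains
    all arguments t - x and t + x with 0 <= x <= ell t at these times. *)
Theorem corollary5 (R : realType) (eta : R)
    (ell dell phi dphi u0 u1 : R -> R) (u ux ut : R -> R -> R)
    (eta_gt0 : 0 < eta) (eta_neq1 : eta != 1)
    (ell_cont : {within `[0, +oo[, continuous ell})
    (ell_gt0 : forall t, 0 <= t -> 0 < ell t)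
    (ell_deriv : deriv_within `[0, +oo[ ell dell)
    (dell_lt1 : forall t, 0 <= t -> `|dell t| < 1)
    (phi_deriv : deriv_within `[- ell 0, +oo[ phi dphi)
    (dphi_cont : {within `[- ell 0, +oo[, continuous dphi})
    (dphi_gt0 : forall y, - ell 0 <= y -> 0 < dphi y)
    (phi_ell : forall t, 0 <= t -> phi (t + ell t) - phi (t - ell t) = 2)
    (u0_V0 : exists du0, inV0 (ell 0) u0 du0)
    (u1_L2 : inL2 (ell 0) u1)
    (u_sol : wave_solution eta ell dell u0 u1 u ux ut) :
  (forall t0 t, 0 <= t0 -> t0 < t ->
     (mmin ell dphi t * decay eta (phi (t + ell t)))
       / (mmax ell dphi t0 * decay eta (phi (t0 - ell t0)))
       * energy ell ux ut t0 <= energy ell ux ut t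
     /\
     energy ell ux ut t <=
     (mmax ell dphi t * decay eta (phi (t - ell t)))
       / (mmin ell dphi t0 * decay eta (phi (t0 + ell t0)))
       * energy ell ux ut t0)
  /\
  (forall t0 t1, 0 <= t0 -> t0 < t1 ->
     ({in `[t0 - ell t0, t1 + ell t1] &, {homo dphi : y z / y <= z}} \/
      {in `[t0 - ell t0, t1 + ell t1] &, {homo dphi : y z /~ y <= z}}) ->
     ((forall t, t0 <= t <= t1 -> -1 < dell t /\ dell t <= 0) ->
        {in `[t0 - ell t0, t1 + ell t1] &, {homo dphi : y z / y <= z}}
        /\
        (forall t, t0 <= t <= t1 ->
           (dphi (t - ell t) * decay eta (phi (t + ell t)))
             / (dphi (t0 + ell t0) * decay eta (phi (t0 - ell t0)))
             * energy ell ux ut t0 <= energy ell ux ut t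
           /\
           energy ell ux ut t <=
           (dphi (t + ell t) * decay eta (phi (t - ell t)))
             / (dphi (t0 - ell t0) * decay eta (phi (t0 + ell t0)))
             * energy ell ux ut t0))
     /\
     ((forall t, t0 <= t <= t1 -> 0 < dell t /\ dell t < 1) ->
        {in `[t0 - ell t0, t1 + ell t1] &, {homo dphi : y z /~ y <= z}}
        /\
        {in `[t0, t1] &, {homo energy ell ux ut : s t /~ s <= t}}
        /\
        (forall t, t0 <= t <= t1 ->
           (dphi (t + ell t) * decay eta (phi (t + ell t)))
             / (dphi (t0 - ell t0) * decay eta (phi (t0 - ell t0)))
             * energy ell ux ut t0 <= energy ell ux ut t
           /\
           energy ell ux ut t <=
           (dphi (t - ell t) * decay eta (phi (t - ell t)))
             / (dphi (t0 + ell t0) * decay eta (phi (t0 + ell t0)))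
             * energy ell ux ut t0))).
Proof.
split.
  move=> t0 t t0_ge0 t0t; have t_ge0 := le_trans t0_ge0 (ltW t0t).
  have [m_gt0 B] := dphi_extrema ell_cont ell_gt0 ell_deriv dell_lt1 dphi_cont dphi_gt0 t_ge0.
  have [m0_gt0 B0] := dphi_extrema ell_cont ell_gt0 ell_deriv dell_lt1 dphi_cont dphi_gt0 t0_ge0.
  exact: (energy_bounds eta_gt0 eta_neq1 ell_cont ell_gt0 ell_deriv dell_lt1 phi_deriv
    dphi_cont dphi_gt0 phi_ell u_sol t0_ge0 (ltW t0t)).
move=> t0 t1 t0_ge0 t01 mono; have t1_gt0 := le_lt_trans t0_ge0 t01.
split=> dell_sign.
  have nd : {in `[t0 - ell t0, t1 + ell t1] &, {homo dphi : y z / y <= z}}.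
    apply: (shrinking_nondecreasing ell_cont ell_gt0 ell_deriv dell_lt1 t0_ge0 t01 mono).
    move=> t t0t tt1.
    apply: (dphi_le_shrinking ell_cont ell_gt0 ell_deriv dell_lt1 phi_deriv dphi_cont
      dphi_gt0 phi_ell t0_ge0 t01) => // r r0 rt1.
    by have [|_ ->] := dell_sign r; first exact/andP.
  split=> //; exact: (nondecreasing_bounds eta_gt0 eta_neq1 ell_cont ell_gt0 ell_deriv
    dell_lt1 phi_deriv dphi_cont dphi_gt0 phi_ell u_sol t0_ge0 t01 nd).
have ni : {in `[t0 - ell t0, t1 + ell t1] &, {homo dphi : y z /~ y <= z}}.
  apply: (growing_nonincreasing ell_cont ell_gt0 ell_deriv dell_lt1 phi_deriv dphi_gt0
    phi_ell t0_ge0 t01 mono).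
  by have [|] := dell_sign t1; first by rewrite lexx ltW.
split=> //; split.
  apply: (growing_energy eta_gt0 eta_neq1 ell_cont ell_gt0 ell_deriv dell_lt1 phi_deriv
    dphi_cont dphi_gt0 phi_ell u_sol t0_ge0 t01).
  by move=> t /dell_sign[].
exact: (nonincreasing_bounds eta_gt0 eta_neq1 ell_cont ell_gt0 ell_deriv dell_lt1
  phi_deriv dphi_cont dphi_gt0 phi_ell u_sol t0_ge0 t01 ni).
Qed.
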